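(* Let $f,g\in H^1(\mathbb{D})$ satisfy $|f|=|g|$ almost everywhere on $\mathbb{T}$ (in the sense of radial limits) and on $r\mathbb{T}$ for some $0<r<1$. Then $f=\lambda g$ for some $\lambda\in\mathbb{T}$.
   Context: $\mathbb{D}$ is the open unit disc, $\mathbb{T}$ the unit circle, $r\mathbb{T}=\{z:|z|=r\}$, and $H^1(\mathbb{D})$ is the Hardy space of analytic functions on $\mathbb{D}$ with $\sup_{0<\rho<1}\int_0^{2\pi}|f(\rho e^{it})|\,dt<\infty$. *)

(* Defs.v *)
From Stdlib Require Import Reals.
From Coquelicot Require Import Coquelicot.
Open Scope R_scope.

Definition polar (rho t : R) : C := (rho * cos t, rho * sin t).

Definition holo_disc (f : C -> C) : Prop :=
  forall z : C, Cmod z < 1 -> @ex_derive C_AbsRing C_NormedModule f z.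

Definition H1 (f : C -> C) : Prop :=
  holo_disc f /\
  exists M : R, forall rho : R, 0 < rho < 1 ->
    RInt (fun t => Cmod (f (polar rho t))) 0 (2 * PI) <= M.

Definition null_set (N : R -> Prop) : Prop :=
  forall eps : R, 0 < eps ->
    exists a b : nat -> R,
      (forall n, a n <= b n) /\
      (forall x, N x -> exists n, a n < x < b n) /\
      (forall n, sum_f_R0 (fun k => b k - a k) n <= eps).

Definition ae_circle (P : R -> Prop) : Prop :=
  null_set (fun t => 0 <= t <= 2 * PI /\ ~ P t).

Definition radial_limit (f : C -> C) (t : R) (L : C) : Prop :=
  filterlim (fun rho => f (polar rho t)) (at_left 1) (locally L).

(* Main.v *)
(** Put [q = r^2].  Since [|f| = |g|] on [r T], Schwarz reflection in that circle gives
    [f(z) conj f(q / conj z) = g(z) conj g(q / conj z)] on [q < |z| < 1].  Letting [z] tend radially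
    to [e^{it}], the equality of moduli on the unit circle gives [|f| = |g|] at [q e^{it}] wherever
    the radial limit of [f] is nonzero.  That limit cannot vanish almost everywhere unless [f = 0],
    so [|f| = |g|] at infinitely many points of [q T], hence on all of it.  Combining the reflections
    in the circles of squared radius [q] and [q^2] yields [f(w) g(q w) = g(w) f(q w)] on the disc.
    Comparing orders of vanishing at 0, first for [(f, g)] and then for [(b f - a g, g)] with [a], [b]
    the leading coefficients, forces [b f = a g]. *)
Require Import Defs.
From Stdlib Require Import Reals.
From Coquelicot Require Import Coquelicot.
From Stdlib Require Import Lra Lia Psatz Classical ClassicalEpsilon.
Open Scope R_scope.

(** * Complex differentiability *)

(** With h = f / g, each reflection identity says that h(z) is the reciprocal of the conjugate of h
    at the mirror image of z. Two reflections in concentric circles compose to a dilation, here by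
    q, so h(q z) = h(z), and a function meromorphic at 0 with this invariance is constant. The
    identities are kept multiplied out, and orders of vanishing stand in for meromorphic quotients.
    The modulus of the constant is read off on r T. The costly input is that radial limits vanishing
    almost everywhere force f = 0. Integrals here are Riemann integrals and null sets are given by
    interval covers, so boundary functions are never integrated: the argument stays on circles of
    radius below 1, where bounded convergence for continuous functions makes |f| small outside a set
    of small measure. On that set only the integral of |f| is controlled, so f is multiplied by a
    holomorphic factor that is small there but not at 0. *)

Definition ccont (f : C -> C) (z : C) : Prop :=
  forall eps, 0 < eps -> exists d, 0 < d /\
    forall w, Cmod (w - z) < d -> Cmod (f w - f z) < eps.

(* Caratheodory's form of complex differentiability at a point. *)
Definition cdiff (f : C -> C) (z : C) : Prop :=
  exists (phi : C -> C) (d : R), 0 < d /\ ccont phi z /\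
    forall w, Cmod (w - z) < d -> f w = (f z + phi w * (w - z))%C.

Lemma Cmod_sub_sym (a b : C) : Cmod (a - b) = Cmod (b - a).
Proof. rewrite <- Cmod_opp. f_equal. ring. Qed.

Lemma Cmod_sub_self (a : C) : Cmod (a - a) = 0.
Proof. replace (a - a)%C with (RtoC 0) by ring. apply Cmod_0. Qed.

Lemma Cmod_triangle_sub (a b : C) : Cmod a <= Cmod (a - b) + Cmod b.
Proof.
  replace a with ((a - b) + b)%C at 1 by ring. apply Cmod_triangle.
Qed.

Lemma Cmod_minus_le (a b : C) : Cmod (a - b) <= Cmod a + Cmod b.
Proof.
  unfold Cminus. rewrite <- (Cmod_opp b). apply Cmod_triangle.
Qed.

Lemma ccont_const (c z : C) : ccont (fun _ => c) z.
Proof.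
  intros e He. exists 1. split; [lra|]. intros w _. rewrite Cmod_sub_self. exact He.
Qed.

Lemma ccont_id (z : C) : ccont (fun w => w) z.
Proof. intros e He. exists e. auto. Qed.

Lemma ccont_ext_loc (f g : C -> C) (z : C) (d : R) :
  0 < d -> (forall w, Cmod (w - z) < d -> f w = g w) -> ccont f z -> ccont g z.
Proof.
  intros Hd He Hf e Hp. destruct (Hf e Hp) as [d1 [H1 H2]].
  exists (Rmin d d1). split; [apply Rmin_pos; assumption|].
  intros w Hw. assert (Cmod (w - z) < d /\ Cmod (w - z) < d1) as [Ha Hb].
  { split; eapply Rlt_le_trans; [exact Hw|apply Rmin_l|exact Hw|apply Rmin_r]. }
  rewrite <- (He w Ha), <- (He z); [auto|]. rewrite Cmod_sub_self. exact Hd.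
Qed.

Lemma ccont_plus (f g : C -> C) (z : C) :
  ccont f z -> ccont g z -> ccont (fun w => f w + g w)%C z.
Proof.
  intros Hf Hg e He. destruct (Hf (e/2)) as [d1 [H1 H2]]; [lra|].
  destruct (Hg (e/2)) as [d2 [H3 H4]]; [lra|].
  exists (Rmin d1 d2). split; [apply Rmin_pos; assumption|].
  intros w Hw.
  assert (Ha : Cmod (w - z) < d1) by (eapply Rlt_le_trans; [exact Hw|apply Rmin_l]).
  assert (Hb : Cmod (w - z) < d2) by (eapply Rlt_le_trans; [exact Hw|apply Rmin_r]).
  replace (f w + g w - (f z + g z))%C with ((f w - f z) + (g w - g z))%C by ring.
  pose proof (Cmod_triangle (f w - f z) (g w - g z)).
  specialize (H2 w Ha). specialize (H4 w Hb). lra.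
Qed.

Lemma ccont_mult (f g : C -> C) (z : C) :
  ccont f z -> ccont g z -> ccont (fun w => f w * g w)%C z.
Proof.
  intros Hf Hg e He.
  set (A := Cmod (f z)). set (B := Cmod (g z)).
  assert (HA : 0 <= A) by apply Cmod_ge_0. assert (HB : 0 <= B) by apply Cmod_ge_0.
  (* If both increments are below h <= 1, the expanded difference is at most h (h + B + A) <= h (A +
     B + 1) <= e / 2. *)
  set (h := Rmin 1 (e / (2 * (A + B + 1)))).
  assert (Hh : 0 < h).
  { apply Rmin_pos; [lra|]. apply Rdiv_lt_0_compat; lra. }
  assert (Hh2 : h * (A + B + 1) <= e / 2).
  { assert (h <= e / (2 * (A + B + 1))) by apply Rmin_r.
    replace (e / 2) with (e / (2 * (A + B + 1)) * (A + B + 1)) by (field; lra).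
    apply Rmult_le_compat_r; lra. }
  assert (Hh1 : h <= 1) by apply Rmin_l.
  destruct (Hf h Hh) as [d1 [H1 H2]]. destruct (Hg h Hh) as [d2 [H3 H4]].
  exists (Rmin d1 d2). split; [apply Rmin_pos; assumption|].
  intros w Hw.
  assert (Ha : Cmod (w - z) < d1) by (eapply Rlt_le_trans; [exact Hw|apply Rmin_l]).
  assert (Hb : Cmod (w - z) < d2) by (eapply Rlt_le_trans; [exact Hw|apply Rmin_r]).
  specialize (H2 w Ha). specialize (H4 w Hb).
  replace (f w * g w - f z * g z)%C with
    ((f w - f z) * (g w - g z) + ((f w - f z) * g z + f z * (g w - g z)))%C by ring.
  eapply Rle_lt_trans; [apply Cmod_triangle|].
  eapply Rle_lt_trans; [apply Rplus_le_compat_l, Cmod_triangle|].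
  rewrite !Cmod_mult. fold A B.
  pose proof (Cmod_ge_0 (f w - f z)). pose proof (Cmod_ge_0 (g w - g z)).
  nra.
Qed.

Lemma ccont_opp (f : C -> C) (z : C) : ccont f z -> ccont (fun w => - f w)%C z.
Proof.
  intros Hf e He. destruct (Hf e He) as [d [H1 H2]]. exists d. split; [auto|].
  intros w Hw. replace (- f w - - f z)%C with (- (f w - f z))%C by ring.
  rewrite Cmod_opp. auto.
Qed.

Lemma ccont_minus (f g : C -> C) (z : C) :
  ccont f z -> ccont g z -> ccont (fun w => f w - g w)%C z.
Proof. intros Hf Hg. apply ccont_plus; [exact Hf|apply ccont_opp, Hg]. Qed.

Lemma ccont_comp (f g : C -> C) (z : C) :
  ccont g z -> ccont f (g z) -> ccont (fun w => f (g w)) z.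
Proof.
  intros Hg Hf e He. destruct (Hf e He) as [d [H1 H2]].
  destruct (Hg d H1) as [d' [H3 H4]]. exists d'. auto.
Qed.

Lemma ccont_neq0 (f : C -> C) (z : C) : ccont f z -> f z <> 0 ->
  exists d, 0 < d /\ forall w, Cmod (w - z) < d -> Cmod (f z) / 2 < Cmod (f w).
Proof.
  intros Hf Hz. apply Cmod_gt_0 in Hz.
  destruct (Hf (Cmod (f z) / 2)) as [d [H1 H2]]; [lra|].
  exists d. split; [auto|]. intros w Hw. specialize (H2 w Hw).
  pose proof (Cmod_triangle_sub (f z) (f w)) as H. rewrite Cmod_sub_sym in H. lra.
Qed.

Lemma Cmod_pos_neq0 (x : C) : 0 < Cmod x -> x <> 0.
Proof. apply Cmod_gt_0. Qed.

Lemma ccont_inv (f : C -> C) (z : C) : ccont f z -> f z <> 0 -> ccont (fun w => / f w)%C z.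
Proof.
  intros Hf Hz e He. destruct (ccont_neq0 f z Hf Hz) as [d [H1 H2]].
  pose proof (proj1 (Cmod_gt_0 _) Hz) as Hp. set (A := Cmod (f z)) in *.
  (* The difference of reciprocals is |f w - f z| / (|f w| A), and |f w| > A / 2 near z. *)
  destruct (Hf (e * (A * A / 2))) as [d1 [H3 H4]].
  { apply Rmult_lt_0_compat; nra. }
  exists (Rmin d d1). split; [apply Rmin_pos; assumption|].
  intros w Hw.
  assert (Ha : Cmod (w - z) < d) by (eapply Rlt_le_trans; [exact Hw|apply Rmin_l]).
  assert (Hb : Cmod (w - z) < d1) by (eapply Rlt_le_trans; [exact Hw|apply Rmin_r]).
  specialize (H2 w Ha). specialize (H4 w Hb).
  assert (Hw0 : f w <> 0) by (apply Cmod_pos_neq0; lra).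
  replace (/ f w - / f z)%C with ((f z - f w) / (f w * f z))%C by (field; auto).
  rewrite Cmod_div by (apply Cmult_neq_0; auto).
  rewrite Cmod_mult, Cmod_sub_sym. fold A.
  apply Rmult_lt_reg_r with (Cmod (f w) * A); [nra|].
  replace (Cmod (f w - f z) / (Cmod (f w) * A) * (Cmod (f w) * A)) with (Cmod (f w - f z))
    by (field; lra).
  eapply Rlt_trans; [exact H4|]. apply Rmult_lt_compat_l; [lra|]. nra.
Qed.

Lemma ccont_div (f g : C -> C) (z : C) :
  ccont f z -> ccont g z -> g z <> 0 -> ccont (fun w => f w / g w)%C z.
Proof. intros Hf Hg Hz. apply ccont_mult; [exact Hf|apply ccont_inv; auto]. Qed.

Lemma ccont_pow (f : C -> C) (n : nat) (z : C) : ccont f z -> ccont (fun w => f w ^ n)%C z.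
Proof.
  intros Hf. induction n as [|n IH]; simpl; [apply ccont_const|].
  apply ccont_mult; auto.
Qed.

Lemma ccont_conj (f : C -> C) (z : C) : ccont f z -> ccont (fun w => Cconj (f w)) z.
Proof.
  intros Hf e He. destruct (Hf e He) as [d [H1 H2]]. exists d. split; [auto|].
  intros w Hw. rewrite <- Cminus_conj, Cmod_conj. auto.
Qed.

Lemma cdiff_ccont (f : C -> C) (z : C) : cdiff f z -> ccont f z.
Proof.
  intros [phi [d [Hd [Hp He]]]].
  apply (ccont_ext_loc (fun w => f z + phi w * (w - z))%C f z d Hd).
  { intros w Hw. symmetry. auto. }
  apply ccont_plus; [apply ccont_const|]. apply ccont_mult; [exact Hp|].
  apply ccont_minus; [apply ccont_id|apply ccont_const].
Qed.

Lemma cdiff_ext_loc (f g : C -> C) (z : C) (d : R) :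
  0 < d -> (forall w, Cmod (w - z) < d -> f w = g w) -> cdiff f z -> cdiff g z.
Proof.
  intros Hd Hfg [phi [d1 [H1 [Hp He]]]]. exists phi, (Rmin d d1).
  split; [apply Rmin_pos; auto|]. split; [exact Hp|]. intros w Hw.
  rewrite <- (Hfg w), <- (Hfg z).
  - apply He. eapply Rlt_le_trans; [exact Hw|apply Rmin_r].
  - rewrite Cmod_sub_self. auto.
  - eapply Rlt_le_trans; [exact Hw|apply Rmin_l].
Qed.

Lemma cdiff_const (c z : C) : cdiff (fun _ => c) z.
Proof.
  exists (fun _ => RtoC 0), 1. split; [lra|]. split; [apply ccont_const|]. intros. ring.
Qed.

Lemma cdiff_id (z : C) : cdiff (fun w => w) z.
Proof.
  exists (fun _ => RtoC 1), 1. split; [lra|]. split; [apply ccont_const|]. intros. ring.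
Qed.

Lemma cdiff_plus (f g : C -> C) (z : C) :
  cdiff f z -> cdiff g z -> cdiff (fun w => f w + g w)%C z.
Proof.
  intros [p [d [Hd [Hp He]]]] [p' [d' [Hd' [Hp' He']]]].
  exists (fun w => p w + p' w)%C, (Rmin d d').
  split; [apply Rmin_pos; auto|]. split; [apply ccont_plus; auto|]. intros w Hw.
  rewrite (He w), (He' w); [ring| |]; eapply Rlt_le_trans;
    [exact Hw|apply Rmin_r|exact Hw|apply Rmin_l].
Qed.

Lemma cdiff_mult (f g : C -> C) (z : C) :
  cdiff f z -> cdiff g z -> cdiff (fun w => f w * g w)%C z.
Proof.
  intros Hf Hg. pose proof (cdiff_ccont g z Hg) as Hgc. revert Hf Hg.
  intros [p [d [Hd [Hp He]]]] [p' [d' [Hd' [Hp' He']]]].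
  exists (fun w => p w * g w + f z * p' w)%C, (Rmin d d').
  split; [apply Rmin_pos; auto|].
  split; [apply ccont_plus; apply ccont_mult; auto; apply ccont_const|]. intros w Hw.
  rewrite (He w), (He' w); [ring| |]; eapply Rlt_le_trans;
    [exact Hw|apply Rmin_r|exact Hw|apply Rmin_l].
Qed.

Lemma cdiff_opp (f : C -> C) (z : C) : cdiff f z -> cdiff (fun w => - f w)%C z.
Proof.
  intros H. apply (cdiff_ext_loc (fun w => (-(1)) * f w)%C _ z 1); [lra|intros; ring|].
  apply cdiff_mult; [apply cdiff_const|exact H].
Qed.

Lemma cdiff_minus (f g : C -> C) (z : C) :
  cdiff f z -> cdiff g z -> cdiff (fun w => f w - g w)%C z.
Proof. intros Hf Hg. apply cdiff_plus; [exact Hf|apply cdiff_opp, Hg]. Qed.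

Lemma cdiff_comp (f g : C -> C) (z : C) :
  cdiff g z -> cdiff f (g z) -> cdiff (fun w => f (g w)) z.
Proof.
  intros Hg Hf. pose proof (cdiff_ccont g z Hg) as Hgc. revert Hf Hg.
  intros [p [d [Hd [Hp He]]]] [p' [d' [Hd' [Hp' He']]]].
  destruct (Hgc d Hd) as [d2 [H1 H2]].
  exists (fun w => p (g w) * p' w)%C, (Rmin d' d2).
  split; [apply Rmin_pos; auto|].
  split; [apply ccont_mult; auto; apply (ccont_comp p g); auto|]. intros w Hw.
  assert (Ha : Cmod (w - z) < d') by (eapply Rlt_le_trans; [exact Hw|apply Rmin_l]).
  assert (Hb : Cmod (w - z) < d2) by (eapply Rlt_le_trans; [exact Hw|apply Rmin_r]).
  rewrite (He (g w)) by auto. rewrite (He' w Ha) at 2. ring.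
Qed.

Lemma cdiff_inv (f : C -> C) (z : C) : cdiff f z -> f z <> 0 -> cdiff (fun w => / f w)%C z.
Proof.
  intros Hf Hz. pose proof (cdiff_ccont f z Hf) as Hc.
  destruct (ccont_neq0 f z Hc Hz) as [d1 [H1 H2]].
  destruct Hf as [p [d [Hd [Hp He]]]].
  exists (fun w => - p w / (f w * f z))%C, (Rmin d d1).
  split; [apply Rmin_pos; auto|]. split.
  - apply ccont_div; [apply ccont_opp; auto| |apply Cmult_neq_0; auto].
    apply ccont_mult; [auto|apply ccont_const].
  - intros w Hw.
    assert (Ha : Cmod (w - z) < d) by (eapply Rlt_le_trans; [exact Hw|apply Rmin_l]).
    assert (Hb : Cmod (w - z) < d1) by (eapply Rlt_le_trans; [exact Hw|apply Rmin_r]).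
    assert (Hw0 : f w <> 0).
    { apply Cmod_pos_neq0. specialize (H2 w Hb). pose proof (Cmod_ge_0 (f z)). lra. }
    assert (E : (p w * (w - z) = f w - f z)%C) by (rewrite (He w Ha); ring).
    replace (- p w / (f w * f z) * (w - z))%C with (- (p w * (w - z)) / (f w * f z))%C
      by (field; auto).
    rewrite E. field. auto.
Qed.

Lemma cdiff_div (f g : C -> C) (z : C) :
  cdiff f z -> cdiff g z -> g z <> 0 -> cdiff (fun w => f w / g w)%C z.
Proof. intros Hf Hg Hz. apply cdiff_mult; [exact Hf|apply cdiff_inv; auto]. Qed.

Lemma cdiff_pow (f : C -> C) (n : nat) (z : C) : cdiff f z -> cdiff (fun w => f w ^ n)%C z.
Proof.
  intros Hf. induction n as [|n IH]; simpl; [apply cdiff_const|].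
  apply cdiff_mult; auto.
Qed.

(** Schwarz reflection in the real axis; composed with z |-> q / z it becomes reflection in a
    circle. *)
Lemma cdiff_conj_conj (f : C -> C) (z : C) :
  cdiff f (Cconj z) -> cdiff (fun w => Cconj (f (Cconj w))) z.
Proof.
  intros [p [d [Hd [Hp He]]]]. exists (fun w => Cconj (p (Cconj w))), d.
  split; [auto|]. split.
  - apply ccont_conj. apply (ccont_comp p Cconj); [apply ccont_conj, ccont_id|exact Hp].
  - intros w Hw. rewrite (He (Cconj w)).
    + rewrite Cplus_conj, Cmult_conj, Cminus_conj, !Cconj_conj. reflexivity.
    + rewrite <- Cminus_conj, Cmod_conj. auto.
Qed.

Lemma sub_neq0 (w z : C) : w <> z -> (w - z)%C <> 0.
Proof.
  intros n H. apply n. replace w with ((w - z) + z)%C by ring. rewrite H. ring.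
Qed.

Lemma cdiff_of_eps (f : C -> C) (z l : C) :
  (forall e, 0 < e -> exists d, 0 < d /\ forall w, Cmod (w - z) < d ->
     Cmod (f w - f z - l * (w - z)) <= e * Cmod (w - z)) -> cdiff f z.
Proof.
  intros Hl.
  exists (fun w => if excluded_middle_informative (w = z) then l
                   else ((f w - f z) / (w - z))%C), 1.
  split; [lra|]. split.
  - intros e He. destruct (Hl (e / 2)) as [d [Hd0 Hd]]; [lra|].
    exists d. split; [exact Hd0|].
    intros w Hw. destruct (excluded_middle_informative (z = z)) as [_|n]; [|easy].
    destruct (excluded_middle_informative (w = z)) as [->|n].
    + rewrite Cmod_sub_self. exact He.
    + specialize (Hd w Hw). pose proof (sub_neq0 _ _ n) as Hn.
      replace ((f w - f z) / (w - z) - l)%C with ((f w - f z - l * (w - z)) / (w - z))%C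
        by (field; auto).
      rewrite Cmod_div by auto. apply Cmod_gt_0 in Hn.
      apply Rle_lt_trans with (e / 2); [|lra].
      apply Rmult_le_reg_r with (Cmod (w - z)); [auto|].
      unfold Rdiv at 1. rewrite Rmult_assoc, Rinv_l, Rmult_1_r by lra. exact Hd.
  - intros w _. destruct (excluded_middle_informative (w = z)) as [->|n]; [ring|].
    field. apply sub_neq0, n.
Qed.

Lemma cdiff_eps (f : C -> C) (z : C) : cdiff f z -> exists l : C,
  forall e, 0 < e -> exists d, 0 < d /\ forall w, Cmod (w - z) < d ->
     Cmod (f w - f z - l * (w - z)) <= e * Cmod (w - z).
Proof.
  intros [p [d [Hd [Hp He]]]]. exists (p z). intros e He0.
  destruct (Hp e He0) as [d1 [H1 H2]]. exists (Rmin d d1).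
  split; [apply Rmin_pos; auto|]. intros w Hw.
  rewrite (He w) by (eapply Rlt_le_trans; [exact Hw|apply Rmin_l]).
  replace (f z + p w * (w - z) - f z - p z * (w - z))%C with ((p w - p z) * (w - z))%C by ring.
  rewrite Cmod_mult. apply Rmult_le_compat_r; [apply Cmod_ge_0|].
  apply Rlt_le, H2. eapply Rlt_le_trans; [exact Hw|apply Rmin_r].
Qed.

Lemma ex_derive_cdiff (f : C -> C) (z : C) :
  @ex_derive C_AbsRing C_NormedModule f z -> cdiff f z.
Proof.
  intros [l [_ Hl]]. specialize (Hl z (fun P H => H)).
  apply (cdiff_of_eps f z l). intros e He.
  destruct (Hl (mkposreal _ He)) as [d Hd]. exists d. split; [apply cond_pos|].
  intros w Hw. rewrite (Cmult_comm l). exact (Hd w Hw).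
Qed.

(** * Goursat's theorem for closed forms *)

(* The form [P ds + Q dt] is Frechet differentiable at [(s, t)] and closed there: the
   coefficient [k] is both the t-derivative of [P] and the s-derivative of [Q]. *)
Definition closed_at (P Q : R -> R -> R) (s t : R) : Prop :=
  exists ps k qt, forall eps, 0 < eps -> exists d, 0 < d /\ forall x y,
    Rabs (x - s) < d -> Rabs (y - t) < d ->
    Rabs (P x y - P s t - ps * (x - s) - k * (y - t)) <= eps * (Rabs (x - s) + Rabs (y - t)) /\
    Rabs (Q x y - Q s t - k * (x - s) - qt * (y - t)) <= eps * (Rabs (x - s) + Rabs (y - t)).

(** Counterclockwise boundary integral of [P ds + Q dt] over the rectangle [a, b] x [c, d]. *)
Definition rect_int (P Q : R -> R -> R) (a b c d : R) : R :=
  RInt (fun s => P s c) a b + RInt (fun t => Q b t) c d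
  - RInt (fun s => P s d) a b - RInt (fun t => Q a t) c d.

Lemma affine_approx_continuous (f : R -> R) (x l : R) :
  (forall eps, 0 < eps -> exists d, 0 < d /\ forall y, Rabs (y - x) < d ->
     Rabs (f y - f x - l * (y - x)) <= eps * Rabs (y - x)) ->
  continuous f x.
Proof.
  intros H. apply continuity_pt_filterlim. intros e He.
  destruct (H 1 Rlt_0_1) as [d [Hd Hf]].
  exists (Rmin d (e / (2 * (Rabs l + 1)))).
  pose proof (Rabs_pos l).
  split. { apply Rmin_pos; [auto|]. apply Rdiv_lt_0_compat; lra. }
  intros y [_ Hy]. unfold dist in *; simpl in *. unfold R_dist in *.
  assert (Ha : Rabs (y - x) < d) by (eapply Rlt_le_trans; [exact Hy|apply Rmin_l]).
  assert (Hb : Rabs (y - x) < e / (2 * (Rabs l + 1)))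
    by (eapply Rlt_le_trans; [exact Hy|apply Rmin_r]).
  specialize (Hf y Ha).
  assert (Hc : Rabs (y - x) * (Rabs l + 1) <= e / 2).
  { replace (e / 2) with (e / (2 * (Rabs l + 1)) * (Rabs l + 1)) by (field; lra).
    apply Rmult_le_compat_r; lra. }
  replace (f y - f x) with ((f y - f x - l * (y - x)) + l * (y - x)) by ring.
  eapply Rle_lt_trans; [apply Rabs_triang|]. rewrite Rabs_mult. lra.
Qed.

Lemma closed_at_continuous_fst (P Q : R -> R -> R) (s t : R) :
  closed_at P Q s t -> continuous (fun x => P x t) s.
Proof.
  intros [ps [k [qt H]]]. apply (affine_approx_continuous _ _ ps). intros e He.
  destruct (H e He) as [d [Hd Hf]]. exists d. split; [auto|]. intros y Hy.
  destruct (Hf y t Hy) as [H1 _]; [rewrite Rminus_diag, Rabs_R0; auto|].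
  rewrite Rminus_diag, Rabs_R0, Rplus_0_r, Rmult_0_r, Rminus_0_r in H1. exact H1.
Qed.

Lemma closed_at_continuous_snd (P Q : R -> R -> R) (s t : R) :
  closed_at P Q s t -> continuous (fun y => Q s y) t.
Proof.
  intros [ps [k [qt H]]]. apply (affine_approx_continuous _ _ qt). intros e He.
  destruct (H e He) as [d [Hd Hf]]. exists d. split; [auto|]. intros y Hy.
  destruct (Hf s y) as [_ H1]; [rewrite Rminus_diag, Rabs_R0; auto|auto|].
  rewrite Rminus_diag, Rabs_R0, Rplus_0_l, Rmult_0_r, Rminus_0_r in H1. exact H1.
Qed.

Lemma ex_RInt_cont (f : R -> R) (a b : R) : a <= b ->
  (forall x, a <= x <= b -> continuous f x) -> ex_RInt f a b.
Proof.
  intros Hab H. apply (ex_RInt_continuous (V := R_CompleteNormedModule)).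
  rewrite Rmin_left, Rmax_right by auto. exact H.
Qed.

(** Every left end lies below every right end, so the supremum of the left ends works. Intervals are
    given by left end and width because bisection fixes the widths in advance. *)
Lemma nested_intervals (u w : nat -> R) :
  (forall n, 0 <= w n) -> (forall n, u n <= u (S n)) ->
  (forall n, u (S n) + w (S n) <= u n + w n) ->
  exists x, forall n, u n <= x <= u n + w n.
Proof.
  intros Hw Hu Hv.
  assert (Hu' : forall n k, u n <= u (n + k)%nat).
  { intros n k. induction k as [|k IH]; [rewrite Nat.add_0_r; lra|].
    rewrite Nat.add_succ_r. specialize (Hu (n + k)%nat). lra. }
  assert (Hv' : forall n k, u (n + k)%nat + w (n + k)%nat <= u n + w n).
  { intros n k. induction k as [|k IH]; [rewrite Nat.add_0_r; lra|].
    rewrite Nat.add_succ_r. specialize (Hv (n + k)%nat). lra. }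
  assert (Hm : forall m n, u m <= u n + w n).
  { intros m n. pose proof (Hu' m n). pose proof (Hv' n m).
    rewrite (Nat.add_comm n m) in *. specialize (Hw (m + n)%nat). lra. }
  destruct (completeness (fun x => exists n, x = u n)) as [x [Hx1 Hx2]].
  - exists (u O + w O). intros y [n ->]. apply Hm.
  - exists (u O), O. reflexivity.
  - exists x. intros n. split; [apply Hx1; eauto|].
    apply Hx2. intros y [m ->]. apply Hm.
Qed.

Section Goursat.
Variables (P Q : R -> R -> R) (a b c d : R).
Hypothesis Hab : a <= b.
Hypothesis Hcd : c <= d.
Hypothesis Hcl : forall s t, a <= s <= b -> c <= t <= d -> closed_at P Q s t.

Lemma ex_RInt_horizontal (x x' y : R) :
  a <= x -> x <= x' -> x' <= b -> c <= y <= d -> ex_RInt (fun s => P s y) x x'.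
Proof.
  intros. apply ex_RInt_cont; [auto|]. intros s Hs.
  apply (closed_at_continuous_fst P Q). apply Hcl; lra.
Qed.

Lemma ex_RInt_vertical (x y y' : R) :
  c <= y -> y <= y' -> y' <= d -> a <= x <= b -> ex_RInt (fun t => Q x t) y y'.
Proof.
  intros. apply ex_RInt_cont; [auto|]. intros s Hs.
  apply (closed_at_continuous_snd P Q). apply Hcl; lra.
Qed.

(** Interior edges are traversed twice in opposite directions and cancel. *)
Lemma rect_int_split (x x1 x2 y y1 y2 : R) :
  a <= x -> x <= x1 -> x1 <= x2 -> x2 <= b -> c <= y -> y <= y1 -> y1 <= y2 -> y2 <= d ->
  rect_int P Q x x2 y y2 =
  rect_int P Q x x1 y y1 + rect_int P Q x1 x2 y y1
  + rect_int P Q x x1 y1 y2 + rect_int P Q x1 x2 y1 y2.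
Proof.
  intros. unfold rect_int.
  rewrite <- (RInt_Chasles (fun s => P s y) x x1 x2) by (apply ex_RInt_horizontal; lra).
  rewrite <- (RInt_Chasles (fun s => P s y2) x x1 x2) by (apply ex_RInt_horizontal; lra).
  rewrite <- (RInt_Chasles (fun t => Q x t) y y1 y2) by (apply ex_RInt_vertical; lra).
  rewrite <- (RInt_Chasles (fun t => Q x2 t) y y1 y2) by (apply ex_RInt_vertical; lra).
  unfold plus; simpl. ring.
Qed.

Lemma RInt_const_approx (f : R -> R) (x y k e : R) : x <= y -> ex_RInt f x y ->
  (forall t, x <= t <= y -> Rabs (f t - k) <= e) ->
  Rabs (RInt f x y - (y - x) * k) <= (y - x) * e.
Proof.
  intros Hxy He Hb.
  replace (RInt f x y - (y - x) * k) with (RInt (fun t => f t - k) x y).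
  - apply abs_RInt_le_const; auto. apply (ex_RInt_minus f (fun _ => k)); [auto|].
    apply ex_RInt_const.
  - rewrite (RInt_minus f (fun _ => k)); [|auto|apply ex_RInt_const].
    rewrite RInt_const. reflexivity.
Qed.

(** To first order, bottom minus top gives -k times the area and right minus left gives +k times the
    area. Closedness makes the two k equal, so only the approximation errors remain. *)
Lemma rect_int_local (s t eps : R) : a <= s <= b -> c <= t <= d -> 0 < eps ->
  exists h, 0 < h /\ forall x x' y y',
    a <= x -> x <= s <= x' -> x' <= b -> c <= y -> y <= t <= y' -> y' <= d ->
    x' - x < h -> y' - y < h ->
    Rabs (rect_int P Q x x' y y') <= 2 * eps * (x' - x + (y' - y)) ^ 2.
Proof.
  intros Hs Ht He. destruct (Hcl s t Hs Ht) as [ps [k [qt H]]].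
  destruct (H eps He) as [h [Hh Hf]]. exists h. split; [auto|].
  intros x x' y y' Hx1 Hx2 Hx3 Hy1 Hy2 Hy3 Hx Hy.
  set (L := x' - x + (y' - y)).
  assert (Hin : forall u v, x <= u <= x' -> y <= v <= y' ->
    Rabs (P u v - P s t - ps * (u - s) - k * (v - t)) <= eps * L /\
    Rabs (Q u v - Q s t - k * (u - s) - qt * (v - t)) <= eps * L).
  { intros u v Hu Hv.
    assert (Rabs (u - s) <= x' - x) by (apply Rabs_le; lra).
    assert (Rabs (v - t) <= y' - y) by (apply Rabs_le; lra).
    destruct (Hf u v) as [F1 F2]; [lra|lra|].
    assert (eps * (Rabs (u - s) + Rabs (v - t)) <= eps * L)
      by (apply Rmult_le_compat_l; unfold L; lra).
    split; lra. }
  unfold rect_int.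
  assert (E1 : RInt (fun s0 => P s0 y) x x' - RInt (fun s0 => P s0 y') x x'
    = RInt (fun u => P u y - P u y') x x').
  { symmetry. apply (RInt_minus (V := R_CompleteNormedModule)); apply ex_RInt_horizontal; lra. }
  assert (E2 : RInt (fun s0 => Q x' s0) y y' - RInt (fun s0 => Q x s0) y y'
    = RInt (fun u => Q x' u - Q x u) y y').
  { symmetry. apply (RInt_minus (V := R_CompleteNormedModule)); apply ex_RInt_vertical; lra. }
  assert (B1 : Rabs (RInt (fun u => P u y - P u y') x x' - (x' - x) * (k * (y - y')))
     <= (x' - x) * (2 * eps * L)).
  { apply RInt_const_approx; [lra| |].
    - apply (ex_RInt_minus (V := R_NormedModule)); apply ex_RInt_horizontal; lra.
    - intros u Hu. destruct (Hin u y) as [F1 _]; [lra|lra|].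
      destruct (Hin u y') as [F2 _]; [lra|lra|].
      apply Rabs_le_between in F1. apply Rabs_le_between in F2. apply Rabs_le. lra. }
  assert (B2 : Rabs (RInt (fun u => Q x' u - Q x u) y y' - (y' - y) * (k * (x' - x)))
     <= (y' - y) * (2 * eps * L)).
  { apply RInt_const_approx; [lra| |].
    - apply (ex_RInt_minus (V := R_NormedModule)); apply ex_RInt_vertical; lra.
    - intros u Hu. destruct (Hin x u) as [_ F1]; [lra|lra|].
      destruct (Hin x' u) as [_ F2]; [lra|lra|].
      apply Rabs_le_between in F1. apply Rabs_le_between in F2. apply Rabs_le. lra. }
  apply Rabs_le_between in B1. apply Rabs_le_between in B2.
  replace (2 * eps * L ^ 2) with ((x' - x) * (2 * eps * L) + (y' - y) * (2 * eps * L))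
    by (unfold L; ring).
  apply Rabs_le. lra.
Qed.

Let W (n : nat) := (b - a) * (1 / 2) ^ n.
Let T (n : nat) := (d - c) * (1 / 2) ^ n.

(** [p] is the lower left corner of a rectangle of the n-th bisection generation. The bound is
    quadratic in the half-perimeter, so it scales like area. *)
Let bad (eps : R) (n : nat) (p : R * R) : Prop :=
  a <= fst p /\ fst p + W n <= b /\ c <= snd p /\ snd p + T n <= d /\
  eps * (W n + T n) ^ 2 <
  Rabs (rect_int P Q (fst p) (fst p + W n) (snd p) (snd p + T n)).

Let next (eps : R) (n : nat) (p p' : R * R) : Prop :=
  bad eps (S n) p' /\ fst p <= fst p' /\ fst p' + W (S n) <= fst p + W n /\
  snd p <= snd p' /\ snd p' + T (S n) <= snd p + T n.

Lemma W_half n : W (S n) = W n / 2. Proof. unfold W; simpl; field. Qed.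
Lemma T_half n : T (S n) = T n / 2. Proof. unfold T; simpl; field. Qed.
Lemma half_pow_pos n : 0 < (1 / 2) ^ n. Proof. apply pow_lt. lra. Qed.
Lemma W_pos n : 0 <= W n.
Proof. apply Rmult_le_pos; [lra|]. pose proof (half_pow_pos n). lra. Qed.
Lemma T_pos n : 0 <= T n.
Proof. apply Rmult_le_pos; [lra|]. pose proof (half_pow_pos n). lra. Qed.

(** If all four quarters obeyed the bound, adding them would give it for the whole, since halving
    the sides divides the squared half-perimeter by four. *)
Lemma bad_next (eps : R) (n : nat) (p : R * R) : bad eps n p -> exists p', next eps n p p'.
Proof.
  intros [H1 [H2 [H3 [H4 H5]]]]. destruct p as [x y]; cbn [fst snd] in *.
  pose proof (W_half n). pose proof (T_half n). pose proof (W_pos n). pose proof (T_pos n).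
  apply NNPP. intros Hn.
  assert (Hq : forall x' y', (x' = x \/ x' = x + W (S n)) -> (y' = y \/ y' = y + T (S n)) ->
    Rabs (rect_int P Q x' (x' + W (S n)) y' (y' + T (S n))) <= eps * (W (S n) + T (S n)) ^ 2).
  { intros x' y' Hx Hy. apply Rnot_lt_le. intros Hlt. apply Hn. exists (x', y').
    unfold next, bad; cbn [fst snd]. destruct Hx, Hy; subst; repeat split; try assumption; lra. }
  revert H5. apply Rle_not_lt.
  rewrite (rect_int_split x (x + W (S n)) (x + W n) y (y + T (S n)) (y + T n)) by lra.
  pose proof (Hq x y) as Q1. pose proof (Hq (x + W (S n)) y) as Q2.
  pose proof (Hq x (y + T (S n))) as Q3. pose proof (Hq (x + W (S n)) (y + T (S n))) as Q4.
  replace (x + W (S n) + W (S n)) with (x + W n) in * by lra.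
  replace (y + T (S n) + T (S n)) with (y + T n) in * by lra.
  specialize (Q1 (or_introl eq_refl) (or_introl eq_refl)).
  specialize (Q2 (or_intror eq_refl) (or_introl eq_refl)).
  specialize (Q3 (or_introl eq_refl) (or_intror eq_refl)).
  specialize (Q4 (or_intror eq_refl) (or_intror eq_refl)).
  replace (eps * (W n + T n) ^ 2) with (4 * (eps * (W (S n) + T (S n)) ^ 2))
    by (rewrite W_half, T_half; field).
  apply Rabs_le_between in Q1. apply Rabs_le_between in Q2.
  apply Rabs_le_between in Q3. apply Rabs_le_between in Q4.
  apply Rabs_le. lra.
Qed.

Lemma goursat : rect_int P Q a b c d = 0.
Proof.
  apply NNPP. intros Hne. set (I := Rabs (rect_int P Q a b c d)).
  assert (HI : 0 < I) by (apply Rabs_pos_lt; exact Hne).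
  set (L := b - a + (d - c)).
  assert (HL : 0 <= L ^ 2) by apply pow2_ge_0.
  (* This makes [eps * L ^ 2] < [I], so the whole rectangle is bad; the + 1 covers [L = 0]. *)
  set (eps := I / (2 * (L ^ 2 + 1))).
  assert (Heps : 0 < eps) by (apply Rdiv_lt_0_compat; lra).
  (* Dependent choice through Hilbert's epsilon, with (0, 0) as the default value. *)
  set (s := fix s n := match n with O => (a, c)
     | S m => epsilon (inhabits (0, 0)) (next eps m (s m)) end).
  assert (Hbad : forall n, bad eps n (s n)).
  { induction n as [|n IH].
    - unfold bad, W, T; simpl. rewrite !Rmult_1_r.
      replace (a + (b - a)) with b by ring. replace (c + (d - c)) with d by ring.
      repeat split; try lra. fold L. fold I.
      replace (L * L) with (L ^ 2) by ring.
      assert (eps * (2 * (L ^ 2 + 1)) = I) by (unfold eps; field; lra).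
      nra.
    - apply (epsilon_spec (inhabits (0, 0)) (next eps n (s n))), bad_next, IH. }
  assert (Hnext : forall n, next eps n (s n) (s (S n))).
  { intros n. apply (epsilon_spec (inhabits (0, 0)) (next eps n (s n))), bad_next, Hbad. }
  destruct (nested_intervals (fun n => fst (s n)) W) as [x Hx].
  { apply W_pos. } { intros n. apply Hnext. } { intros n. apply Hnext. }
  destruct (nested_intervals (fun n => snd (s n)) T) as [y Hy].
  { apply T_pos. } { intros n. apply Hnext. } { intros n. apply Hnext. }
  (* With [eps / 2] the local bound is exactly the inequality whose failure defines [bad eps]. *)
  destruct (rect_int_local x y (eps / 2)) as [h [Hh Hloc]].
  - specialize (Hx O). destruct (Hbad O) as [B1 [B2 _]]. lra.
  - specialize (Hy O). destruct (Hbad O) as [_ [_ [B3 [B4 _]]]]. lra.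
  - lra.
  - destruct (pow_lt_1_zero (1 / 2)) with (y := h / (L + 1)) as [N HN].
    { rewrite Rabs_right; lra. }
    { apply Rdiv_lt_0_compat; unfold L; lra. }
    specialize (HN N (Nat.le_refl N)). pose proof (half_pow_pos N) as Hp.
    rewrite Rabs_right in HN by lra.
    assert (HL0 : 0 <= L) by (unfold L; lra).
    assert (HLh : L * (1 / 2) ^ N < h).
    { replace h with ((L + 1) * (h / (L + 1))) by (field; lra). nra. }
    assert (HWT : W N + T N < h) by (unfold W, T; unfold L in HLh; lra).
    pose proof (W_pos N). pose proof (T_pos N).
    destruct (Hbad N) as [B1 [B2 [B3 [B4 B5]]]].
    specialize (Hx N). specialize (Hy N).
    specialize (Hloc (fst (s N)) (fst (s N) + W N) (snd (s N)) (snd (s N) + T N)).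
    replace (fst (s N) + W N - fst (s N)) with (W N) in Hloc by ring.
    replace (snd (s N) + T N - snd (s N)) with (T N) in Hloc by ring.
    replace (2 * (eps / 2)) with eps in Hloc by field.
    apply (Rlt_not_le _ _ B5). apply Hloc; lra.
Qed.

End Goursat.

(** * Polar coordinates and complex integrals *)

Lemma im_le_Cmod (z : C) : Rabs (Im z) <= Cmod z.
Proof. eapply Rle_trans; [|apply Rmax_Cmod]. apply Rmax_r. Qed.

Lemma Cmod_le_abs (z : C) : Cmod z <= Rabs (Re z) + Rabs (Im z).
Proof.
  pose proof (Rabs_pos (Re z)). pose proof (Rabs_pos (Im z)).
  apply Rsqr_incr_0_var; [|lra]. rewrite !Rsqr_pow2, Cmod2_alt.
  rewrite <- (pow2_abs (Re z)), <- (pow2_abs (Im z)). nra.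
Qed.

Lemma Cmod_polar (rho t : R) : 0 <= rho -> Cmod (polar rho t) = rho.
Proof.
  intros H. apply Rsqr_inj; [apply Cmod_ge_0|auto|].
  rewrite !Rsqr_pow2, Cmod2_alt. unfold polar, Re, Im; simpl.
  pose proof (sin2_cos2 t) as E. unfold Rsqr in E. nra.
Qed.

Lemma polar_mult (a b s t : R) : (polar a s * polar b t)%C = polar (a * b) (s + t).
Proof.
  unfold polar, Cmult; simpl. rewrite cos_plus, sin_plus. f_equal; ring.
Qed.

Lemma polar_conj (a t : R) : Cconj (polar a t) = polar a (- t).
Proof. unfold polar, Cconj; simpl. rewrite cos_neg, sin_neg. f_equal; ring. Qed.

Lemma polar_0 (a : R) : polar a 0 = RtoC a.
Proof. unfold polar, RtoC. rewrite cos_0, sin_0. f_equal; ring. Qed.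

Lemma polar_zero (t : R) : polar 0 t = RtoC 0.
Proof. unfold polar, RtoC. f_equal; ring. Qed.

Lemma polar_2PI (a : R) : polar a (2 * PI) = polar a 0.
Proof. unfold polar. rewrite cos_2PI, sin_2PI, cos_0, sin_0. reflexivity. Qed.

Lemma polar_exists (z : C) : exists t, z = polar (Cmod z) t.
Proof.
  pose proof (Cmod_ge_0 z) as H0. destruct (Req_dec (Cmod z) 0) as [H|H].
  - exists 0. rewrite H, polar_zero. apply Cmod_eq_0, H.
  - set (m := Cmod z) in *. assert (Hm : 0 < m) by lra.
    destruct z as [x y].
    assert (E : x ^ 2 + y ^ 2 = m ^ 2) by (unfold m; rewrite Cmod2_alt; reflexivity).
    assert (Hx : -1 <= x / m <= 1).
    { split; apply Rmult_le_reg_r with m; auto;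
      replace (x / m * m) with x by (field; lra); nra. }
    assert (Hs : sqrt (1 - (x / m)²) = Rabs y / m).
    { replace (1 - (x / m)²) with ((Rabs y / m)²).
      - apply sqrt_Rsqr. apply Rmult_le_pos; [apply Rabs_pos|]. left.
        apply Rinv_0_lt_compat; lra.
      - rewrite !Rsqr_div', <- Rsqr_abs. unfold Rsqr.
        replace (y * y) with (m * m - x * x) by nra. field. lra. }
    destruct (Rle_dec 0 y) as [Hy|Hy].
    + exists (acos (x / m)). unfold polar. rewrite cos_acos, sin_acos by auto.
      rewrite Hs, Rabs_right by lra. f_equal; field; lra.
    + exists (- acos (x / m)). unfold polar.
      rewrite cos_neg, sin_neg, cos_acos, sin_acos by auto.
      rewrite Hs, Rabs_left by lra. f_equal; field; lra.
Qed.

Lemma lipschitz_1 (f df : R -> R) (x y : R) : (forall t, is_derive f t (df t)) ->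
  (forall t, Rabs (df t) <= 1) -> Rabs (f y - f x) <= Rabs (y - x).
Proof.
  intros Hd Hb. destruct (MVT_gen f x y df) as [c [_ ->]].
  - intros; apply Hd.
  - intros t _. apply continuity_pt_filterlim.
    apply (ex_derive_continuous (V := R_NormedModule)). eexists; apply Hd.
  - rewrite Rabs_mult. specialize (Hb c). pose proof (Rabs_pos (y - x)). nra.
Qed.

Lemma sin_lipschitz (x y : R) : Rabs (sin y - sin x) <= Rabs (y - x).
Proof.
  apply (lipschitz_1 sin cos); [intros; auto_derive; [auto|ring]|].
  intros t. apply Rabs_le, COS_bound.
Qed.

Lemma cos_lipschitz (x y : R) : Rabs (cos y - cos x) <= Rabs (y - x).
Proof.
  apply (lipschitz_1 cos (fun t => - sin t)); [intros; auto_derive; [auto|ring]|].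
  intros t. rewrite Rabs_Ropp. apply Rabs_le, SIN_bound.
Qed.

(** Move radially at the angle [t'], then along the circle of radius [rho]; the factor 2 comes from
    adding the cosine and sine increments. *)
Lemma polar_lipschitz (rho rho' t t' : R) : 0 <= rho ->
  Cmod (polar rho' t' - polar rho t) <= Rabs (rho' - rho) + 2 * rho * Rabs (t' - t).
Proof.
  intros Hr.
  replace (polar rho' t' - polar rho t)%C
    with ((polar rho' t' - polar rho t') + (polar rho t' - polar rho t))%C by ring.
  eapply Rle_trans; [apply Cmod_triangle|]. apply Rplus_le_compat.
  - replace (polar rho' t' - polar rho t')%C with (RtoC (rho' - rho) * polar 1 t')%C.
    + rewrite Cmod_mult, Cmod_R, Cmod_polar by lra. lra.
    + unfold polar, RtoC, Cmult, Cminus, Cplus, Copp; simpl. f_equal; ring.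
  - eapply Rle_trans; [apply Cmod_le_abs|].
    unfold polar, Cminus, Cplus, Copp, Re, Im; simpl.
    replace (rho * cos t' + - (rho * cos t)) with (rho * (cos t' - cos t)) by ring.
    replace (rho * sin t' + - (rho * sin t)) with (rho * (sin t' - sin t)) by ring.
    rewrite !Rabs_mult, (Rabs_right rho) by lra.
    pose proof (sin_lipschitz t t'). pose proof (cos_lipschitz t t'). nra.
Qed.

(** Logarithmic coordinates: [ln r1, ln r2] x [0, 2 PI] is carried onto an annulus, so Goursat on
    rectangles compares integrals over concentric circles. *)
Definition cexp (z : C) : C := polar (exp (Re z)) (Im z).

Lemma cexp_plus (z w : C) : cexp (z + w) = (cexp z * cexp w)%C.
Proof.
  unfold cexp. rewrite polar_mult. destruct z, w; simpl. rewrite exp_plus. reflexivity.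
Qed.

Lemma derive_eps (f : R -> R) (x l : R) : is_derive f x l -> forall e, 0 < e ->
  exists d, 0 < d /\ forall h, Rabs h < d -> Rabs (f (x + h) - f x - l * h) <= e * Rabs h.
Proof.
  intros [_ H] e He. destruct (H x (fun P HP => HP) (mkposreal _ He)) as [d Hd].
  exists d. split; [apply cond_pos|]. intros h Hh. specialize (Hd (x + h)).
  unfold ball, norm, minus, plus, opp, scal in Hd; simpl in Hd.
  unfold AbsRing_ball, abs, minus, plus, opp, mult in Hd; simpl in Hd.
  replace (x + h + - x) with h in Hd by ring. unfold mult in Hd; simpl in Hd.
  replace (f (x + h) - f x - l * h) with (f (x + h) + - f x + - (h * l)) by ring.
  apply Hd, Hh.
Qed.

Lemma cexp_approx (e : R) : 0 < e -> exists d, 0 < d /\ forall h : C, Cmod h < d ->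
  Cmod (cexp h - 1 - h) <= e * Cmod h.
Proof.
  intros He. set (u := Rmin 1 (e / 9)).
  assert (Hu : 0 < u) by (apply Rmin_pos; lra).
  assert (Hu1 : u <= 1) by apply Rmin_l. assert (Hu2 : u <= e / 9) by apply Rmin_r.
  destruct (derive_eps exp 0 1) with (e := u) as [d1 [D1 E1]]; auto.
  { auto_derive; [auto|]. rewrite exp_0; ring. }
  destruct (derive_eps cos 0 0) with (e := u) as [d2 [D2 E2]]; auto.
  { auto_derive; [auto|]. rewrite sin_0; ring. }
  destruct (derive_eps sin 0 1) with (e := u) as [d3 [D3 E3]]; auto.
  { auto_derive; [auto|]. rewrite cos_0; ring. }
  exists (Rmin (Rmin d1 u) (Rmin d2 d3)).
  split; [apply Rmin_pos; apply Rmin_pos; assumption|].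
  intros h Hh.
  assert (Hm : forall a b c, a < Rmin b c -> a < b /\ a < c).
  { intros a b c H. split; eapply Rlt_le_trans; [exact H|apply Rmin_l|exact H|apply Rmin_r]. }
  apply Hm in Hh. destruct Hh as [Ha Hb]. apply Hm in Ha. apply Hm in Hb.
  destruct Ha as [Ha1 Ha2]. destruct Hb as [Hb1 Hb2].
  pose proof (re_le_Cmod h) as Hx. pose proof (im_le_Cmod h) as Hy.
  set (m := Cmod h) in *. destruct h as [x y]. simpl in Hx, Hy.
  specialize (E1 x ltac:(lra)). specialize (E2 y ltac:(lra)). specialize (E3 y ltac:(lra)).
  rewrite Rplus_0_l in E1, E2, E3. rewrite exp_0 in E1. rewrite cos_0 in E2. rewrite sin_0 in E3.
  eapply Rle_trans; [apply Cmod_le_abs|].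
  unfold cexp, polar, Cminus, Cplus, Copp, RtoC, Re, Im; simpl.
  replace (exp x * cos y + - (1) + - x) with ((exp x - 1 - 1 * x) * cos y + (1 + x) * (cos y - 1 - 0 * y)) by ring.
  replace (exp x * sin y + - 0 + - y) with
    ((exp x - 1 - 1 * x) * sin y + (1 + x) * (sin y - 0 - 1 * y) + x * y) by ring.
  assert (A1 : Rabs (exp x - 1 - 1 * x) <= u * m) by nra.
  assert (A2 : Rabs (cos y - 1 - 0 * y) <= u * m) by nra.
  assert (A3 : Rabs (sin y - 0 - 1 * y) <= u * m) by nra.
  assert (B1 : Rabs (cos y) <= 1) by (apply Rabs_le, COS_bound).
  assert (B2 : Rabs (sin y) <= 1) by (apply Rabs_le, SIN_bound).
  assert (B3 : Rabs (1 + x) <= 2).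
  { eapply Rle_trans; [apply Rabs_triang|]. rewrite Rabs_R1. lra. }
  assert (Hm0 : 0 <= m) by apply Cmod_ge_0.
  assert (Hmul : forall p q P Q, Rabs p <= P -> Rabs q <= Q -> Rabs (p * q) <= P * Q).
  { intros. rewrite Rabs_mult. apply Rmult_le_compat; auto using Rabs_pos. }
  pose proof (Hmul _ _ _ _ A1 B1). pose proof (Hmul _ _ _ _ B3 A2).
  pose proof (Hmul _ _ _ _ A1 B2). pose proof (Hmul _ _ _ _ B3 A3).
  assert (Rabs (x * y) <= u * m) by (apply Hmul; lra).
  eapply Rle_trans. { apply Rplus_le_compat; [apply Rabs_triang|].
    eapply Rle_trans; [apply Rabs_triang|]. apply Rplus_le_compat_r, Rabs_triang. }
  nra.
Qed.

Lemma cdiff_cexp (z : C) : cdiff cexp z.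
Proof.
  apply (cdiff_of_eps cexp z (cexp z)). intros e He.
  set (A := Cmod (cexp z)). assert (HA : 0 <= A) by apply Cmod_ge_0.
  destruct (cexp_approx (e / (A + 1))) as [d [Hd H]].
  { apply Rdiv_lt_0_compat; lra. }
  exists d. split; [auto|]. intros w Hw. specialize (H (w - z)%C Hw).
  replace (cexp w) with (cexp z * cexp (w - z))%C
    by (rewrite <- cexp_plus; f_equal; ring).
  replace (cexp z * cexp (w - z) - cexp z - cexp z * (w - z))%C
    with (cexp z * (cexp (w - z) - 1 - (w - z)))%C by ring.
  rewrite Cmod_mult. fold A.
  apply Rle_trans with (A * (e / (A + 1) * Cmod (w - z))); [apply Rmult_le_compat_l; auto|].
  pose proof (Cmod_ge_0 (w - z)).
  replace (A * (e / (A + 1) * Cmod (w - z))) with (A / (A + 1) * (e * Cmod (w - z)))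
    by (field; lra).
  assert (A / (A + 1) <= 1).
  { apply Rmult_le_reg_r with (A + 1); [lra|]. unfold Rdiv.
    rewrite Rmult_assoc, Rinv_l by lra. lra. }
  assert (0 <= e * Cmod (w - z)) by (apply Rmult_le_pos; lra). nra.
Qed.

(* Cauchy-Riemann: the real and imaginary parts of [F dz] are closed. *)
Lemma cdiff_closed (F : C -> C) (s t : R) : cdiff F (s, t) ->
  closed_at (fun x y => Re (F (x, y))) (fun x y => - Im (F (x, y))) s t /\
  closed_at (fun x y => Im (F (x, y))) (fun x y => Re (F (x, y))) s t.
Proof.
  intros H. apply cdiff_eps in H. destruct H as [[p q] H].
  assert (K : forall e, 0 < e -> exists d, 0 < d /\ forall x y,
    Rabs (x - s) < d -> Rabs (y - t) < d ->
    Rabs (Re (F (x, y)) - Re (F (s, t)) - p * (x - s) - (- q) * (y - t))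
      <= e * (Rabs (x - s) + Rabs (y - t)) /\
    Rabs (Im (F (x, y)) - Im (F (s, t)) - q * (x - s) - p * (y - t))
      <= e * (Rabs (x - s) + Rabs (y - t))).
  { intros e He. destruct (H e He) as [d [Hd Hf]]. exists (d / 2). split; [lra|].
    intros x y Hx Hy.
    assert (HC : Cmod ((x, y) - (s, t))%C <= Rabs (x - s) + Rabs (y - t)).
    { eapply Rle_trans; [apply Cmod_le_abs|].
      unfold Cminus, Cplus, Copp, Re, Im; simpl. unfold Rminus. lra. }
    specialize (Hf (x, y) ltac:(lra)).
    assert (Hf' := Rle_trans _ _ _ Hf (Rmult_le_compat_l e _ _ ltac:(lra) HC)).
    split; eapply Rle_trans; [|exact Hf'| |exact Hf'].
    - eapply Rle_trans; [|apply re_le_Cmod]. apply Req_le. f_equal.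
      unfold Re, Cminus, Cplus, Copp, Cmult; simpl. ring.
    - eapply Rle_trans; [|apply im_le_Cmod]. apply Req_le. f_equal.
      unfold Im, Cminus, Cplus, Copp, Cmult; simpl. ring. }
  (* For the derivative p + i q, the shared mixed coefficient is -q for the real part of [F dz] and
     p for its imaginary part. *)
  split; [exists p, (- q), (- p)|exists q, p, (- q)]; intros e He;
    destruct (K e He) as [d [Hd HK]]; exists d; (split; [auto|]); intros x y Hx Hy;
    destruct (HK x y Hx Hy) as [K1 K2]; split; try assumption.
  rewrite <- Rabs_Ropp. eapply Rle_trans; [|exact K2]. apply Req_le. f_equal. ring.
Qed.

(** * Integrals of continuous complex-valued functions of a real variable *)

Definition cint (f : R -> C) (a b : R) : C :=
  (RInt (fun t => Re (f t)) a b, RInt (fun t => Im (f t)) a b).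

(** Continuity on the whole line, so integrability holds on every interval without side conditions
    on the endpoints. *)
Definition path_cont (f : R -> C) : Prop :=
  forall t e, 0 < e -> exists d, 0 < d /\ forall u, Rabs (u - t) < d -> Cmod (f u - f t) < e.

Lemma eps_continuous (f : R -> R) (t : R) :
  (forall e, 0 < e -> exists d, 0 < d /\ forall u, Rabs (u - t) < d -> Rabs (f u - f t) < e) ->
  continuous f t.
Proof.
  intros H. apply continuity_pt_filterlim. intros e He. destruct (H e He) as [d [Hd Hf]].
  exists d. split; [auto|]. intros u [_ Hu]. apply Hf, Hu.
Qed.

Lemma path_cont_re (f : R -> C) (t : R) : path_cont f -> continuous (fun t => Re (f t)) t.
Proof.
  intros H. apply eps_continuous. intros e He. destruct (H t e He) as [d [Hd Hf]].
  exists d. split; [auto|]. intros u Hu. eapply Rle_lt_trans; [|apply (Hf u Hu)].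
  eapply Rle_trans; [|apply re_le_Cmod]. apply Req_le. reflexivity.
Qed.

Lemma path_cont_im (f : R -> C) (t : R) : path_cont f -> continuous (fun t => Im (f t)) t.
Proof.
  intros H. apply eps_continuous. intros e He. destruct (H t e He) as [d [Hd Hf]].
  exists d. split; [auto|]. intros u Hu. eapply Rle_lt_trans; [|apply (Hf u Hu)].
  eapply Rle_trans; [|apply im_le_Cmod]. apply Req_le. reflexivity.
Qed.

Lemma path_cont_Cmod (f : R -> C) (t : R) : path_cont f -> continuous (fun t => Cmod (f t)) t.
Proof.
  intros H. apply eps_continuous. intros e He. destruct (H t e He) as [d [Hd Hf]].
  exists d. split; [auto|]. intros u Hu. eapply Rle_lt_trans; [|apply (Hf u Hu)].
  apply Rabs_le. pose proof (Cmod_triangle_sub (f u) (f t)).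
  pose proof (Cmod_triangle_sub (f t) (f u)). rewrite (Cmod_sub_sym (f t)) in *. lra.
Qed.

Lemma path_cont_comp (G : C -> C) (f : R -> C) : path_cont f ->
  (forall t, ccont G (f t)) -> path_cont (fun t => G (f t)).
Proof.
  intros Hf HG t e He. destruct (HG t e He) as [d [Hd H]].
  destruct (Hf t d Hd) as [d' [Hd' H']]. exists d'. auto.
Qed.

Lemma path_cont_polar (rho : R) : 0 <= rho -> path_cont (polar rho).
Proof.
  intros Hr t e He. exists (e / (2 * rho + 1)). split; [apply Rdiv_lt_0_compat; lra|].
  intros u Hu. eapply Rle_lt_trans; [apply polar_lipschitz, Hr|].
  rewrite Rminus_diag, Rabs_R0, Rplus_0_l.
  pose proof (Rabs_pos (u - t)).
  assert (Rabs (u - t) * (2 * rho + 1) < e).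
  { replace e with (e / (2 * rho + 1) * (2 * rho + 1)) by (field; lra).
    apply Rmult_lt_compat_r; lra. }
  nra.
Qed.

Lemma path_cont_circle (G : C -> C) (rho : R) : 0 <= rho ->
  (forall z, Cmod z = rho -> ccont G z) -> path_cont (fun t => G (polar rho t)).
Proof.
  intros Hr HG. apply path_cont_comp; [apply path_cont_polar, Hr|].
  intros t. apply HG, Cmod_polar, Hr.
Qed.

Lemma path_cont_ex_re (f : R -> C) (a b : R) : path_cont f -> ex_RInt (fun t => Re (f t)) a b.
Proof.
  intros H. apply (ex_RInt_continuous (V := R_CompleteNormedModule)).
  intros; apply path_cont_re, H.
Qed.

Lemma path_cont_ex_im (f : R -> C) (a b : R) : path_cont f -> ex_RInt (fun t => Im (f t)) a b.
Proof.
  intros H. apply (ex_RInt_continuous (V := R_CompleteNormedModule)).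
  intros; apply path_cont_im, H.
Qed.

Lemma path_cont_ex_Cmod (f : R -> C) (a b : R) :
  path_cont f -> ex_RInt (fun t => Cmod (f t)) a b.
Proof.
  intros H. apply (ex_RInt_continuous (V := R_CompleteNormedModule)).
  intros; apply path_cont_Cmod, H.
Qed.

Lemma is_RInt_cint (f : R -> C) (a b : R) : path_cont f ->
  is_RInt (V := C_R_NormedModule) f a b (cint f a b).
Proof.
  intros H. apply (is_RInt_fct_extend_pair (U := R_NormedModule) (V := R_NormedModule)).
  - apply (RInt_correct (V := R_CompleteNormedModule)), (path_cont_ex_re f), H.
  - apply (RInt_correct (V := R_CompleteNormedModule)), (path_cont_ex_im f), H.
Qed.

Lemma Cmod_cint_le (f : R -> C) (g : R -> R) (a b : R) : a <= b -> path_cont f ->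
  ex_RInt g a b -> (forall t, a <= t <= b -> Cmod (f t) <= g t) ->
  Cmod (cint f a b) <= RInt g a b.
Proof.
  intros Hab Hf Hg H.
  (* Identifying the product norm with [Cmod] gives the integral inequality with constant 1;
     bounding the components separately would lose a factor. *)
  assert (N : forall z : C, @norm R_AbsRing C_R_NormedModule z = Cmod z).
  { intros [x y]. unfold norm; simpl. unfold prod_norm, Cmod; simpl. unfold norm; simpl.
    unfold abs; simpl. f_equal. rewrite !Rmult_1_r, <- !Rabs_mult.
    rewrite !Rabs_right by (apply Rle_ge, Rle_0_sqr). reflexivity. }
  rewrite <- N. apply (norm_RInt_le (V := C_R_NormedModule) f g a b); auto.
  - intros t Ht. rewrite N. auto.
  - apply is_RInt_cint, Hf.
  - apply (RInt_correct (V := R_CompleteNormedModule)), Hg.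
Qed.

Lemma Cmod_cint_le_const (f : R -> C) (M a b : R) : a <= b -> path_cont f ->
  (forall t, a <= t <= b -> Cmod (f t) <= M) -> Cmod (cint f a b) <= (b - a) * M.
Proof.
  intros Hab Hf H. eapply Rle_trans.
  - apply (Cmod_cint_le f (fun _ => M)); auto. apply ex_RInt_const.
  - rewrite RInt_const. apply Req_le. reflexivity.
Qed.

Lemma cint_ext (f g : R -> C) (a b : R) : (forall t, f t = g t) -> cint f a b = cint g a b.
Proof. intros H. unfold cint. f_equal; apply RInt_ext; intros; rewrite H; reflexivity. Qed.

Lemma path_cont_plus (f g : R -> C) :
  path_cont f -> path_cont g -> path_cont (fun t => f t + g t)%C.
Proof.
  intros Hf Hg t e He. destruct (Hf t (e / 2)) as [d [Hd H1]]; [lra|].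
  destruct (Hg t (e / 2)) as [d' [Hd' H2]]; [lra|].
  exists (Rmin d d'). split; [apply Rmin_pos; auto|]. intros u Hu.
  replace (f u + g u - (f t + g t))%C with ((f u - f t) + (g u - g t))%C by ring.
  eapply Rle_lt_trans; [apply Cmod_triangle|].
  specialize (H1 u ltac:(eapply Rlt_le_trans; [exact Hu|apply Rmin_l])).
  specialize (H2 u ltac:(eapply Rlt_le_trans; [exact Hu|apply Rmin_r])). lra.
Qed.

Lemma path_cont_scal (c : C) (f : R -> C) : path_cont f -> path_cont (fun t => c * f t)%C.
Proof.
  intros Hf. apply (path_cont_comp (fun z => c * z)%C f Hf). intros t.
  apply ccont_mult; [apply ccont_const|apply ccont_id].
Qed.

Lemma path_cont_minus (f g : R -> C) :
  path_cont f -> path_cont g -> path_cont (fun t => f t - g t)%C.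
Proof.
  intros Hf Hg. apply (path_cont_plus f (fun t => - g t)%C Hf).
  apply (path_cont_comp (fun z => - z)%C g Hg). intros t. apply ccont_opp, ccont_id.
Qed.

Lemma path_cont_const (c : C) : path_cont (fun _ => c).
Proof.
  intros t e He. exists 1. split; [lra|]. intros. rewrite Cmod_sub_self. exact He.
Qed.

Lemma cint_plus (f g : R -> C) (a b : R) : path_cont f -> path_cont g ->
  cint (fun t => f t + g t)%C a b = (cint f a b + cint g a b)%C.
Proof.
  intros Hf Hg. unfold cint, Cplus. cbn [fst snd]. f_equal.
  - apply (RInt_plus (V := R_CompleteNormedModule) (fun t => Re (f t)) (fun t => Re (g t)));
      apply path_cont_ex_re; assumption.
  - apply (RInt_plus (V := R_CompleteNormedModule) (fun t => Im (f t)) (fun t => Im (g t)));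
      apply path_cont_ex_im; assumption.
Qed.

Lemma cint_scal (c : C) (f : R -> C) (a b : R) : path_cont f ->
  cint (fun t => c * f t)%C a b = (c * cint f a b)%C.
Proof.
  intros Hf. destruct c as [p q].
  pose proof (path_cont_ex_re f a b Hf) as H1. pose proof (path_cont_ex_im f a b Hf) as H2.
  unfold cint, Cmult, Re, Im in *; simpl. f_equal.
  - transitivity (RInt (fun t => minus (scal p (fst (f t))) (scal q (snd (f t)))) a b).
    { apply RInt_ext. intros. reflexivity. }
    rewrite (RInt_minus (V := R_CompleteNormedModule))
      by (apply (ex_RInt_scal (V := R_NormedModule)); auto).
    rewrite !(RInt_scal (V := R_CompleteNormedModule)) by auto. reflexivity.
  - transitivity (RInt (fun t => plus (scal p (snd (f t))) (scal q (fst (f t)))) a b).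
    { apply RInt_ext. intros. reflexivity. }
    rewrite (RInt_plus (V := R_CompleteNormedModule))
      by (apply (ex_RInt_scal (V := R_NormedModule)); auto).
    rewrite !(RInt_scal (V := R_CompleteNormedModule)) by auto. reflexivity.
Qed.

Lemma cint_minus (f g : R -> C) (a b : R) : path_cont f -> path_cont g ->
  cint (fun t => f t - g t)%C a b = (cint f a b - cint g a b)%C.
Proof.
  intros Hf Hg.
  rewrite (cint_ext _ (fun t => f t + (-(1)) * g t)%C) by (intros; ring).
  rewrite cint_plus by auto using path_cont_scal. rewrite cint_scal by auto. ring.
Qed.

Lemma cint_const (c : C) (a b : R) : cint (fun _ => c) a b = (RtoC (b - a) * c)%C.
Proof.
  unfold cint. rewrite !RInt_const. destruct c. unfold Cmult, RtoC, scal; simpl.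
  unfold mult; simpl. f_equal; ring.
Qed.

(** * Circle integrals *)

(** This is the integral of G dz / (i z), that is, 2 PI times the mean of G. Hence the Cauchy kernel
    appears below as z / (z - w). *)
Definition circle_int (G : C -> C) (rho : R) : C := cint (fun t => G (polar rho t)) 0 (2 * PI).

Lemma exp_le_mono (x y : R) : x <= y -> exp x <= exp y.
Proof. intros [H| ->]; [left; apply exp_increasing, H|lra]. Qed.

(** In logarithmic coordinates the two circles are the vertical sides of a rectangle, and the
    horizontal sides cancel by periodicity. *)
Lemma circle_int_annulus (G : C -> C) (r1 r2 : R) : 0 < r1 <= r2 ->
  (forall z, r1 <= Cmod z <= r2 -> cdiff G z) -> circle_int G r1 = circle_int G r2.
Proof.
  intros [H1 H2] HG.
  assert (Hln : ln r1 <= ln r2).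
  { destruct H2 as [H2| ->]; [|lra]. left. apply ln_increasing; lra. }
  assert (HP : 0 <= 2 * PI) by (pose proof PI_RGT_0; lra).
  set (F := fun z => G (cexp z)).
  assert (HF : forall s t, ln r1 <= s <= ln r2 -> 0 <= t <= 2 * PI -> cdiff F (s, t)).
  { intros s t Hs _. apply (cdiff_comp G cexp); [apply cdiff_cexp|].
    apply HG. unfold cexp. rewrite Cmod_polar by (left; apply exp_pos). cbn [Re fst].
    rewrite <- (exp_ln r1), <- (exp_ln r2) by lra.
    split; apply exp_le_mono; lra. }
  pose proof (goursat (fun x y => Re (F (x, y))) (fun x y => - Im (F (x, y)))
    (ln r1) (ln r2) 0 (2 * PI) Hln HP
    (fun s t Hs Ht => proj1 (cdiff_closed F s t (HF s t Hs Ht)))) as E1.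
  pose proof (goursat (fun x y => Im (F (x, y))) (fun x y => Re (F (x, y)))
    (ln r1) (ln r2) 0 (2 * PI) Hln HP
    (fun s t Hs Ht => proj2 (cdiff_closed F s t (HF s t Hs Ht)))) as E2.
  assert (Hper : forall s, F (s, 2 * PI) = F (s, 0)).
  { intros s. unfold F, cexp. cbn [Re Im fst snd]. rewrite polar_2PI. reflexivity. }
  assert (Hend : forall r t, 0 < r -> F (ln r, t) = G (polar r t)).
  { intros r t Hr. unfold F, cexp. cbn [Re Im fst snd]. rewrite exp_ln by auto. reflexivity. }
  unfold rect_int in E1, E2.
  rewrite (RInt_ext (fun s => Re (F (s, 2 * PI))) (fun s => Re (F (s, 0)))) in E1
    by (intros; rewrite Hper; reflexivity).
  rewrite (RInt_ext (fun s => Im (F (s, 2 * PI))) (fun s => Im (F (s, 0)))) in E2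
    by (intros; rewrite Hper; reflexivity).
  assert (Hc : forall r, r1 <= r <= r2 -> path_cont (fun t => G (polar r t))).
  { intros r Hr. apply path_cont_circle; [lra|]. intros z Hz. apply cdiff_ccont, HG. lra. }
  assert (K : forall r, r1 <= r <= r2 ->
    RInt (fun t => - Im (F (ln r, t))) 0 (2 * PI) = - Im (circle_int G r) /\
    RInt (fun t => Re (F (ln r, t))) 0 (2 * PI) = Re (circle_int G r)).
  { intros r Hr. split.
    - transitivity (RInt (fun t => opp (Im (G (polar r t)))) 0 (2 * PI)).
      { apply RInt_ext. intros t _. rewrite Hend by lra. reflexivity. }
      apply (RInt_opp (V := R_CompleteNormedModule) (fun t => Im (G (polar r t)))).
      apply (path_cont_ex_im (fun t => G (polar r t))), Hc, Hr.
    - apply RInt_ext. intros t _. rewrite Hend by lra. reflexivity. }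
  destruct (K r1 ltac:(lra)) as [A1 B1]. destruct (K r2 ltac:(lra)) as [A2 B2].
  rewrite A1, A2 in E1. rewrite B1, B2 in E2.
  destruct (circle_int G r1) as [x1 y1]. destruct (circle_int G r2) as [x2 y2].
  unfold Re, Im in *. cbn [fst snd] in *. f_equal; lra.
Qed.

(** Compactness of the angle interval makes the pointwise moduli of continuity uniform. *)
Lemma circle_uniform (G : C -> C) (rho e : R) : 0 <= rho -> 0 < e ->
  (forall z, Cmod z = rho -> ccont G z) ->
  exists d, 0 < d /\ forall rho' t, Rabs (rho' - rho) < d -> 0 <= t <= 2 * PI ->
    Cmod (G (polar rho' t) - G (polar rho t)) < e.
Proof.
  intros Hr He HG.
  assert (H : forall t, exists d, 0 < d /\ forall w, Cmod (w - polar rho t) < d ->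
    Cmod (G w - G (polar rho t)) < e / 2).
  { intros t. apply (HG (polar rho t)); [apply Cmod_polar, Hr|lra]. }
  apply choice in H. destruct H as [dl Hdl].
  assert (Hp : forall t, 0 < dl t / (2 * rho + 1)).
  { intros t. apply Rdiv_lt_0_compat; [apply Hdl|lra]. }
  assert (Hp2 : forall t, 0 < dl t / (2 * rho + 1) / 2).
  { intros t. specialize (Hp t). lra. }
  destruct (compactness_value_1d 0 (2 * PI) (fun t => mkposreal _ (Hp2 t))) as [d Hd].
  exists d. split; [apply cond_pos|]. intros rho' t Hrho Ht.
  specialize (Hd t Ht). apply NNPP in Hd. destruct Hd as [u [_ [Hu1 Hu2]]]. simpl in Hu1, Hu2.
  destruct (Hdl u) as [Hu0 Hu3]. set (m := dl u / (2 * rho + 1) / 2) in *.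
  assert (Hm : m * (2 * (2 * rho + 1)) = dl u) by (unfold m; field; lra).
  assert (Hm0 : 0 < m) by apply Hp2.
  pose proof (Rabs_pos (t - u)).
  assert (Hin : forall x, Rabs (x - rho) < d -> Cmod (polar x t - polar rho u) < dl u).
  { intros x Hx. eapply Rle_lt_trans; [apply polar_lipschitz, Hr|].
    assert (2 * rho * Rabs (t - u) <= 2 * rho * m) by (apply Rmult_le_compat_l; lra).
    nra. }
  pose proof (Hu3 _ (Hin rho' Hrho)) as A.
  assert (B : Cmod (G (polar rho t) - G (polar rho u)) < e / 2).
  { apply Hu3, Hin. rewrite Rminus_diag, Rabs_R0. apply cond_pos. }
  replace (G (polar rho' t) - G (polar rho t))%C with
    ((G (polar rho' t) - G (polar rho u)) - (G (polar rho t) - G (polar rho u)))%C by ring.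
  eapply Rle_lt_trans; [apply Cmod_minus_le|]. lra.
Qed.

Lemma circle_int_continuous (G : C -> C) (rho e : R) : 0 <= rho -> 0 < e ->
  (forall z, Cmod z = rho -> ccont G z) ->
  exists d, 0 < d /\ forall rho', Rabs (rho' - rho) < d -> 0 <= rho' ->
    (forall z, Cmod z = rho' -> ccont G z) ->
    Cmod (circle_int G rho' - circle_int G rho) <= e.
Proof.
  intros Hr He HG. pose proof PI_RGT_0 as HPI.
  destruct (circle_uniform G rho (e / (2 * PI)) Hr) as [d [Hd H]]; auto.
  { apply Rdiv_lt_0_compat; lra. }
  exists d. split; [auto|]. intros rho' Hrho Hr' HG'.
  unfold circle_int. rewrite <- cint_minus by (apply path_cont_circle; auto).
  replace e with ((2 * PI - 0) * (e / (2 * PI))) by (field; lra).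
  apply Cmod_cint_le_const; [lra| |].
  - apply path_cont_minus; apply path_cont_circle; auto.
  - intros t Ht. left. apply H; auto.
Qed.

Lemma eq_of_Cmod_le (a b : C) : (forall e, 0 < e -> Cmod (a - b) <= e) -> a = b.
Proof.
  intros H. assert (E : Cmod (a - b) = 0).
  { apply Rle_antisym; [|apply Cmod_ge_0]. apply Rnot_lt_le. intros Hlt.
    specialize (H (Cmod (a - b) / 2)). lra. }
  apply Cmod_eq_0 in E. replace a with ((a - b) + b)%C by ring. rewrite E. ring.
Qed.

(* The circle where [G] is only continuous is crossed by continuity of [rho |-> circle_int G rho]. *)
Lemma circle_int_center (G : C -> C) (r0 Rad rho : R) : 0 <= r0 -> 0 <= rho < Rad ->
  (forall z, Cmod z < Rad -> ccont G z) ->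
  (forall z, 0 < Cmod z < Rad -> Cmod z <> r0 -> cdiff G z) ->
  circle_int G rho = (RtoC (2 * PI) * G 0)%C.
Proof.
  intros Hr0 Hrho Hc Hd.
  assert (H0 : circle_int G 0 = (RtoC (2 * PI) * G 0)%C).
  { unfold circle_int. rewrite (cint_ext _ (fun _ => G 0)).
    - rewrite cint_const. f_equal. f_equal. ring.
    - intros t. rewrite polar_zero. reflexivity. }
  rewrite <- H0. clear H0.
  assert (Hcont : forall x, 0 <= x < Rad -> forall z, Cmod z = x -> ccont G z).
  { intros x Hx z Hz. apply Hc. lra. }
  assert (HA : forall x, 0 <= x < Rad -> x < r0 -> circle_int G x = circle_int G 0).
  { intros x Hx Hlt. apply eq_of_Cmod_le. intros e He.
    destruct (circle_int_continuous G 0 e) as [d [Hdp Hdd]]; [lra|auto|apply Hcont; lra|].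
    destruct (Req_dec x 0) as [->|Hx0]; [rewrite Cmod_sub_self; lra|].
    set (y := Rmin (d / 2) (x / 2)).
    assert (Hy : 0 < y) by (apply Rmin_pos; lra).
    assert (Hy1 : y <= d / 2) by apply Rmin_l. assert (Hy2 : y <= x / 2) by apply Rmin_r.
    rewrite <- (circle_int_annulus G y x); [|lra|].
    - apply Hdd; [rewrite Rminus_0_r, Rabs_right; lra|lra|apply Hcont; lra].
    - intros z Hz. apply Hd; lra. }
  (* The exceptional radius itself is a limit of smaller radii. *)
  assert (HB : forall x, 0 <= x < Rad -> x <= r0 -> circle_int G x = circle_int G 0).
  { intros x Hx Hle. destruct Hle as [Hlt|Heq]; [auto|].
    destruct (Req_dec x 0) as [->|Hx0]; [reflexivity|].
    apply eq_of_Cmod_le. intros e He.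
    destruct (circle_int_continuous G x e) as [d [Hdp Hdd]]; [lra|auto|apply Hcont; lra|].
    set (y := x - Rmin (d / 2) (x / 2)).
    assert (Hy : 0 < Rmin (d / 2) (x / 2)) by (apply Rmin_pos; lra).
    pose proof (Rmin_l (d / 2) (x / 2)). pose proof (Rmin_r (d / 2) (x / 2)).
    rewrite <- (HA y) by (unfold y; lra). rewrite Cmod_sub_sym.
    apply Hdd; [apply Rabs_def1; unfold y; lra|unfold y; lra|apply Hcont; unfold y; lra]. }
  destruct (Rle_dec rho r0) as [Hle|Hgt]; [auto|].
  (* Beyond [r0], the circle is shrunk towards [r0] from outside. *)
  rewrite <- (HB r0) by lra. apply eq_of_Cmod_le. intros e He.
  destruct (circle_int_continuous G r0 e) as [d [Hdp Hdd]]; [lra|auto|apply Hcont; lra|].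
  set (y := r0 + Rmin (d / 2) ((rho - r0) / 2)).
  assert (Hy : 0 < Rmin (d / 2) ((rho - r0) / 2)) by (apply Rmin_pos; lra).
  pose proof (Rmin_l (d / 2) ((rho - r0) / 2)). pose proof (Rmin_r (d / 2) ((rho - r0) / 2)).
  rewrite <- (circle_int_annulus G y rho).
  - apply Hdd; [apply Rabs_def1; unfold y; lra|unfold y; lra|apply Hcont; unfold y; lra].
  - unfold y; lra.
  - intros z Hz. apply Hd; unfold y in *; lra.
Qed.

(** * Cauchy's formula and orders of vanishing *)

Lemma neq_of_Cmod (z w : C) : Cmod z <> Cmod w -> z <> w.
Proof. intros H ->. apply H. reflexivity. Qed.

Lemma Cmod_sub_lower (z w : C) : Cmod z - Cmod w <= Cmod (z - w).
Proof. pose proof (Cmod_triangle_sub z w). lra. Qed.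

Lemma cdiff_kernel (w z : C) : z <> w -> cdiff (fun z => z / (z - w))%C z.
Proof.
  intros H. apply cdiff_div; [apply cdiff_id| |apply sub_neq0, H].
  apply cdiff_minus; [apply cdiff_id|apply cdiff_const].
Qed.

(** The circle may be pushed outwards, and z / (z - w) tends to 1 at infinity. *)
Lemma circle_int_kernel (w : C) (rho : R) : Cmod w < rho ->
  circle_int (fun z => z / (z - w))%C rho = RtoC (2 * PI).
Proof.
  intros Hw. pose proof (Cmod_ge_0 w) as Hw0. pose proof PI_RGT_0 as HPI.
  assert (Hd : forall z, rho <= Cmod z -> cdiff (fun z => z / (z - w))%C z).
  { intros z Hz. apply cdiff_kernel, neq_of_Cmod. lra. }
  apply eq_of_Cmod_le. intros e He.
  (* On |z| = rho + N one has |z - w| >= N, so |w / (z - w)| <= e / (2 PI). *)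
  set (N := Cmod w * (2 * PI) / e).
  assert (HN : 0 <= N).
  { apply Rmult_le_pos; [nra|]. left. apply Rinv_0_lt_compat, He. }
  set (y := rho + N).
  rewrite (circle_int_annulus _ rho y) by (unfold y; try (split; lra); intros; apply Hd; lra).
  assert (Hy : 0 <= y) by (unfold y; lra).
  assert (Hpc : path_cont (fun t => polar y t / (polar y t - w))%C).
  { apply (path_cont_circle (fun z => z / (z - w))%C y Hy).
    intros z Hz. apply cdiff_ccont, Hd. unfold y in Hz; lra. }
  replace (RtoC (2 * PI)) with (cint (fun _ => RtoC 1) 0 (2 * PI))
    by (rewrite cint_const, Rminus_0_r; ring).
  unfold circle_int. rewrite <- cint_minus by (auto; apply path_cont_const).
  replace e with ((2 * PI - 0) * (e / (2 * PI))) by (field; lra).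
  apply Cmod_cint_le_const; [lra|apply path_cont_minus; auto; apply path_cont_const|].
  intros t _. set (z := polar y t).
  assert (Hz : Cmod z = y) by (apply Cmod_polar, Hy).
  assert (Hn : (z - w)%C <> 0) by (apply sub_neq0, neq_of_Cmod; unfold y in *; lra).
  replace (z / (z - w) - 1)%C with (w / (z - w))%C by (field; auto).
  rewrite Cmod_div by auto.
  pose proof (Cmod_sub_lower z w) as Hl. rewrite Hz in Hl.
  apply Cmod_gt_0 in Hn.
  apply Rmult_le_reg_r with (Cmod (z - w)); [auto|].
  unfold Rdiv at 1. rewrite Rmult_assoc, Rinv_l, Rmult_1_r by lra.
  apply Rle_trans with (e / (2 * PI) * N).
  - unfold N. apply Req_le. field. lra.
  - apply Rmult_le_compat_l; [left; apply Rdiv_lt_0_compat; lra|]. unfold y in Hl; lra.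
Qed.

(** The function z (g z - g w) / (z - w) vanishes at 0, extends continuously to w by the slope
    function of [cdiff], and is differentiable off the circle |z| = |w|. [circle_int_center], with
    that circle as the exceptional one, makes its integral 0; then the difference is split. *)
Lemma cauchy_formula (g : C -> C) (Rad rho : R) (w : C) : Cmod w < rho < Rad ->
  (forall z, Cmod z < Rad -> cdiff g z) ->
  circle_int (fun z => g z * (z / (z - w)))%C rho = (RtoC (2 * PI) * g w)%C.
Proof.
  intros [Hw Hr] Hg. pose proof (Cmod_ge_0 w) as Hw0.
  destruct (Hg w) as [phi [d [Hd [Hp He]]]]; [lra|].
  set (h := fun z => if excluded_middle_informative (z = w) then phi w
                     else ((g z - g w) / (z - w))%C).
  assert (Hh : forall z, z <> w -> h z = ((g z - g w) / (z - w))%C).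
  { intros z Hz. unfold h. destruct (excluded_middle_informative (z = w)); easy. }
  assert (Hhd : forall z, Cmod z < Rad -> z <> w -> cdiff h z).
  { intros z Hz Hne. pose proof (proj1 (Cmod_gt_0 _) (sub_neq0 _ _ Hne)) as Hpos.
    apply (cdiff_ext_loc (fun z => (g z - g w) / (z - w))%C h z (Cmod (z - w))); [auto| |].
    - intros u Hu. symmetry. apply Hh. intros ->. rewrite Cmod_sub_sym in Hu. lra.
    - apply cdiff_div; [|apply cdiff_minus; [apply cdiff_id|apply cdiff_const]|
        apply sub_neq0, Hne].
      apply cdiff_minus; [apply Hg, Hz|apply cdiff_const]. }
  assert (Hhc : ccont h w).
  { apply (ccont_ext_loc phi h w d Hd); [|exact Hp]. intros z Hz.
    unfold h. destruct (excluded_middle_informative (z = w)) as [->|n]; [reflexivity|].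
    rewrite (He z Hz). field. apply sub_neq0, n. }
  set (G := fun z => (z * h z)%C).
  assert (E : circle_int G rho = (RtoC (2 * PI) * G 0)%C).
  { apply (circle_int_center G (Cmod w) Rad rho); [auto|lra| |].
    - intros z Hz. apply ccont_mult; [apply ccont_id|].
      destruct (classic (z = w)) as [->|n]; [exact Hhc|]. apply cdiff_ccont, Hhd; auto.
    - intros z [_ Hz] Hne. apply cdiff_mult; [apply cdiff_id|].
      apply Hhd; [auto|]. apply neq_of_Cmod, Hne. }
  unfold G in E at 2. rewrite Cmult_0_l, Cmult_0_r in E.
  assert (Hne : forall t, polar rho t <> w).
  { intros t. apply neq_of_Cmod. rewrite Cmod_polar; lra. }
  assert (Hk : path_cont (fun t => polar rho t / (polar rho t - w))%C).
  { apply (path_cont_circle (fun z => z / (z - w))%C); [lra|]. intros z Hz.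
    apply cdiff_ccont, cdiff_kernel, neq_of_Cmod. lra. }
  assert (Hgk : path_cont (fun t => g (polar rho t) * (polar rho t / (polar rho t - w)))%C).
  { apply (path_cont_circle (fun z => g z * (z / (z - w)))%C); [lra|]. intros z Hz.
    apply cdiff_ccont, cdiff_mult; [apply Hg; lra|apply cdiff_kernel, neq_of_Cmod; lra]. }
  unfold circle_int in E. rewrite (cint_ext _ (fun t =>
    g (polar rho t) * (polar rho t / (polar rho t - w)) -
    g w * (polar rho t / (polar rho t - w)))%C) in E.
  - rewrite cint_minus in E by (auto; apply path_cont_scal; auto).
    rewrite cint_scal in E by auto.
    pose proof (circle_int_kernel w rho Hw) as K. unfold circle_int in K. rewrite K in E.
    unfold circle_int. rewrite (Cmult_comm (RtoC (2 * PI))).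
    match goal with |- ?a = ?b => replace a with ((a - b) + b)%C by ring end.
    rewrite E. ring.
  - intros t. unfold G. rewrite Hh by auto. field. apply sub_neq0, Hne.
Qed.

Lemma path_cont_bounded (f : R -> C) (a b : R) : a <= b -> path_cont f ->
  exists M, forall t, a <= t <= b -> Cmod (f t) <= M.
Proof.
  intros Hab Hf. destruct (continuity_ab_maj (fun t => Cmod (f t)) a b Hab) as [x [Hx _]].
  - intros c _. apply continuity_pt_filterlim, path_cont_Cmod, Hf.
  - exists (Cmod (f x)). exact Hx.
Qed.

Lemma least_nat (P : nat -> Prop) : (exists n, P n) ->
  exists n, P n /\ forall m, (m < n)%nat -> ~ P m.
Proof.
  intros [n Hn]. induction n as [n IH] using (well_founded_induction Wf_nat.lt_wf).
  destruct (classic (exists m, (m < n)%nat /\ P m)) as [[m [H1 H2]]|H]; [eauto|].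
  exists n. split; [auto|]. intros m Hm Hp. apply H. eauto.
Qed.

Lemma RtoC_neq0 (x : R) : x <> 0 -> RtoC x <> RtoC 0.
Proof. intros H E. apply H, RtoC_inj, E. Qed.

(* Cauchy's formula with [z / (z - w) = sum_(n < m) (w / z)^n + (w / z)^m z / (z - w)]. *)
Lemma zero_order (g : C -> C) (Rad : R) : 0 < Rad ->
  (forall z, Cmod z < Rad -> cdiff g z) ->
  (exists d, 0 < d /\ forall z, Cmod z < d -> g z = 0) \/
  (exists (m : nat) (c : C), c <> 0 /\ forall e, 0 < e -> exists d, 0 < d /\
     forall z, Cmod z < d -> Cmod (g z - c * z ^ m) <= e * Cmod z ^ m).
Proof.
  intros HR Hg. set (rho := Rad / 2). assert (Hrho : 0 < rho < Rad) by (unfold rho; lra).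
  pose proof PI_RGT_0 as HPI.
  destruct (path_cont_bounded (fun t => g (polar rho t)) 0 (2 * PI)) as [M HM]; [lra| |].
  { apply path_cont_circle; [lra|]. intros z Hz. apply cdiff_ccont, Hg; lra. }
  assert (HM0 : 0 <= M).
  { eapply Rle_trans; [apply Cmod_ge_0|apply (HM 0); lra]. }
  assert (Hnz : forall z, Cmod z = rho -> z <> 0).
  { intros z Hz. apply Cmod_pos_neq0. lra. }
  (* 2 PI times the n-th Taylor coefficient at 0; [rem n] is 2 PI times the remainder after n
     terms. *)
  set (A := fun n => circle_int (fun z => g z * / z ^ n)%C rho).
  set (rem := fun n w => circle_int (fun z => g z * ((w / z) ^ n * (z / (z - w))))%C rho).
  assert (Hc : forall n w z, Cmod w < rho -> Cmod z = rho ->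
    ccont (fun z => g z * ((w / z) ^ n * (z / (z - w))))%C z).
  { intros n w z Hw Hz. apply ccont_mult; [apply cdiff_ccont, Hg; lra|].
    apply ccont_mult; [|apply cdiff_ccont, cdiff_kernel, neq_of_Cmod; lra].
    apply ccont_pow, ccont_div; [apply ccont_const|apply ccont_id|apply Hnz, Hz]. }
  assert (Hrem0 : forall w, Cmod w < rho -> rem O w = (RtoC (2 * PI) * g w)%C).
  { intros w Hw. rewrite <- (cauchy_formula g Rad rho w) by (auto; lra).
    apply cint_ext. intros t. simpl. ring. }
  assert (HremS : forall n w, Cmod w < rho -> rem n w = (w ^ n * A n + rem (S n) w)%C).
  { intros n w Hw. unfold rem, A, circle_int.
    assert (PA : path_cont (fun t => g (polar rho t) * / polar rho t ^ n)%C).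
    { apply (path_cont_circle (fun z => g z * / z ^ n)%C); [lra|]. intros z Hz.
      apply ccont_mult; [apply cdiff_ccont, Hg; lra|].
      apply ccont_inv; [apply ccont_pow, ccont_id|apply Cpow_nz, Hnz, Hz]. }
    rewrite <- cint_scal by exact PA. rewrite <- cint_plus.
    - apply cint_ext. intros t.
      assert (Hz : Cmod (polar rho t) = rho) by (apply Cmod_polar; lra).
      set (z := polar rho t) in *.
      assert (z <> 0) by (apply Hnz, Hz).
      assert ((z - w)%C <> 0) by (apply sub_neq0, neq_of_Cmod; lra).
      assert ((z ^ n)%C <> 0) by (apply Cpow_nz; auto).
      unfold Cdiv. rewrite !Cpow_mult_l, !Cpow_inv by auto. simpl. field. auto.
    - apply path_cont_scal, PA.
    - apply (path_cont_circle (fun z => g z * ((w / z) ^ S n * (z / (z - w))))%C); [lra|].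
      intros z Hz. apply Hc; auto. }
  (* For |w| <= rho / 2 and |z| = rho, |z / (z - w)| <= 2. *)
  assert (HremB : forall n w, Cmod w <= rho / 2 ->
    Cmod (rem n w) <= 2 * PI * (2 * M * (Cmod w / rho) ^ n)).
  { intros n w Hw. replace (2 * PI) with (2 * PI - 0) by ring.
    apply Cmod_cint_le_const; [lra| |].
    - apply (path_cont_circle (fun z => g z * ((w / z) ^ n * (z / (z - w))))%C); [lra|].
      intros z Hz. apply Hc; [lra|auto].
    - intros t Ht. assert (Hz : Cmod (polar rho t) = rho) by (apply Cmod_polar; lra).
      specialize (HM t Ht). set (z := polar rho t) in *.
      assert (z <> 0) by (apply Hnz, Hz).
      assert (Hn : (z - w)%C <> 0) by (apply sub_neq0, neq_of_Cmod; lra).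
      rewrite !Cmod_mult, Cmod_pow, !Cmod_div, Hz by auto.
      pose proof (Cmod_sub_lower z w). rewrite Hz in *.
      assert (Hk : rho / Cmod (z - w) <= 2).
      { apply Rmult_le_reg_r with (Cmod (z - w)); [lra|].
        unfold Rdiv. rewrite Rmult_assoc, Rinv_l by lra. lra. }
      assert (0 <= Cmod w / rho).
      { apply Rmult_le_pos; [apply Cmod_ge_0|]. left. apply Rinv_0_lt_compat; lra. }
      pose proof (pow_le _ n H1) as Hpw.
      assert (0 <= rho / Cmod (z - w)).
      { apply Rmult_le_pos; [lra|]. left. apply Rinv_0_lt_compat; lra. }
      replace (2 * M * (Cmod w / rho) ^ n) with (M * ((Cmod w / rho) ^ n * 2)) by ring.
      apply Rmult_le_compat; auto using Cmod_ge_0.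
      + apply Rmult_le_pos; auto.
      + apply Rmult_le_compat_l; auto. }
  assert (Hlow : forall n, (forall k, (k < n)%nat -> A k = 0) -> forall w, Cmod w < rho ->
    (RtoC (2 * PI) * g w)%C = rem n w).
  { intros n. induction n as [|n IH]; intros HA w Hw.
    - symmetry. apply Hrem0, Hw.
    - rewrite IH by (auto; intros; apply HA; lia).
      rewrite HremS by auto. rewrite (HA n) by lia. ring. }
  assert (H2pi : RtoC (2 * PI) <> RtoC 0) by (apply RtoC_neq0; lra).
  (* The first nonzero coefficient gives the leading term. If there is none, 2 PI g equals every
     remainder, and these tend to 0. *)
  destruct (classic (exists n, A n <> 0)) as [Hex|Hall].
  - right. destruct (least_nat _ Hex) as [m [Hm1 Hm2]].
    exists m, (A m / RtoC (2 * PI))%C. split.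
    { intros E. apply Hm1. replace (A m) with (A m / RtoC (2 * PI) * RtoC (2 * PI))%C
        by (field; auto). rewrite E. ring. }
    intros e He. set (K := 2 * M / rho ^ S m).
    assert (Hpm : 0 < rho ^ S m) by (apply pow_lt; lra).
    assert (HK : 0 <= K) by (apply Rmult_le_pos; [lra|]; left; apply Rinv_0_lt_compat, Hpm).
    exists (Rmin (rho / 2) (e / (K + 1))).
    split. { apply Rmin_pos; [lra|]. apply Rdiv_lt_0_compat; lra. }
    intros w Hw.
    assert (Hw1 : Cmod w < rho / 2) by (eapply Rlt_le_trans; [exact Hw|apply Rmin_l]).
    assert (Hw2 : Cmod w < e / (K + 1)) by (eapply Rlt_le_trans; [exact Hw|apply Rmin_r]).
    assert (E : (RtoC (2 * PI) * g w)%C = (w ^ m * A m + rem (S m) w)%C).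
    { rewrite <- HremS by lra. apply Hlow; [|lra]. intros k Hk. apply NNPP, Hm2, Hk. }
    replace (g w - A m / RtoC (2 * PI) * w ^ m)%C with (rem (S m) w / RtoC (2 * PI))%C.
    2:{ replace (rem (S m) w) with (RtoC (2 * PI) * g w - w ^ m * A m)%C
          by (rewrite E; ring). field. auto. }
    rewrite Cmod_div, Cmod_R, Rabs_right by (auto; lra).
    specialize (HremB (S m) w ltac:(lra)).
    pose proof (Cmod_ge_0 w) as Hw0. pose proof (pow_le _ m Hw0) as Hwm.
    apply Rle_trans with (K * Cmod w * Cmod w ^ m).
    + apply Rmult_le_reg_r with (2 * PI); [lra|].
      unfold Rdiv at 1. rewrite Rmult_assoc, Rinv_l, Rmult_1_r by lra.
      eapply Rle_trans; [exact HremB|]. unfold K, Rdiv. rewrite Rpow_mult_distr, pow_inv.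
      simpl. apply Req_le. ring.
    + apply Rmult_le_compat_r; [auto|].
      assert (Cmod w * (K + 1) <= e).
      { replace e with (e / (K + 1) * (K + 1)) by (field; lra).
        apply Rmult_le_compat_r; lra. }
      nra.
  - left. exists (rho / 2). split; [lra|]. intros w Hw.
    assert (E : (RtoC (2 * PI) * g w)%C = 0).
    { apply eq_of_Cmod_le. intros e He. replace (RtoC (2 * PI) * g w - 0)%C with
        (RtoC (2 * PI) * g w)%C by ring.
      destruct (pow_lt_1_zero (1 / 2)) with (y := e / (4 * PI * (M + 1))) as [N HN].
      { rewrite Rabs_right; lra. }
      { apply Rdiv_lt_0_compat; nra. }
      specialize (HN N (Nat.le_refl N)).
      assert (HpN : 0 < (1 / 2) ^ N) by (apply pow_lt; lra).
      rewrite Rabs_right in HN by lra.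
      rewrite (Hlow N) by (try lra; intros; apply NNPP; intros Hk; apply Hall; eauto).
      eapply Rle_trans; [apply HremB; lra|].
      assert ((Cmod w / rho) ^ N <= (1 / 2) ^ N).
      { apply pow_incr. pose proof (Cmod_ge_0 w). split.
        - apply Rmult_le_pos; [auto|]. left. apply Rinv_0_lt_compat; lra.
        - apply Rmult_le_reg_r with rho; [lra|]. unfold Rdiv at 1.
          rewrite Rmult_assoc, Rinv_l by lra. lra. }
      apply Rle_trans with (4 * PI * (M + 1) * (1 / 2) ^ N).
      - replace (2 * PI * (2 * M * (Cmod w / rho) ^ N)) with
          (4 * PI * (M * (Cmod w / rho) ^ N)) by ring.
        replace (4 * PI * (M + 1) * (1 / 2) ^ N) with (4 * PI * ((M + 1) * (1 / 2) ^ N)) by ring.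
        apply Rmult_le_compat_l; [lra|].
        apply Rmult_le_compat; try lra. apply pow_le.
        apply Rmult_le_pos; [apply Cmod_ge_0|]. left. apply Rinv_0_lt_compat; lra.
      - replace e with (4 * PI * (M + 1) * (e / (4 * PI * (M + 1)))) by (field; lra).
        apply Rmult_le_compat_l; [nra|lra]. }
    replace (g w) with (RtoC (2 * PI) * g w / RtoC (2 * PI))%C by (field; auto).
    rewrite E. unfold Cdiv. ring.
Qed.

Lemma zeros_isolated (T : C -> C) (z0 : C) (Rad : R) : 0 < Rad ->
  (forall z, Cmod (z - z0) < Rad -> cdiff T z) ->
  (exists d, 0 < d /\ forall z, Cmod (z - z0) < d -> T z = 0) \/
  (exists d, 0 < d /\ forall z, 0 < Cmod (z - z0) < d -> T z <> 0).
Proof.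
  intros HR HT. destruct (zero_order (fun h => T (z0 + h)%C) Rad HR) as [[d [Hd H]]|H].
  - intros h Hh. apply (cdiff_comp T (fun h => z0 + h)%C).
    + apply cdiff_plus; [apply cdiff_const|apply cdiff_id].
    + apply HT. replace (z0 + h - z0)%C with h by ring. exact Hh.
  - left. exists d. split; [auto|]. intros z Hz. specialize (H (z - z0)%C Hz).
    replace (z0 + (z - z0))%C with z in H by ring. exact H.
  - right. destruct H as [m [c [Hc H]]]. pose proof (proj1 (Cmod_gt_0 _) Hc) as Hcp.
    destruct (H (Cmod c / 2)) as [d [Hd Hb]]; [lra|].
    exists d. split; [auto|]. intros z [Hz0 Hz] E. specialize (Hb (z - z0)%C Hz).
    replace (z0 + (z - z0))%C with z in Hb by ring. rewrite E in Hb.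
    replace (0 - c * (z - z0) ^ m)%C with (- (c * (z - z0) ^ m))%C in Hb by ring.
    rewrite Cmod_opp, Cmod_mult, Cmod_pow in Hb.
    pose proof (pow_lt _ m Hz0). nra.
Qed.

(** * The identity theorem *)

(* Along a path in polar coordinates the indicator of "T vanishes near the point" is
   locally constant, hence has zero derivative and is constant. *)
Lemma identity_annulus (T : C -> C) (r1 r2 : R) (z0 : C) : 0 <= r1 ->
  (forall z, r1 < Cmod z < r2 -> cdiff T z) -> r1 < Cmod z0 < r2 ->
  (forall d, 0 < d -> exists z, 0 < Cmod (z - z0) < d /\ T z = 0) ->
  forall z, r1 < Cmod z < r2 -> T z = 0.
Proof.
  intros Hr1 HT Hz0 Hacc z1 Hz1.
  set (Z := fun z => exists d, 0 < d /\ forall w, Cmod (w - z) < d -> T w = 0).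
  assert (Hdich : forall z, r1 < Cmod z < r2 ->
    Z z \/ exists d, 0 < d /\ forall w, 0 < Cmod (w - z) < d -> T w <> 0).
  { intros z Hz. apply (zeros_isolated T z (Rmin (Cmod z - r1) (r2 - Cmod z))).
    { apply Rmin_pos; lra. }
    intros w Hw.
    assert (Cmod (w - z) < Cmod z - r1) by (eapply Rlt_le_trans; [exact Hw|apply Rmin_l]).
    assert (Cmod (w - z) < r2 - Cmod z) by (eapply Rlt_le_trans; [exact Hw|apply Rmin_r]).
    pose proof (Cmod_triangle_sub w z). pose proof (Cmod_triangle_sub z w) as H2.
    rewrite Cmod_sub_sym in H2. apply HT. lra. }
  assert (HZ0 : Z z0).
  { destruct (Hdich z0 Hz0) as [H|[d [Hd H]]]; [exact H|].
    destruct (Hacc d Hd) as [z [Hz Hz']]. exfalso. apply (H z); auto. }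
  destruct (polar_exists z0) as [t0 E0]. destruct (polar_exists z1) as [t1 E1].
  set (m0 := Cmod z0) in *. set (m1 := Cmod z1) in *.
  set (rr := fun x => (1 - x) * m0 + x * m1).
  (* Radius and angle are interpolated separately, which keeps the path inside the annulus. *)
  set (gam := fun x => polar (rr x) ((1 - x) * t0 + x * t1)).
  assert (Hrr : forall x, 0 <= x <= 1 -> r1 < rr x < r2) by (intros x Hx; unfold rr; clearbody m0 m1; split; destruct (Rle_dec x (1 / 2)); nra).
  assert (Hgc : forall x e, 0 <= x <= 1 -> 0 < e -> exists d, 0 < d /\ forall y,
    Rabs (y - x) < d -> Cmod (gam y - gam x) < e).
  { intros x e Hx He. set (K := Rabs (m1 - m0) + 2 * rr x * Rabs (t1 - t0)).
    specialize (Hrr x Hx).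
    pose proof (Rabs_pos (m1 - m0)). pose proof (Rabs_pos (t1 - t0)).
    assert (HK : 0 <= K) by (unfold K; nra).
    exists (e / (K + 1)). split; [apply Rdiv_lt_0_compat; lra|]. intros y Hy.
    eapply Rle_lt_trans; [apply polar_lipschitz; lra|].
    replace (rr y - rr x) with ((y - x) * (m1 - m0)) by (unfold rr; ring).
    replace ((1 - y) * t0 + y * t1 - ((1 - x) * t0 + x * t1)) with ((y - x) * (t1 - t0)) by ring.
    rewrite !Rabs_mult. pose proof (Rabs_pos (y - x)).
    replace (Rabs (y - x) * Rabs (m1 - m0) + 2 * rr x * (Rabs (y - x) * Rabs (t1 - t0)))
      with (Rabs (y - x) * K) by (unfold K; ring).
    assert (Rabs (y - x) * (K + 1) < e).
    { replace e with (e / (K + 1) * (K + 1)) by (field; lra). apply Rmult_lt_compat_r; lra. }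
    nra. }
  set (chi := fun x => if excluded_middle_informative (Z (gam x)) then 1 else 0).
  assert (Hchi : chi 0 = chi 1).
  { apply (eq_is_derive (V := R_NormedModule) chi 0 1); [|lra]. intros x Hx.
    assert (Hloc : exists d, 0 < d /\ forall y, Rabs (y - x) < d -> chi y = chi x).
    { destruct (Hdich (gam x)) as [HZ|[d [Hd HN]]].
      { specialize (Hrr x Hx). unfold gam. rewrite Cmod_polar; lra. }
      - destruct HZ as [d [Hd HZ]]. destruct (Hgc x d Hx Hd) as [d' [Hd' Hg]].
        exists d'. split; [auto|]. intros y Hy. specialize (Hg y Hy). unfold chi.
        destruct (excluded_middle_informative (Z (gam x))) as [_|n];
          [|exfalso; apply n; exists d; auto].
        destruct (excluded_middle_informative (Z (gam y))) as [_|n]; [reflexivity|].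
        exfalso. apply n. exists (d - Cmod (gam y - gam x)). split; [lra|].
        intros w Hw. apply HZ.
        replace (w - gam x)%C with ((w - gam y) + (gam y - gam x))%C by ring.
        eapply Rle_lt_trans; [apply Cmod_triangle|]. lra.
      - destruct (Hgc x d Hx Hd) as [d' [Hd' Hg]].
        assert (Hn : forall y, Rabs (y - x) < d' -> ~ Z (gam y)).
        { intros y Hy [u [Hu HZ]]. specialize (Hg y Hy).
          (* A point of the punctured disc around [gam x] where T vanishes is needed: [gam y]
             itself, or, if it is the centre, the nearby point [gam x + m]. *)
          destruct (classic (gam y = gam x)) as [E|E].
          - rewrite E in HZ. set (m := Rmin u d / 2).
            assert (Hm : 0 < m) by (unfold m; assert (0 < Rmin u d) by (apply Rmin_pos; auto); lra).
            pose proof (Rmin_l u d). pose proof (Rmin_r u d).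
            assert (Hmm : Cmod (gam x + RtoC m - gam x) = m).
            { replace (gam x + RtoC m - gam x)%C with (RtoC m) by ring.
              rewrite Cmod_R. apply Rabs_right. lra. }
            apply (HN (gam x + RtoC m)%C); [|apply HZ]; rewrite Hmm; unfold m in *; lra.
          - apply (HN (gam y)).
            + split; [apply Cmod_gt_0, sub_neq0, E|exact Hg].
            + apply HZ. rewrite Cmod_sub_self. exact Hu. }
        exists d'. split; [auto|]. intros y Hy. unfold chi.
        destruct (excluded_middle_informative (Z (gam y))) as [H|_];
          [exfalso; apply (Hn y Hy H)|].
        destruct (excluded_middle_informative (Z (gam x))) as [H|_]; [|reflexivity].
        exfalso. apply (Hn x); [rewrite Rminus_diag, Rabs_R0; auto|exact H]. }
    destruct Hloc as [d [Hd Hloc]].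
    apply (is_derive_ext_loc (V := R_NormedModule) (fun _ => chi x)).
    - exists (mkposreal d Hd). intros y Hy. symmetry. apply Hloc, Hy.
    - apply (is_derive_const (V := R_NormedModule)). }
  unfold chi in Hchi.
  replace (gam 0) with z0 in Hchi
    by (unfold gam, rr; rewrite E0 at 1; f_equal; ring).
  replace (gam 1) with z1 in Hchi
    by (unfold gam, rr; rewrite E1 at 1; f_equal; ring).
  destruct (excluded_middle_informative (Z z0)) as [_|n]; [|easy].
  destruct (excluded_middle_informative (Z z1)) as [[d [Hd HZ]]|_]; [|lra].
  apply HZ. rewrite Cmod_sub_self. exact Hd.
Qed.

Lemma polar_locally_injective (rho s t : R) : 0 < rho -> 0 < Rabs (t - s) < PI ->
  polar rho t <> polar rho s.
Proof.
  intros Hr Ht E. unfold polar in E. injection E as E1 E2.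
  apply Rmult_eq_reg_l in E1; [|lra]. apply Rmult_eq_reg_l in E2; [|lra].
  assert (H : sin (t - s) = 0) by (rewrite sin_minus, E1, E2; ring).
  destruct (Rle_dec 0 (t - s)) as [Hp|Hn].
  - rewrite Rabs_right in Ht by lra. pose proof (sin_gt_0 (t - s)). lra.
  - rewrite Rabs_left in Ht by lra. pose proof (sin_gt_0 (- (t - s))) as Hs.
    rewrite sin_neg in Hs. lra.
Qed.

(** By local injectivity of [polar], zeros accumulating in the angle give zeros accumulating in the
    plane at another point of the circle, and the identity theorem applies. *)
Lemma circle_zeros_isolated (T : C -> C) (r1 r2 rho : R) : 0 <= r1 -> r1 < rho < r2 ->
  (forall z, r1 < Cmod z < r2 -> cdiff T z) ->
  (forall z, r1 < Cmod z < r2 -> T z = 0) \/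
  forall t0, exists d, 0 < d /\ forall t, 0 < Rabs (t - t0) < d -> T (polar rho t) <> 0.
Proof.
  intros Hr1 Hrho HT. apply NNPP. intros Hn. apply not_or_and in Hn. destruct Hn as [Hn1 Hn2].
  apply Hn1. apply not_all_ex_not in Hn2. destruct Hn2 as [t0 Hn2].
  apply (identity_annulus T r1 r2 (polar rho t0)); auto.
  { rewrite Cmod_polar; lra. }
  intros d Hd. pose proof PI_RGT_0 as HPI.
  destruct (path_cont_polar rho ltac:(lra) t0 d Hd) as [d' [Hd' Hc]].
  apply NNPP. intros Hno. apply Hn2. exists (Rmin d' PI).
  split; [apply Rmin_pos; auto|]. intros t [Ht0 Ht] E. apply Hno.
  exists (polar rho t). split; [split|exact E].
  - apply Cmod_gt_0, sub_neq0, polar_locally_injective; [lra|]. split; [auto|].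
    eapply Rlt_le_trans; [exact Ht|apply Rmin_r].
  - apply Hc. eapply Rlt_le_trans; [exact Ht|apply Rmin_l].
Qed.

(** Finitely many of the isolating intervals cover [a, b], and in each of them only the centre can
    satisfy P. *)
Lemma isolated_finite (P : R -> Prop) (a b : R) :
  (forall t0, exists d, 0 < d /\ forall t, 0 < Rabs (t - t0) < d -> ~ P t) ->
  exists l : list R, forall t, a <= t <= b -> P t -> List.In t l.
Proof.
  intros H. apply choice in H. destruct H as [dl Hdl].
  (* Compactness is stated for n-tuples; a 1-tuple is a real paired with [tt]. *)
  pose proof (compactness_list 1 (a, tt) (b, tt)
    (fun u => mkposreal (dl (fst u)) (proj1 (Hdl (fst u))))) as Hc.
  apply NNPP in Hc. destruct Hc as [l Hl].
  exists (List.map fst l). intros t Ht HP.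
  destruct (Hl (t, tt)) as [[u []] [Hin [_ Hclose]]]; [simpl; auto|].
  destruct Hclose as [Hclose _]. simpl in Hclose.
  destruct (Req_dec t u) as [->|Hne].
  - apply List.in_map_iff. exists (u, tt). auto.
  - exfalso. apply (proj2 (Hdl u) t); [|exact HP]. split; [|exact Hclose].
    apply Rabs_pos_lt. lra.
Qed.

(** * Null sets and bounded convergence *)

Lemma null_set_mono (N M : R -> Prop) : (forall x, M x -> N x) -> null_set N -> null_set M.
Proof.
  intros H HN e He. destruct (HN e He) as [a [b [H1 [H2 H3]]]]. exists a, b. eauto.
Qed.

Lemma null_set_add (N : R -> Prop) (p : R) : null_set N -> null_set (fun x => x = p \/ N x).
Proof.
  intros HN e He. destruct (HN (e / 2)) as [a [b [H1 [H2 H3]]]]; [lra|].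
  exists (fun n => match n with O => p - e / 4 | S m => a m end),
         (fun n => match n with O => p + e / 4 | S m => b m end).
  split; [|split].
  - intros [|n]; [lra|apply H1].
  - intros x [->|Hx]; [exists O; lra|]. destruct (H2 x Hx) as [n Hn]. exists (S n). exact Hn.
  - intros [|n]; [simpl; lra|]. rewrite decomp_sum by lia. simpl. specialize (H3 n). lra.
Qed.

Lemma null_set_add_list (N : R -> Prop) (l : list R) : null_set N ->
  null_set (fun x => List.In x l \/ N x).
Proof.
  intros HN. induction l as [|p l IH].
  - apply (null_set_mono N); [|exact HN]. intros x [[]|H]; exact H.
  - apply (null_set_mono (fun x => x = p \/ (List.In x l \/ N x))).
    + intros x [[->|H]|H]; auto.
    + apply null_set_add, IH.
Qed.

(** * Riemann integrals and finite interval covers *)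

Definition ind (c d t : R) : R :=
  if Rlt_dec c t then if Rlt_dec t d then 1 else 0 else 0.

Lemma is_RInt_const_open (f : R -> R) (a b v : R) : a <= b ->
  (forall x, a < x < b -> f x = v) -> is_RInt f a b (v * (b - a)).
Proof.
  intros Hab H. apply (is_RInt_ext (fun _ => v)).
  - rewrite Rmin_left, Rmax_right by auto. intros x Hx. symmetry. auto.
  - replace (v * (b - a)) with (scal (b - a) v) by (unfold scal; simpl; unfold mult; simpl; ring).
    apply (is_RInt_const (V := R_NormedModule)).
Qed.

Lemma ind_integral (a b c d : R) : a <= b -> c <= d ->
  exists I, is_RInt (ind c d) a b I /\ I <= d - c.
Proof.
  (* The endpoints clipped to [a, b]; clipping cannot lengthen the interval. *)
  intros Hab Hcd. set (p := Rmax a (Rmin c b)). set (q := Rmax a (Rmin d b)).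
  assert (Hpq : a <= p /\ p <= q /\ q <= b /\ q - p <= d - c).
  { unfold p, q, Rmax, Rmin. repeat destruct Rle_dec; lra. }
  destruct Hpq as [H1 [H2 [H3 H4]]].
  exists (0 * (p - a) + (1 * (q - p) + 0 * (b - q))). split; [|lra].
  apply (is_RInt_Chasles (V := R_NormedModule)) with p; [|apply (is_RInt_Chasles (V := R_NormedModule)) with q];
    apply is_RInt_const_open; auto; intros x Hx; unfold ind;
    revert Hx; unfold p, q, Rmax, Rmin; repeat destruct Rle_dec;
    destruct (Rlt_dec c x), (Rlt_dec x d); lra.
Qed.

Lemma ind_sum_integral (a b : R) (u v : nat -> R) (N : nat) : a <= b ->
  (forall n, u n <= v n) ->
  exists I, is_RInt (fun t => sum_f_R0 (fun k => ind (u k) (v k) t) N) a b I /\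
    I <= sum_f_R0 (fun k => v k - u k) N.
Proof.
  intros Hab Huv. induction N as [|N [I [H1 H2]]]; simpl.
  - apply ind_integral; auto.
  - destruct (ind_integral a b (u (S N)) (v (S N)) Hab (Huv (S N))) as [J [H3 H4]].
    exists (I + J). split; [|lra]. apply (is_RInt_plus (V := R_NormedModule) _ _ a b I J H1 H3).
Qed.

Lemma ind_nonneg (c d t : R) : 0 <= ind c d t.
Proof. unfold ind. destruct Rlt_dec; [destruct Rlt_dec|]; lra. Qed.

Lemma ind_sum_ge (u v : nat -> R) (N k : nat) (t : R) : (k <= N)%nat -> u k < t < v k ->
  1 <= sum_f_R0 (fun k => ind (u k) (v k) t) N.
Proof.
  intros Hk Ht. induction N as [|N IH].
  - assert (k = O) by lia. subst. simpl. unfold ind.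
    destruct Rlt_dec; [destruct Rlt_dec|]; lra.
  - simpl. destruct (Nat.eq_dec k (S N)) as [->|Hne].
    + assert (0 <= sum_f_R0 (fun k => ind (u k) (v k) t) N)
        by (apply cond_pos_sum; intros; apply ind_nonneg).
      unfold ind at 2. destruct Rlt_dec; [destruct Rlt_dec|]; lra.
    + specialize (IH ltac:(lia)). pose proof (ind_nonneg (u (S N)) (v (S N)) t). lra.
Qed.

Lemma ex_RInt_cont_all (f : R -> R) (a b : R) : (forall t, continuous f t) -> ex_RInt f a b.
Proof.
  intros H. apply (ex_RInt_continuous (V := R_CompleteNormedModule)). intros; apply H.
Qed.

(** Pointwise, f is at most eta plus the sum of the indicators of the covering intervals. *)
Lemma RInt_le_cover (f : R -> R) (a b eta : R) (u v : nat -> R) (N : nat) : a <= b ->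
  (forall t, continuous f t) -> (forall t, f t <= 1) -> 0 <= eta ->
  (forall n, u n <= v n) ->
  (forall t, a <= t <= b -> f t <= eta \/ exists k, (k <= N)%nat /\ u k < t < v k) ->
  RInt f a b <= (b - a) * eta + sum_f_R0 (fun k => v k - u k) N.
Proof.
  intros Hab Hc H1 He Huv H. destruct (ind_sum_integral a b u v N Hab Huv) as [I [HI HI2]].
  apply Rle_trans with ((b - a) * eta + I); [|lra].
  pose proof (is_RInt_plus (V := R_NormedModule) _ _ a b _ _
    (is_RInt_const (V := R_NormedModule) a b eta) HI) as HS.
  replace ((b - a) * eta + I) with
    (RInt (fun t => plus eta (sum_f_R0 (fun k => ind (u k) (v k) t) N)) a b)
    by (apply is_RInt_unique, HS).
  apply RInt_le; auto.
  - apply ex_RInt_cont_all, Hc.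
  - eexists. exact HS.
  - intros t Ht. unfold plus; simpl.
    assert (0 <= sum_f_R0 (fun k => ind (u k) (v k) t) N)
      by (apply cond_pos_sum; intros; apply ind_nonneg).
    destruct (H t) as [Hf|[k [Hk Hin]]]; [lra|lra|].
    pose proof (ind_sum_ge u v N k t Hk Hin). specialize (H1 t). lra.
Qed.

Lemma continuous_eps (f : R -> R) (t e : R) : continuous f t -> 0 < e ->
  exists d, 0 < d /\ forall u, Rabs (u - t) < d -> Rabs (f u - f t) < e.
Proof.
  intros H He. destruct (H (ball (f t) (mkposreal e He)) (locally_ball _ _)) as [d Hd].
  exists d. split; [apply cond_pos|]. exact Hd.
Qed.

Lemma continuous_max (f g : R -> R) (t : R) :
  continuous f t -> continuous g t -> continuous (fun x => Rmax (f x) (g x)) t.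
Proof.
  intros Hf Hg. apply eps_continuous. intros e He.
  destruct (continuous_eps f t e Hf He) as [d1 [D1 E1]].
  destruct (continuous_eps g t e Hg He) as [d2 [D2 E2]].
  exists (Rmin d1 d2). split; [apply Rmin_pos; auto|]. intros u Hu.
  specialize (E1 u ltac:(eapply Rlt_le_trans; [exact Hu|apply Rmin_l])).
  specialize (E2 u ltac:(eapply Rlt_le_trans; [exact Hu|apply Rmin_r])).
  apply Rabs_def2 in E1. apply Rabs_def2 in E2. apply Rabs_def1;
  unfold Rmax; repeat destruct Rle_dec; lra.
Qed.

Lemma continuous_min (f g : R -> R) (t : R) :
  continuous f t -> continuous g t -> continuous (fun x => Rmin (f x) (g x)) t.
Proof.
  intros Hf Hg. apply eps_continuous. intros e He.
  destruct (continuous_eps f t e Hf He) as [d1 [D1 E1]].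
  destruct (continuous_eps g t e Hg He) as [d2 [D2 E2]].
  exists (Rmin d1 d2). split; [apply Rmin_pos; auto|]. intros u Hu.
  specialize (E1 u ltac:(eapply Rlt_le_trans; [exact Hu|apply Rmin_l])).
  specialize (E2 u ltac:(eapply Rlt_le_trans; [exact Hu|apply Rmin_r])).
  apply Rabs_def2 in E1. apply Rabs_def2 in E2. apply Rabs_def1;
  unfold Rmin; repeat destruct Rle_dec; lra.
Qed.

Section BoundedConvergence.
Variables (v : nat -> R -> R) (N : R -> Prop) (a b : R).
Hypothesis Hab : a <= b.
Hypothesis Hcont : forall n t, continuous (v n) t.
Hypothesis Hv : forall n t, 0 <= v n t <= 1.
Hypothesis HN : null_set N.
Hypothesis Hlim : forall t, a <= t <= b -> ~ N t ->
  forall e, 0 < e -> exists n0, forall n, (n0 <= n)%nat -> v n t < e.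

(** Finite substitute for the supremum of all [v m] with m >= n, which need not be continuous or
    Riemann integrable. *)
Fixpoint run_max (n k : nat) (t : R) : R :=
  match k with O => v n t | S j => Rmax (run_max n j t) (v (n + S j)%nat t) end.

Lemma run_max_cont n k t : continuous (run_max n k) t.
Proof. induction k; simpl; [apply Hcont|apply continuous_max; auto]. Qed.

Lemma run_max_bounds n k t : 0 <= run_max n k t <= 1.
Proof.
  induction k; simpl; [apply Hv|]. pose proof (Hv (n + S k)%nat t).
  unfold Rmax. destruct Rle_dec; lra.
Qed.

Lemma run_max_ge n k j t : (j <= k)%nat -> v (n + j)%nat t <= run_max n k t.
Proof.
  induction k as [|k IH]; intros Hj; simpl.
  - replace j with O by lia. rewrite Nat.add_0_r. lra.
  - destruct (Nat.eq_dec j (S k)) as [->|Hne]; [apply Rmax_r|].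
    eapply Rle_trans; [apply IH; lia|apply Rmax_l].
Qed.

Lemma run_max_le n k t x : (forall m, (n <= m <= n + k)%nat -> v m t <= x) -> run_max n k t <= x.
Proof.
  induction k as [|k IH]; intros H; simpl; [apply H; lia|].
  apply Rmax_lub; [apply IH; intros; apply H; lia|apply H; lia].
Qed.

Lemma run_max_lt n k t x : (forall m, (n <= m <= n + k)%nat -> v m t < x) -> run_max n k t < x.
Proof.
  induction k as [|k IH]; intros H; simpl; [apply H; lia|].
  apply Rmax_lub_lt; [apply IH; intros; apply H; lia|apply H; lia].
Qed.

(** The integrals are bounded by b - a, so one of them comes within e of their supremum; taking more
    terms then gains at most e. *)
Lemma run_max_near_sup n e : 0 < e -> exists k, forall j,
  RInt (run_max n j) a b <= RInt (run_max n k) a b + e.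
Proof.
  intros He.
  destruct (completeness (fun x => exists k, x = RInt (run_max n k) a b)) as [s [Hs1 Hs2]].
  - exists ((b - a) * 1). intros x [k ->]. eapply Rle_trans; [apply Rle_abs|].
    apply abs_RInt_le_const; [exact Hab|apply ex_RInt_cont_all, run_max_cont|].
    intros t _. pose proof (run_max_bounds n k t). apply Rabs_le. lra.
  - eexists. exists O. reflexivity.
  - assert (Hk : exists k, s - e < RInt (run_max n k) a b).
    { apply NNPP. intros Hn. assert (s <= s - e); [|lra]. apply Hs2.
      intros x [k ->]. apply Rnot_lt_le. intros Hlt. apply Hn. exists k. lra. }
    destruct Hk as [k Hk]. exists k. intros j.
    assert (RInt (run_max n j) a b <= s) by (apply Hs1; eauto). lra.
Qed.

(* Lewin's argument: if every [v n] had integral at least [delta], the minima of suitable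
   running maxima would decrease to 0 off [N] while keeping integral at least [delta / 2];
   Dini's theorem off a cover of [N] contradicts this. *)
Lemma bounded_convergence delta : 0 < delta -> exists n, RInt (v n) a b < delta.
Proof.
  intros Hd. apply NNPP. intros Hno.
  assert (Hlow : forall n, delta <= RInt (v n) a b).
  { intros n. apply Rnot_lt_le. intros H. apply Hno. eauto. }
  (* The losses sum to at most delta / 2, leaving the other half of delta. *)
  set (dn := fun n => delta / 4 * (1 / 2) ^ n).
  assert (Hdn : forall n, 0 < dn n).
  { intros n. apply Rmult_lt_0_compat; [lra|apply pow_lt; lra]. }
  destruct (choice (fun n k => forall j, RInt (run_max n j) a b <= RInt (run_max n k) a b + dn n))
    as [K HK]. { intros n. apply run_max_near_sup, Hdn. }
  set (U := fun n => run_max n (K n)).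
  assert (HUc : forall n t, continuous (U n) t) by (intros; apply run_max_cont).
  set (w := fix w n := match n with O => U O | S m => fun t => Rmin (w m t) (U (S m) t) end).
  assert (Hwc : forall n t, continuous (w n) t).
  { intros n t. induction n; simpl; [apply HUc|apply continuous_min; auto]. }
  assert (HwU : forall n t, w n t <= U n t).
  { intros [|n] t; simpl; [lra|apply Rmin_r]. }
  assert (Hw1 : forall n t, w n t <= 1).
  { intros n t. eapply Rle_trans; [apply HwU|]. apply run_max_bounds. }
  assert (Hwdec : forall n k t, w (n + k)%nat t <= w n t).
  { intros n k t. induction k as [|k IH]; [rewrite Nat.add_0_r; lra|].
    rewrite Nat.add_succ_r. simpl. eapply Rle_trans; [apply Rmin_l|exact IH]. }
  assert (Hex : forall f, (forall t, continuous f t) -> ex_RInt f a b)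
    by (intros; apply ex_RInt_cont_all; auto).
  (* The quantity delta / 2 - 2 [dn n] is the accumulated loss, the sum of [dn k] over k < n. *)
  assert (Hwint : forall n,
    RInt (U n) a b - (delta / 2 - 2 * dn n) <= RInt (w n) a b).
  { induction n as [|n IH].
    - simpl. unfold dn; simpl. lra.
    - assert (E : RInt (w (S n)) a b =
        RInt (w n) a b + RInt (U (S n)) a b - RInt (fun t => Rmax (w n t) (U (S n) t)) a b).
      { transitivity (RInt (fun t => minus (plus (w n t) (U (S n) t)) (Rmax (w n t) (U (S n) t))) a b).
        - apply RInt_ext. intros t _. unfold minus, plus, opp; simpl. unfold Rmin, Rmax.
          destruct Rle_dec; ring.
        - rewrite (RInt_minus (V := R_CompleteNormedModule)).
          + rewrite (RInt_plus (V := R_CompleteNormedModule)) by (apply Hex; auto). reflexivity.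
          + apply (ex_RInt_plus (V := R_NormedModule)); apply Hex; auto.
          + apply Hex. intros; apply continuous_max; auto. }
      assert (L : RInt (fun t => Rmax (w n t) (U (S n) t)) a b <= RInt (U n) a b + dn n).
      (* This length covers both the indices of [U n] and those of [U (S n)], which start at n +
         1. *)
      { eapply Rle_trans; [|apply (HK n (K n + K (S n) + 1)%nat)].
        apply RInt_le; auto.
        - apply Hex. intros; apply continuous_max; auto.
        - apply Hex, run_max_cont.
        - intros t _. apply Rmax_lub.
          + eapply Rle_trans; [apply HwU|]. apply run_max_le. intros m Hm.
            replace m with (n + (m - n))%nat by lia. apply run_max_ge. lia.
          + apply run_max_le. intros m Hm.
            replace m with (n + (m - n))%nat by lia. apply run_max_ge. lia. }
      assert (dn (S n) = dn n / 2) by (unfold dn; simpl; field).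
      lra. }
  assert (Hwlow : forall n, delta / 2 <= RInt (w n) a b).
  { intros n. specialize (Hwint n). specialize (Hdn n).
    assert (RInt (v n) a b <= RInt (U n) a b).
    { apply RInt_le; auto. intros t _. rewrite <- (Nat.add_0_r n) at 1.
      apply run_max_ge. lia. }
    specialize (Hlow n). lra. }
  destruct (HN (delta / 8)) as [u [u' [H1 [H2 H3]]]]; [lra|].
  (* Level and cover contribute at most delta / 8 each, less than delta / 2 in total. *)
  set (eta := delta / (8 * (b - a + 1))).
  assert (Heta : 0 < eta) by (apply Rdiv_lt_0_compat; lra).
  assert (Hpt : forall t, exists dm : R * nat, 0 < fst dm /\ (a <= t <= b -> forall x, Rabs (x - t) < fst dm ->
    w (snd dm) x <= eta \/ exists k, (k <= snd dm)%nat /\ u k < x < u' k)).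
  { intros t. destruct (classic (a <= t <= b)) as [Ht|Ht].
    2:{ exists (1, O). split; [simpl; lra|]. intros; easy. }
    destruct (classic (N t)) as [HNt|HNt].
    - destruct (H2 t HNt) as [k Hk]. exists (Rmin (t - u k) (u' k - t), k). simpl.
      split; [apply Rmin_pos; lra|]. intros _ x Hx. right. exists k. split; [lia|].
      assert (Rabs (x - t) < t - u k) as A by (eapply Rlt_le_trans; [exact Hx|apply Rmin_l]).
      assert (Rabs (x - t) < u' k - t) as B by (eapply Rlt_le_trans; [exact Hx|apply Rmin_r]).
      apply Rabs_def2 in A. apply Rabs_def2 in B. lra.
    - destruct (Hlim t Ht HNt eta Heta) as [n Hn].
      assert (Hwt : w n t < eta).
      { eapply Rle_lt_trans; [apply HwU|]. apply run_max_lt. intros m Hm. apply Hn. lia. }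
      destruct (continuous_eps (w n) t (eta - w n t) (Hwc n t)) as [d [Hdp Hdd]]; [lra|].
      exists (d, n). simpl. split; [auto|]. intros _ x Hx. left.
      specialize (Hdd x Hx). apply Rabs_def2 in Hdd. lra. }
  apply choice in Hpt. destruct Hpt as [dm Hdm].
  (* Compactness returns only a positive lower bound for the gauge. Building 1 / (index + 1) into
     the gauge turns it into an upper bound for the indices. *)
  assert (Hpos : forall t, 0 < Rmin (fst (dm t)) (/ (INR (snd (dm t)) + 1))).
  { intros t. apply Rmin_pos; [apply Hdm|]. apply Rinv_0_lt_compat.
    pose proof (pos_INR (snd (dm t))). lra. }
  destruct (compactness_value_1d a b (fun t => mkposreal _ (Hpos t))) as [d Hcomp].
  assert (Hdpos := cond_pos d).
  destruct (INR_unbounded (/ d)) as [M HM].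
  assert (Hcov : forall x, a <= x <= b -> w M x <= eta \/ exists k, (k <= M)%nat /\ u k < x < u' k).
  { intros x Hx. specialize (Hcomp x Hx). apply NNPP in Hcomp.
    destruct Hcomp as [t [Ht [Hx1 Hx2]]]. simpl in Hx1, Hx2.
    assert (Hle : (snd (dm t) <= M)%nat).
    { apply INR_le. assert (d <= / (INR (snd (dm t)) + 1)) as A
        by (eapply Rle_trans; [exact Hx2|apply Rmin_r]).
      pose proof (pos_INR (snd (dm t))).
      apply Rinv_le_contravar in A; [|auto]. rewrite Rinv_inv in A. lra. }
    destruct (proj2 (Hdm t) Ht x) as [A|[k [Hk Hin]]].
    - eapply Rlt_le_trans; [exact Hx1|apply Rmin_l].
    - left. eapply Rle_trans; [|exact A].
      replace M with (snd (dm t) + (M - snd (dm t)))%nat by lia. apply Hwdec.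
    - right. exists k. split; [lia|auto]. }
  pose proof (RInt_le_cover (w M) a b eta u u' M Hab (Hwc M) (Hw1 M) ltac:(lra) H1 Hcov) as HF.
  specialize (H3 M). specialize (Hwlow M).
  assert ((b - a) * eta <= delta / 8).
  { unfold eta. apply Rmult_le_reg_r with (8 * (b - a + 1)); [lra|].
    replace ((b - a) * (delta / (8 * (b - a + 1))) * (8 * (b - a + 1))) with ((b - a) * delta)
      by (field; lra). nra. }
  lra.
Qed.

End BoundedConvergence.

(** * Uniqueness for radial limits in the Hardy space *)

(** The right-hand side is the Poisson kernel. *)
Lemma Re_cayley (u : C) : u <> 1 ->
  Re ((1 + u) / (1 - u))%C = (1 - Cmod u ^ 2) / Cmod (1 - u) ^ 2.
Proof.
  intros Hu. assert (Hn : (1 - u)%C <> 0) by (apply sub_neq0; auto).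
  assert (Hm : 0 < Cmod (1 - u) ^ 2) by (apply pow_lt, Cmod_gt_0, Hn).
  rewrite !Cmod2_alt in *. destruct u as [x y].
  unfold Re, Im, Cdiv, Cinv, Cmult, Cminus, Cplus, Copp, RtoC in *; cbn [fst snd] in *.
  field. nra.
Qed.

Lemma Re_cayley_nonneg (u : C) : Cmod u < 1 -> 0 <= Re ((1 + u) / (1 - u))%C.
Proof.
  intros Hu. pose proof (Cmod_ge_0 u).
  assert (Hu1 : u <> 1) by (apply neq_of_Cmod; rewrite Cmod_1; lra).
  rewrite Re_cayley by auto. apply Rmult_le_pos; [nra|].
  left. apply Rinv_0_lt_compat, pow_lt, Cmod_gt_0, sub_neq0. auto.
Qed.

(** Here |1 - u|^2 = l^2 + 4 (1 - l) sin^2(tau / 2) <= 2 l^2, while 1 - |u|^2 = l (2 - l) >= l. *)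
Lemma Re_cayley_near (l tau : R) : 0 < l < 1 -> Rabs tau <= l ->
  1 / (2 * l) <= Re ((1 + polar (1 - l) tau) / (1 - polar (1 - l) tau))%C.
Proof.
  intros Hl Ht. set (u := polar (1 - l) tau).
  assert (Hu : Cmod u = 1 - l) by (apply Cmod_polar; lra).
  assert (Hu1 : u <> 1) by (apply neq_of_Cmod; rewrite Cmod_1; lra).
  rewrite Re_cayley by auto.
  assert (Hm : 0 < Cmod (1 - u) ^ 2).
  { apply pow_lt, Cmod_gt_0, sub_neq0. auto. }
  assert (Hb : Cmod (1 - u) ^ 2 <= 2 * l ^ 2).
  { rewrite Cmod2_alt. unfold u, polar, Re, Im, Cminus, Cplus, Copp, RtoC; cbn [fst snd].
    pose proof (sin2_cos2 tau) as E. unfold Rsqr in E.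
    pose proof (cos_2a_sin (tau / 2)) as E2. replace (2 * (tau / 2)) with tau in E2 by field.
    pose proof (sin_lipschitz 0 (tau / 2)) as S. rewrite sin_0, !Rminus_0_r in S.
    assert (Rabs (tau / 2) <= l / 2).
    { unfold Rdiv. rewrite Rabs_mult, (Rabs_right (/ 2)) by lra. lra. }
    assert (S2 : sin (tau / 2) ^ 2 <= (l / 2) ^ 2).
    { rewrite <- pow2_abs. apply pow_incr. split; [apply Rabs_pos|lra]. }
    nra. }
  rewrite Hu. set (q := Cmod (1 - u) ^ 2) in *. clearbody q.
  apply Rmult_le_reg_r with (2 * l * q); [nra|].
  replace ((1 - (1 - l) ^ 2) / q * (2 * l * q)) with ((1 - (1 - l) ^ 2) * (2 * l))
    by (field; lra).
  replace (1 / (2 * l) * (2 * l * q)) with q by (field; lra).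
  nra.
Qed.

Lemma Re_plus (z w : C) : Re (z + w)%C = Re z + Re w.
Proof. reflexivity. Qed.

Lemma Re_scal (x : R) (z : C) : Re (RtoC x * z)%C = x * Re z.
Proof. unfold Re, RtoC, Cmult; simpl. ring. Qed.

Lemma grid_point (l t : R) (n : nat) : 0 <= t -> t <= INR n * l -> (1 <= n)%nat ->
  exists j, (j < n)%nat /\ INR j * l <= t <= INR j * l + l.
Proof.
  intros Ht Hn H1. induction n as [|n IH]; [lia|].
  destruct (Rle_dec (INR n * l) t) as [H|H].
  - exists n. rewrite S_INR in Hn. split; [lia|lra].
  - destruct n as [|n]; [simpl in H; lra|].
    destruct IH as [j [Hj Hj2]]; [lra|lia|]. exists j. split; [lia|auto].
Qed.

(* A discretised Herglotz integral of [v / eps]. The poles sit at radius [rho / (1 - l)], just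
   outside the circle, where [l] is the mesh, so that each kernel has real part at least
   [1 / (2 l)] on the arc of half-width [l] around its grid point. *)
Lemma herglotz_sum (v : R -> R) (rho eps eta : R) : 0 < rho -> 0 < eps -> 0 < eta ->
  (forall t, continuous v t) -> (forall t, 0 <= v t) ->
  exists (H : C -> C) (Rad h : R), rho < Rad /\ (forall z, Cmod z < Rad -> cdiff H z) /\
    (forall z, Cmod z < Rad -> 0 <= Re (H z)) /\
    H 0 = RtoC h /\ 0 <= h /\ h * eps <= RInt v 0 (2 * PI) + eta /\
    (forall t, 0 <= t <= 2 * PI -> eps <= v t -> 1 / 4 <= Re (H (polar rho t))).
Proof.
  intros Hrho Heps Heta Hvc Hv. pose proof PI_RGT_0 as HPI.
  (* Two tolerances for the oscillation of v over one mesh: eps / 2 keeps v at least eps / 2 at a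
     neighbouring grid point, and eta / (2 PI) bounds the Riemann sum error by eta. *)
  assert (Hq : 0 < Rmin (eps / 2) (eta / (2 * PI))).
  { apply Rmin_pos; [lra|]. apply Rdiv_lt_0_compat; lra. }
  destruct (unifcont_normed_1d (K := R_AbsRing) (V := R_NormedModule) v 0 (2 * PI)
    ltac:(intros; apply Hvc) (mkposreal _ Hq)) as [d Hunif].
  assert (Hd := cond_pos d).
  destruct (INR_unbounded (2 * PI / Rmin (d / 2) (1 / 2))) as [N HN].
  assert (Hmin : 0 < Rmin (d / 2) (1 / 2)) by (apply Rmin_pos; lra).
  assert (HN0 : 0 < INR N).
  { eapply Rlt_trans; [|exact HN]. apply Rdiv_lt_0_compat; lra. }
  set (l := 2 * PI / INR N).
  assert (HlN : INR N * l = 2 * PI) by (unfold l; field; lra).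
  assert (Hl0 : 0 < l) by (apply Rdiv_lt_0_compat; lra).
  assert (Hlm : l < Rmin (d / 2) (1 / 2)).
  { apply Rmult_lt_reg_l with (INR N); [auto|]. rewrite HlN.
    apply Rmult_lt_compat_r with (r := Rmin (d / 2) (1 / 2)) in HN; [|exact Hmin].
    set (q := Rmin (d / 2) (1 / 2)) in *. replace (2 * PI / q * q) with (2 * PI) in HN
      by (field; lra). exact HN. }
  assert (Hl1 : l < d) by (pose proof (Rmin_l (d / 2) (1 / 2)); lra).
  assert (Hl2 : l < 1) by (pose proof (Rmin_r (d / 2) (1 / 2)); lra).
  assert (Hosc : forall x y, 0 <= x <= 2 * PI -> 0 <= y <= 2 * PI -> Rabs (y - x) <= l ->
    Rabs (v y - v x) < eps / 2 /\ Rabs (v y - v x) < eta / (2 * PI)).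
  { intros x y Hx Hy Hxy.
    assert (A : Rabs (v y - v x) < Rmin (eps / 2) (eta / (2 * PI))).
    { apply (Hunif x y Hx Hy). change (Rabs (y - x) < d). lra. }
    split; eapply Rlt_le_trans; [exact A|apply Rmin_l|exact A|apply Rmin_r]. }
  set (cj := fun j : nat => INR j * l).
  assert (Hcj : forall j, (j < N)%nat -> 0 <= cj j /\ cj j + l <= 2 * PI).
  { intros j Hj. unfold cj. pose proof (pos_INR j). split; [nra|].
    assert (INR j + 1 <= INR N) by (rewrite <- S_INR; apply le_INR; lia). nra. }
  (* The reciprocal of the j-th pole: on the circle of radius rho, [aj j * z] has modulus 1 - l and
     angle t - [cj j]. *)
  set (aj := fun j => polar ((1 - l) / rho) (- cj j)).
  set (Pj := fun j z => ((1 + aj j * z) / (1 - aj j * z))%C).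
  (* Riemann sum weights of v / eps; their sum is the value at 0, because every kernel equals 1
     there. *)
  set (wj := fun j => l * v (cj j) / eps).
  assert (Hwj : forall j, 0 <= wj j).
  { intros j. unfold wj. apply Rmult_le_pos; [|left; apply Rinv_0_lt_compat; auto].
    apply Rmult_le_pos; [lra|apply Hv]. }
  set (Hs := fix Hs n z := match n with O => RtoC 0
     | S m => (Hs m z + RtoC (wj m) * Pj m z)%C end).
  set (hs := fix hs n := match n with O => 0 | S m => hs m + wj m end).
  set (Rad := rho / (1 - l)).
  assert (HRad : rho < Rad).
  { unfold Rad. apply Rmult_lt_reg_r with (1 - l); [lra|].
    unfold Rdiv. rewrite Rmult_assoc, Rinv_l by lra. nra. }
  assert (Haz : forall j z, Cmod z < Rad -> Cmod (aj j * z) < 1).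
  { intros j z Hz. unfold aj. rewrite Cmod_mult.
    assert (0 < (1 - l) / rho) by (apply Rdiv_lt_0_compat; lra).
    rewrite Cmod_polar by lra.
    assert (E : (1 - l) / rho * Rad = 1) by (unfold Rad; field; lra).
    apply Rlt_le_trans with ((1 - l) / rho * Rad); [apply Rmult_lt_compat_l; auto|lra]. }
  assert (Hdiff : forall n z, Cmod z < Rad -> cdiff (Hs n) z).
  { intros n z Hz. induction n as [|n IH]; [apply cdiff_const|]. apply cdiff_plus; [exact IH|].
    apply cdiff_mult; [apply cdiff_const|].
    assert (Hlin : cdiff (fun z => aj n * z)%C z)
      by (apply cdiff_mult; [apply cdiff_const|apply cdiff_id]).
    apply cdiff_div; [apply cdiff_plus|apply cdiff_minus|]; auto using cdiff_const.
    apply sub_neq0. intros E. specialize (Haz n z Hz). rewrite <- E, Cmod_1 in Haz. lra. }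
  assert (HPnn : forall j z, Cmod z < Rad -> 0 <= wj j * Re (Pj j z)).
  { intros j z Hz. apply Rmult_le_pos; [apply Hwj|]. apply Re_cayley_nonneg, Haz, Hz. }
  assert (Hpos : forall n z, Cmod z < Rad -> 0 <= Re (Hs n z)).
  { intros n z Hz. induction n as [|n IH]; simpl Hs; [cbn; lra|].
    rewrite Re_plus, Re_scal. specialize (HPnn n z Hz). lra. }
  assert (Hge : forall n j z, Cmod z < Rad -> (j < n)%nat -> wj j * Re (Pj j z) <= Re (Hs n z)).
  { intros n j z Hz Hj. induction n as [|n IH]; [lia|]. simpl Hs. rewrite Re_plus, Re_scal.
    destruct (Nat.eq_dec j n) as [->|Hne].
    - pose proof (Hpos n z Hz). lra.
    - specialize (IH ltac:(lia)). specialize (HPnn n z Hz). lra. }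
  assert (Hzero : forall n, Hs n 0 = RtoC (hs n)).
  { induction n as [|n IH]; [reflexivity|]. simpl. rewrite IH, RtoC_plus. unfold Pj.
    rewrite Cmult_0_r. f_equal. field. }
  assert (Hhs0 : forall n, 0 <= hs n).
  { induction n as [|n IH]; simpl; [lra|]. specialize (Hwj n). lra. }
  assert (Hsum : forall n, (n <= N)%nat ->
    hs n * eps <= RInt v 0 (cj n) + cj n * (eta / (2 * PI))).
  { induction n as [|n IH]; intros Hn.
    - unfold cj; simpl. rewrite !Rmult_0_l, RInt_point. unfold zero; simpl. lra.
    - specialize (IH ltac:(lia)). destruct (Hcj n ltac:(lia)) as [Hc1 Hc2].
      assert (Ec : cj (S n) = cj n + l) by (unfold cj; rewrite S_INR; ring).
      rewrite Ec.
      rewrite <- (RInt_Chasles v 0 (cj n) (cj n + l)) by (apply ex_RInt_cont_all; auto).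
      unfold plus; simpl.
      assert (L : l * (v (cj n) - eta / (2 * PI)) <= RInt v (cj n) (cj n + l)).
      { replace (l * (v (cj n) - eta / (2 * PI))) with
          (RInt (fun _ => v (cj n) - eta / (2 * PI)) (cj n) (cj n + l)).
        - apply RInt_le; [lra|apply ex_RInt_const|apply ex_RInt_cont_all; auto|].
          intros x Hx. destruct (Hosc (cj n) x) as [_ A]; [lra|lra|apply Rabs_le; lra|].
          apply Rabs_def2 in A. lra.
        - rewrite RInt_const. unfold scal; simpl; unfold mult; simpl. ring. }
      assert (wj n * eps = l * v (cj n)) by (unfold wj; field; lra). nra. }
  exists (Hs N), Rad, (hs N). repeat split; auto.
  - specialize (Hsum N (Nat.le_refl N)). unfold cj in Hsum. rewrite HlN in Hsum.
    replace (2 * PI * (eta / (2 * PI))) with eta in Hsum by (field; lra). exact Hsum.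
  - intros t Ht Hvt.
    assert (HN1 : (1 <= N)%nat). { destruct N; [simpl in HN0; lra|lia]. }
    destruct (grid_point l t N) as [j [Hj Hjt]]; [lra|lra|auto|].
    eapply Rle_trans; [|apply (Hge N j)]; [|rewrite Cmod_polar; lra|exact Hj].
    destruct (Hcj j Hj) as [Hc1 Hc2].
    destruct (Hosc t (cj j)) as [A _]; [lra|lra|apply Rabs_le; unfold cj in *; lra|].
    apply Rabs_def2 in A.
    (* The weight l / 2 times the kernel bound 1 / (2 l) gives the constant 1 / 4. *)
    assert (Hw : l / 2 <= wj j).
    { unfold wj. apply Rmult_le_reg_r with eps; [auto|]. unfold Rdiv at 2.
      rewrite Rmult_assoc, Rinv_l by lra. nra. }
    assert (HP : 1 / (2 * l) <= Re (Pj j (polar rho t))).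
    { unfold Pj. replace (aj j * polar rho t)%C with (polar (1 - l) (t - cj j)).
      - apply Re_cayley_near; [lra|]. apply Rabs_le. unfold cj in *; lra.
      - unfold aj. rewrite polar_mult. f_equal; [field; lra|ring]. }
    replace (1 / 4) with (l / 2 * (1 / (2 * l))) by (field; lra).
    apply Rmult_le_compat; [lra| |auto|auto].
    apply Rmult_le_pos; [lra|]. left. apply Rinv_0_lt_compat. lra.
Qed.

(** * The identity theorem on the disc and vanishing radial limits *)

Lemma identity_disc (g : C -> C) (z0 : C) : (forall z, Cmod z < 1 -> cdiff g z) ->
  0 < Cmod z0 < 1 -> (forall d, 0 < d -> exists z, 0 < Cmod (z - z0) < d /\ g z = 0) ->
  forall z, Cmod z < 1 -> g z = 0.
Proof.
  intros Hg Hz0 Hacc.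
  (* The punctured disc is the annulus with inner radius 0; the centre follows by continuity. *)
  assert (H : forall z, 0 < Cmod z < 1 -> g z = 0).
  { apply (identity_annulus g 0 1 z0); auto; [lra|]. intros z Hz. apply Hg. lra. }
  intros z Hz. destruct (Req_dec (Cmod z) 0) as [E|E].
  2:{ apply H. pose proof (Cmod_ge_0 z). lra. }
  apply eq_of_Cmod_le. intros e He.
  destruct (cdiff_ccont g z (Hg z Hz) e He) as [d [Hd Hc]].
  set (x := Rmin d 1 / 2).
  assert (Hx : 0 < Rmin d 1) by (apply Rmin_pos; lra).
  pose proof (Rmin_l d 1). pose proof (Rmin_r d 1).
  assert (Hxm : Cmod (RtoC x) = x) by (rewrite Cmod_R; apply Rabs_right; unfold x; lra).
  apply Cmod_eq_0 in E. subst z.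
  assert (Hs : Cmod (RtoC x - 0) < d).
  { replace (RtoC x - 0)%C with (RtoC x) by ring. rewrite Hxm. unfold x; lra. }
  specialize (Hc (RtoC x) Hs). rewrite (H (RtoC x)) in Hc by (rewrite Hxm; unfold x; lra).
  rewrite Cmod_sub_sym. left. exact Hc.
Qed.

Lemma identity_disc_0 (g : C -> C) (d : R) : (forall z, Cmod z < 1 -> cdiff g z) ->
  0 < d -> (forall z, Cmod z < d -> g z = 0) -> forall z, Cmod z < 1 -> g z = 0.
Proof.
  intros Hg Hd H.
  (* An accumulation point off the origin, as [identity_disc] requires. *)
  set (x := Rmin d 1 / 2).
  assert (Hx : 0 < Rmin d 1) by (apply Rmin_pos; lra).
  pose proof (Rmin_l d 1). pose proof (Rmin_r d 1).
  assert (Hxm : Cmod (RtoC x) = x) by (rewrite Cmod_R; apply Rabs_right; unfold x; lra).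
  apply (identity_disc g (RtoC x) Hg); [rewrite Hxm; unfold x; lra|].
  intros e He. set (y := Rmin e x / 2).
  assert (Hy : 0 < Rmin e x) by (apply Rmin_pos; unfold x; lra).
  pose proof (Rmin_l e x). pose proof (Rmin_r e x).
  exists (RtoC (x + y)). rewrite <- RtoC_minus, Cmod_R, Rabs_right by (unfold y; lra).
  split; [unfold y; lra|]. apply H. rewrite Cmod_R, Rabs_right by (unfold y, x in *; lra).
  unfold y, x in *; lra.
Qed.

(** The shift by 2 keeps all radii at least 1 / 2, so dividing by z^m on these circles costs at most
    2^m. *)
Definition radius (n : nat) : R := 1 - / (INR n + 2).

Lemma radius_bounds (n : nat) : 1 / 2 <= radius n < 1.
Proof.
  unfold radius. pose proof (pos_INR n).
  assert (0 < / (INR n + 2)) by (apply Rinv_0_lt_compat; lra).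
  assert (/ (INR n + 2) <= / 2) by (apply Rinv_le_contravar; lra). lra.
Qed.

Lemma radius_lim (d : R) : 0 < d -> exists n0, forall n, (n0 <= n)%nat -> 1 - d < radius n.
Proof.
  intros Hd. destruct (INR_unbounded (/ d)) as [n0 H0]. exists n0. intros n Hn.
  apply le_INR in Hn. unfold radius.
  assert (/ (INR n + 2) < d); [|lra].
  rewrite <- (Rinv_inv d). assert (0 < / d) by (apply Rinv_0_lt_compat, Hd).
  apply Rinv_lt_contravar; [apply Rmult_lt_0_compat|]; lra.
Qed.

(* Near the circle [g] is small except on a set of small measure, on which the bounded factor
   [phi = 1 / (1 + kappa H)] is small while [phi 0] stays bounded below; the mean value
   property of [phi g / z^m] then forces the leading coefficient of [g] to vanish. *)
Lemma hardy_uniqueness (g : C -> C) (M : R) (N : R -> Prop) :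
  (forall z, Cmod z < 1 -> cdiff g z) ->
  (forall rho, 0 < rho < 1 -> RInt (fun t => Cmod (g (polar rho t))) 0 (2 * PI) <= M) ->
  null_set N ->
  (forall t, 0 <= t <= 2 * PI -> ~ N t -> forall e, 0 < e ->
     exists n0, forall n, (n0 <= n)%nat -> Cmod (g (polar (radius n) t)) < e) ->
  forall z, Cmod z < 1 -> g z = 0.
Proof.
  intros Hg HM HN Hlim. pose proof PI_RGT_0 as HPI.
  destruct (zero_order g 1 Rlt_0_1 Hg) as [[d [Hd H]]|[m [c [Hc Hord]]]].
  { apply (identity_disc_0 g d); auto. }
  exfalso.
  assert (Hpc : forall rho, 0 <= rho < 1 -> path_cont (fun t => g (polar rho t))).
  { intros rho Hr. apply path_cont_circle; [lra|]. intros z Hz. apply cdiff_ccont, Hg. lra. }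
  assert (HM0 : 0 <= M).
  { eapply Rle_trans; [|apply (HM (1 / 2)); lra]. apply RInt_ge_0; [lra| |].
    - apply path_cont_ex_Cmod, Hpc. lra.
    - intros. apply Cmod_ge_0. }
  set (c0 := Cmod c). assert (Hc0 : 0 < c0) by (apply Cmod_gt_0, Hc).
  set (B := 2 ^ m). assert (HB : 1 <= B) by (apply pow_R1_Rle; lra).
  (* The part where |g| < eps contributes at most 2 PI B eps <= PI c0 / 4. Since eps < 1, the
     truncation at 1 in [v] below does not affect the comparison with eps. *)
  set (eps := Rmin (1 / 2) (c0 / (8 * B))).
  assert (Heps : 0 < eps) by (apply Rmin_pos; [lra|apply Rdiv_lt_0_compat; lra]).
  assert (Heps1 : eps <= 1 / 2) by apply Rmin_l.
  assert (Heps2 : B * eps <= c0 / 8).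
  { replace (c0 / 8) with (B * (c0 / (8 * B))) by (field; lra).
    apply Rmult_le_compat_l; [lra|apply Rmin_r]. }
  (* Chosen so that B M / (1 + kappa / 4) <= PI c0 / 4, which controls the part where |g| >= eps. *)
  set (kappa := 16 * B * M / (PI * c0) + 1).
  assert (Hkap : 1 <= kappa).
  { unfold kappa. assert (0 <= 16 * B * M / (PI * c0)); [|lra].
    apply Rmult_le_pos; [nra|]. left. apply Rinv_0_lt_compat. nra. }
  (* Then h eps <= 2 delta = eps / kappa, whence kappa h <= 1 and the damping factor is at least 1 /
     2 at 0. *)
  set (delta := eps / (2 * kappa)).
  assert (Hdelta : 0 < delta) by (apply Rdiv_lt_0_compat; lra).
  set (v := fun n t => Rmin 1 (Cmod (g (polar (radius n) t)))).
  assert (Hvc : forall n t, continuous (v n) t).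
  { intros n t. apply continuous_min; [apply continuous_const|].
    apply (path_cont_Cmod (fun t => g (polar (radius n) t))), Hpc.
    pose proof (radius_bounds n). lra. }
  assert (Hv : forall n t, 0 <= v n t <= 1).
  { intros n t. split; [apply Rmin_glb; [lra|apply Cmod_ge_0]|apply Rmin_l]. }
  destruct (bounded_convergence v N 0 (2 * PI) ltac:(lra) Hvc Hv HN) with (delta := delta)
    as [n Hn]; auto.
  { intros t Ht HNt e He. destruct (Hlim t Ht HNt e He) as [n0 Hn0]. exists n0.
    intros n Hn. eapply Rle_lt_trans; [apply Rmin_r|]. auto. }
  pose proof (radius_bounds n) as Hrho. set (rho := radius n) in *.
  destruct (herglotz_sum (v n) rho eps delta ltac:(lra) Heps Hdelta (Hvc n)
    (fun t => proj1 (Hv n t))) as [H [Rad [h [H1 [H2 [H3 [H4 [H5 [H6 H7]]]]]]]]].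
  assert (Hkh : kappa * h <= 1).
  { apply Rmult_le_reg_r with (eps / kappa); [apply Rdiv_lt_0_compat; lra|].
    replace (kappa * h * (eps / kappa)) with (h * eps) by (field; lra).
    replace (1 * (eps / kappa)) with (delta + delta) by (unfold delta; field; lra). lra. }
  set (D := fun z => (1 + RtoC kappa * H z)%C).
  assert (HDre : forall z, Re (D z) = 1 + kappa * Re (H z)).
  { intros z. unfold D. rewrite Re_plus, Re_scal. reflexivity. }
  assert (HDge : forall z, 1 + kappa * Re (H z) <= Cmod (D z)).
  { intros z. rewrite <- HDre. eapply Rle_trans; [apply Rle_abs|apply re_le_Cmod]. }
  assert (HD1 : forall z, Cmod z < Rad -> 1 <= Cmod (D z)).
  { intros z Hz. specialize (H3 z Hz). specialize (HDge z). nra. }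
  set (R1 := Rmin Rad 1).
  assert (HR1 : rho < R1) by (apply Rmin_glb_lt; lra).
  assert (HR1a : R1 <= Rad) by apply Rmin_l. assert (HR1b : R1 <= 1) by apply Rmin_r.
  assert (Hphi : forall z, Cmod z < R1 -> cdiff (fun z => / D z)%C z).
  { intros z Hz. apply (cdiff_inv D).
    - apply cdiff_plus; [apply cdiff_const|]. apply cdiff_mult; [apply cdiff_const|].
      apply H2. lra.
    - apply Cmod_pos_neq0. specialize (HD1 z ltac:(lra)). lra. }
  (* Dividing out the zero makes the value at the centre the leading coefficient; the expansion of g
     gives continuity there. *)
  set (K := fun z => if excluded_middle_informative (z = RtoC 0) then c else (g z / z ^ m)%C).
  assert (HK : forall z : C, z <> RtoC 0 -> K z = (g z / z ^ m)%C).
  { intros z Hz. unfold K. destruct (excluded_middle_informative (z = RtoC 0)); easy. }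
  assert (HK0 : K 0 = c).
  { unfold K. destruct (excluded_middle_informative (RtoC 0 = RtoC 0)); easy. }
  assert (HKd : forall z, 0 < Cmod z < 1 -> cdiff K z).
  { intros z [Hz0 Hz]. apply (cdiff_ext_loc (fun z => g z / z ^ m)%C K z (Cmod z)); [auto| |].
    - intros w Hw. symmetry. apply HK. intros ->. rewrite Cmod_sub_sym in Hw.
      replace (z - 0)%C with z in Hw by ring. lra.
    - apply cdiff_div; [auto|apply (cdiff_pow (fun z => z)), cdiff_id|].
      apply Cpow_nz, Cmod_pos_neq0, Hz0. }
  assert (HKc : ccont K 0).
  { intros e He. destruct (Hord (e / 2) ltac:(lra)) as [d [Hd Hb]].
    exists d. split; [auto|]. intros w Hw. rewrite HK0.
    destruct (classic (w = RtoC 0)) as [->|Hne].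
    - rewrite HK0, Cmod_sub_self. exact He.
    - rewrite HK by auto. replace (w - 0)%C with w in Hw by ring. specialize (Hb w Hw).
      assert (Hwm : (w ^ m)%C <> 0) by (apply Cpow_nz, Hne).
      replace (g w / w ^ m - c)%C with ((g w - c * w ^ m) / w ^ m)%C by (field; auto).
      rewrite Cmod_div, Cmod_pow by auto.
      pose proof (pow_lt (Cmod w) m (proj1 (Cmod_gt_0 _) Hne)) as Hp.
      apply Rle_lt_trans with (e / 2); [|lra].
      apply Rmult_le_reg_r with (Cmod w ^ m); [auto|]. unfold Rdiv at 1.
      rewrite Rmult_assoc, Rinv_l, Rmult_1_r by lra. exact Hb. }
  set (F := fun z => (K z * / D z)%C).
  assert (HFc : forall z, Cmod z < R1 -> ccont F z).
  { intros z Hz. apply ccont_mult; [|apply cdiff_ccont, Hphi, Hz].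
    destruct (classic (z = RtoC 0)) as [->|Hne]; [exact HKc|].
    apply cdiff_ccont, HKd. split; [apply Cmod_gt_0, Hne|lra]. }
  assert (E : circle_int F rho = (RtoC (2 * PI) * F 0)%C).
  { apply (circle_int_center F 0 R1); auto; [lra|lra|].
    intros z Hz _. apply cdiff_mult; [apply HKd; lra|apply Hphi; lra]. }
  assert (HF0 : c0 / 2 <= Cmod (F 0)).
  { unfold F. rewrite HK0. unfold D. rewrite H4, <- RtoC_mult, <- RtoC_plus.
    assert (0 <= kappa * h) by nra.
    rewrite Cmod_mult, Cmod_inv by (apply RtoC_neq0; lra).
    rewrite Cmod_R, Rabs_right by lra. fold c0. unfold Rdiv.
    apply Rmult_le_compat_l; [lra|]. apply Rinv_le_contravar; lra. }
  assert (Hbound : forall t, 0 <= t <= 2 * PI ->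
    Cmod (F (polar rho t)) <= B * (eps + / (1 + kappa / 4) * Cmod (g (polar rho t)))).
  { intros t Ht. assert (Hz : Cmod (polar rho t) = rho) by (apply Cmod_polar; lra).
    set (z := polar rho t) in *.
    assert (Hz0 : z <> 0) by (apply Cmod_pos_neq0; lra).
    pose proof (HD1 z ltac:(lra)) as HDz.
    unfold F. rewrite HK by auto.
    rewrite Cmod_mult, Cmod_div, Cmod_pow, Hz, Cmod_inv by
      (first [apply Cpow_nz; exact Hz0|apply Cmod_pos_neq0; lra]).
    assert (Hpm : / rho ^ m <= B).
    { unfold B. rewrite <- (Rinv_inv 2), pow_inv. apply Rinv_le_contravar.
      - apply pow_lt. lra.
      - apply pow_incr. lra. }
    assert (Hpm0 : 0 < / rho ^ m) by (apply Rinv_0_lt_compat, pow_lt; lra).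
    pose proof (Cmod_ge_0 (g z)) as Hgz.
    assert (Hi : 0 < / Cmod (D z)) by (apply Rinv_0_lt_compat; lra).
    assert (Hk4 : 0 < / (1 + kappa / 4)) by (apply Rinv_0_lt_compat; lra).
    replace (Cmod (g z) / rho ^ m * / Cmod (D z)) with
      (/ rho ^ m * (Cmod (g z) * / Cmod (D z))) by (unfold Rdiv; ring).
    apply Rmult_le_compat; [lra|apply Rmult_le_pos; lra|exact Hpm|].
    destruct (Rle_dec eps (v n t)) as [Hbad|Hgood].
    - specialize (H7 t Ht Hbad). specialize (HDge z). fold rho z in H7.
      assert (/ Cmod (D z) <= / (1 + kappa / 4)) by (apply Rinv_le_contravar; nra). nra.
    - assert (Hsmall : Cmod (g z) < eps).
      { apply Rnot_le_lt in Hgood. unfold v in Hgood. fold rho in Hgood. fold z in Hgood.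
        revert Hgood. unfold Rmin. destruct Rle_dec; lra. }
      assert (/ Cmod (D z) <= 1) by (rewrite <- Rinv_1; apply Rinv_le_contravar; lra).
      assert (Cmod (g z) * / Cmod (D z) <= Cmod (g z)) by nra. nra. }
  assert (Hgint : ex_RInt (fun t => Cmod (g (polar rho t))) 0 (2 * PI)).
  { apply path_cont_ex_Cmod, Hpc. lra. }
  assert (Hup : Cmod (circle_int F rho) <= B * (2 * PI * eps + / (1 + kappa / 4) * M)).
  { eapply Rle_trans.
    - apply (Cmod_cint_le (fun t => F (polar rho t))
        (fun t => scal B (plus eps (scal (/ (1 + kappa / 4)) (Cmod (g (polar rho t))))))); [lra| | |].
      + apply path_cont_circle; [lra|]. intros z Hz. apply HFc. lra.
      + apply (ex_RInt_scal (V := R_NormedModule)), (ex_RInt_plus (V := R_NormedModule));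
          [apply ex_RInt_const|apply (ex_RInt_scal (V := R_NormedModule)), Hgint].
      + exact Hbound.
    - rewrite (RInt_scal (V := R_CompleteNormedModule)).
      + rewrite (RInt_plus (V := R_CompleteNormedModule));
          [|apply ex_RInt_const|apply (ex_RInt_scal (V := R_NormedModule)), Hgint].
        rewrite (RInt_scal (V := R_CompleteNormedModule)) by exact Hgint.
        rewrite RInt_const. unfold scal, plus; simpl. unfold mult; simpl.
        apply Rmult_le_compat_l; [lra|]. rewrite Rminus_0_r. apply Rplus_le_compat_l.
        apply Rmult_le_compat_l; [left; apply Rinv_0_lt_compat; lra|]. apply HM. lra.
      + apply (ex_RInt_plus (V := R_NormedModule));
          [apply ex_RInt_const|apply (ex_RInt_scal (V := R_NormedModule)), Hgint]. }
  rewrite E, Cmod_mult, Cmod_R, Rabs_right in Hup by lra.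
  assert (Hlast : B * (/ (1 + kappa / 4) * M) <= PI * c0 / 4).
  { apply Rmult_le_reg_r with (1 + kappa / 4); [lra|].
    replace (B * (/ (1 + kappa / 4) * M) * (1 + kappa / 4)) with (B * M) by (field; lra).
    assert (PI * c0 / 4 * (kappa / 4) = B * M + PI * c0 / 16)
      by (unfold kappa; field; lra).
    assert (0 < PI * c0) by nra. nra. }
  (* The mean value is at least PI c0 from below, but at most PI c0 / 4 + PI c0 / 4 from above. *)
  assert (2 * PI * (c0 / 2) <= 2 * PI * Cmod (F 0)) by (apply Rmult_le_compat_l; lra).
  assert (2 * PI * (B * eps) <= 2 * PI * (c0 / 8)) by (apply Rmult_le_compat_l; lra).
  assert (0 < PI * c0) by nra. lra.
Qed.

(** * Reflection in two circles *)

Lemma radial_limit_eps (f : C -> C) (t : R) (L : C) : radial_limit f t L ->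
  forall e, 0 < e -> exists d, 0 < d /\ forall rho, 1 - d < rho < 1 ->
    Cmod (f (polar rho t) - L) < e.
Proof.
  intros H e He. assert (He2 : 0 < e / 2) by lra.
  destruct (H (fun w => Cmod (w - L) < e)) as [d Hd].
  { exists (mkposreal _ He2). intros w [H1 H2].
    eapply Rle_lt_trans; [apply Cmod_le_abs|].
    change (Rabs (Re w - Re L) < e / 2) in H1. change (Rabs (Im w - Im L) < e / 2) in H2.
    change (Rabs (Re w - Re L) + Rabs (Im w - Im L) < e). lra. }
  exists d. split; [apply cond_pos|]. intros rho Hrho. apply Hd; [|lra].
  change (Rabs (rho - 1) < d). apply Rabs_def1; lra.
Qed.

Lemma is_lim_seq_eps (u : nat -> R) (l : R) :
  (forall e, 0 < e -> exists n0, forall n, (n0 <= n)%nat -> Rabs (u n - l) < e) ->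
  is_lim_seq u l.
Proof.
  intros H. apply is_lim_seq_spec. intros e. destruct (H e (cond_pos e)) as [n0 Hn].
  exists n0. exact Hn.
Qed.

Lemma Rabs_Cmod_sub (a b : C) : Rabs (Cmod a - Cmod b) <= Cmod (a - b).
Proof.
  pose proof (Cmod_triangle_sub a b). pose proof (Cmod_triangle_sub b a) as H2.
  rewrite Cmod_sub_sym in H2. apply Rabs_le. lra.
Qed.

Lemma radial_limit_seq (f : C -> C) (t : R) (L : C) : radial_limit f t L ->
  is_lim_seq (fun n => Cmod (f (polar (radius n) t))) (Cmod L).
Proof.
  intros H. apply is_lim_seq_eps. intros e He.
  destruct (radial_limit_eps f t L H e He) as [d [Hd Hf]].
  destruct (radius_lim d Hd) as [n0 Hn]. exists n0. intros n Hle.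
  eapply Rle_lt_trans; [apply Rabs_Cmod_sub|]. apply Hf.
  specialize (Hn n Hle). pose proof (radius_bounds n). lra.
Qed.

(** As z approaches the unit circle radially, its mirror image q / conj z approaches an interior
    point, where plain continuity suffices. *)
Lemma reflected_radius_seq (f : C -> C) (q t : R) : 0 < q -> ccont f (polar q t) ->
  is_lim_seq (fun n => Cmod (f (polar (q / radius n) t))) (Cmod (f (polar q t))).
Proof.
  intros Hq Hf. apply is_lim_seq_eps. intros e He. destruct (Hf e He) as [d [Hd H]].
  destruct (radius_lim (d / (2 * q))) as [n0 Hn]; [apply Rdiv_lt_0_compat; lra|].
  exists n0. intros n Hle. specialize (Hn n Hle). pose proof (radius_bounds n) as Hr.
  eapply Rle_lt_trans; [apply Rabs_Cmod_sub|]. apply H.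
  eapply Rle_lt_trans; [apply polar_lipschitz; lra|].
  rewrite Rminus_diag, Rabs_R0, Rmult_0_r, Rplus_0_r.
  replace (q / radius n - q) with (q * (1 - radius n) / radius n) by (field; lra).
  rewrite Rabs_right.
  - apply Rmult_lt_reg_r with (radius n); [lra|]. unfold Rdiv.
    rewrite Rmult_assoc, Rinv_l, Rmult_1_r by lra.
    assert (q * (1 - radius n) < d / 2); [|nra].
    replace (d / 2) with (q * (d / (2 * q))) by (field; lra).
    apply Rmult_lt_compat_l; lra.
  - apply Rle_ge, Rmult_le_pos; [nra|]. left. apply Rinv_0_lt_compat. lra.
Qed.

(** A positive value would persist on an interval and bound the integral from below, whereas bounded
    convergence for the constant sequence min(1, u) makes that integral arbitrarily small. *)
Lemma continuous_ae_zero (u : R -> R) : (forall t, continuous u t) -> (forall t, 0 <= u t) ->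
  ae_circle (fun t => u t = 0) -> forall t, 0 <= t <= 2 * PI -> u t = 0.
Proof.
  intros Hc Hu Hae t0 Ht0. pose proof PI_RGT_0 as HPI.
  apply NNPP. intros Hne. assert (Hpos : 0 < u t0) by (specialize (Hu t0); lra).
  set (v := fun t => Rmin 1 (u t)).
  assert (Hvc : forall t, continuous v t).
  { intros t. apply continuous_min; [apply continuous_const|apply Hc]. }
  assert (Hv : forall t, 0 <= v t <= 1).
  { intros t. split; [apply Rmin_glb; [lra|apply Hu]|apply Rmin_l]. }
  assert (Hv0 : 0 < v t0) by (apply Rmin_pos; lra).
  destruct (continuous_eps v t0 (v t0 / 2) (Hvc t0)) as [d [Hd Hdd]]; [lra|].
  set (p := Rmax 0 (t0 - d / 2)). set (q := Rmin (2 * PI) (t0 + d / 2)).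
  assert (Hpq : 0 <= p /\ p < q /\ q <= 2 * PI /\ t0 - d / 2 <= p /\ q <= t0 + d / 2).
  { unfold p, q, Rmax, Rmin. repeat destruct Rle_dec; lra. }
  destruct (bounded_convergence (fun _ => v) (fun t => 0 <= t <= 2 * PI /\ u t <> 0) 0 (2 * PI)
    ltac:(lra) (fun _ => Hvc) (fun _ => Hv) Hae) with (delta := (q - p) * (v t0 / 2)) as [_ Hlt].
  - intros t Ht HN e He. exists O. intros _ _.
    assert (E : u t = 0) by (apply NNPP; intros H; apply HN; auto).
    unfold v. rewrite E, Rmin_right; lra.
  - apply Rmult_lt_0_compat; lra.
  - revert Hlt. apply Rle_not_lt.
    assert (Hex : forall x y, ex_RInt v x y) by (intros; apply ex_RInt_cont_all, Hvc).
    rewrite <- (RInt_Chasles v 0 p (2 * PI)), <- (RInt_Chasles v p q (2 * PI)) by auto.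
    unfold plus; simpl.
    assert (0 <= RInt v 0 p) by (apply RInt_ge_0; auto; [lra|intros; apply Hv]).
    assert (0 <= RInt v q (2 * PI)) by (apply RInt_ge_0; auto; [lra|intros; apply Hv]).
    assert ((q - p) * (v t0 / 2) <= RInt v p q); [|lra].
    replace ((q - p) * (v t0 / 2)) with (RInt (fun _ => v t0 / 2) p q)
      by (rewrite RInt_const; reflexivity).
    apply RInt_le; [lra|apply ex_RInt_const|auto|]. intros x Hx.
    specialize (Hdd x ltac:(apply Rabs_def1; lra)). apply Rabs_def2 in Hdd. lra.
Qed.

(* Equals [|f|^2 - |g|^2] on the circle [|z|^2 = q], where [q / conj z = z]. *)
Definition mirror (f g : C -> C) (q : R) (z : C) : C :=
  (f z * Cconj (f (Cconj (RtoC q / z))) - g z * Cconj (g (Cconj (RtoC q / z))))%C.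

(** Both z and q / conj z lie in the disc, and the two conjugations around each reflected factor
    leave it holomorphic in z. *)
Lemma mirror_cdiff (f g : C -> C) (q : R) (z : C) : 0 < q ->
  (forall z, Cmod z < 1 -> cdiff f z) -> (forall z, Cmod z < 1 -> cdiff g z) ->
  q < Cmod z < 1 -> cdiff (mirror f g q) z.
Proof.
  intros Hq Hf Hg Hz.
  assert (Hz0 : z <> 0) by (apply Cmod_pos_neq0; lra).
  assert (K : forall u, (forall z, Cmod z < 1 -> cdiff u z) ->
    cdiff (fun z => u z * Cconj (u (Cconj (RtoC q / z))))%C z).
  { intros u Hu. apply cdiff_mult; [apply Hu; lra|].
    apply (cdiff_comp (fun w => Cconj (u (Cconj w))) (fun z => RtoC q / z)%C).
    - apply cdiff_div; [apply cdiff_const|apply cdiff_id|exact Hz0].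
    - apply cdiff_conj_conj, Hu. rewrite Cmod_conj, Cmod_div, Cmod_R, Rabs_right by (auto; lra).
      apply Rmult_lt_reg_r with (Cmod z); [lra|]. unfold Rdiv.
      rewrite Rmult_assoc, Rinv_l by lra. lra. }
  apply cdiff_minus; apply K; auto.
Qed.

Lemma mirror_polar (f g : C -> C) (q rho t : R) : 0 < rho ->
  mirror f g q (polar rho t) =
  (f (polar rho t) * Cconj (f (polar (q / rho) t))
   - g (polar rho t) * Cconj (g (polar (q / rho) t)))%C.
Proof.
  intros Hr. unfold mirror.
  assert (E : Cconj (RtoC q / polar rho t) = polar (q / rho) t).
  { rewrite <- (Cconj_conj (polar (q / rho) t)). f_equal. rewrite polar_conj.
    assert (Hn : polar rho t <> 0) by (apply Cmod_pos_neq0; rewrite Cmod_polar; lra).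
    replace (RtoC q) with (polar (q / rho) (- t) * polar rho t)%C.
    - field. exact Hn.
    - rewrite polar_mult, <- polar_0. f_equal; [field; lra|ring]. }
  rewrite E. reflexivity.
Qed.

Lemma mult_conj_sub (a b : C) :
  (a * Cconj a - b * Cconj b)%C = RtoC (Cmod a ^ 2 - Cmod b ^ 2).
Proof. rewrite RtoC_minus, !Cmod2_conj. reflexivity. Qed.

(** * Orders of vanishing under dilation *)

Lemma leading_seq (u : C -> C) (a : C) (m : nat) (q : R) : 0 < q <= 1 ->
  (forall e, 0 < e -> exists d, 0 < d /\
     forall z, Cmod z < d -> Cmod (u z - a * z ^ m) <= e * Cmod z ^ m) ->
  is_lim_seq (fun n => Cmod (u (RtoC (q * (1 - radius n)))) / (1 - radius n) ^ m) (q ^ m * Cmod a).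
Proof.
  intros Hq H. apply is_lim_seq_eps. intros e He.
  destruct (H (e / 2)) as [d [Hd Hu]]; [lra|].
  destruct (radius_lim d Hd) as [n0 Hn]. exists n0. intros n Hle. specialize (Hn n Hle).
  pose proof (radius_bounds n) as Hr. set (x := 1 - radius n) in *.
  assert (Hx : 0 < x) by (unfold x; lra).
  assert (Hxm : 0 < x ^ m) by (apply pow_lt, Hx).
  assert (Hqx : Cmod (RtoC (q * x)) = q * x) by (rewrite Cmod_R; apply Rabs_right; nra).
  specialize (Hu (RtoC (q * x))). rewrite Hqx in Hu.
  assert (Hxd : x < d) by (unfold x; lra).
  specialize (Hu ltac:(clearbody x; nra)).
  pose proof (Rabs_Cmod_sub (u (RtoC (q * x))) (a * RtoC (q * x) ^ m)%C) as A.
  rewrite Cmod_mult, Cmod_pow, Hqx in A.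
  replace (Cmod (u (RtoC (q * x))) / x ^ m - q ^ m * Cmod a) with
    ((Cmod (u (RtoC (q * x))) - Cmod a * (q * x) ^ m) / x ^ m)
    by (rewrite Rpow_mult_distr; field; lra).
  unfold Rdiv. rewrite Rabs_mult, (Rabs_right (/ x ^ m))
    by (apply Rle_ge; left; apply Rinv_0_lt_compat; auto).
  apply Rle_lt_trans with (e / 2); [|lra].
  apply Rmult_le_reg_r with (x ^ m); [auto|].
  rewrite Rmult_assoc, Rinv_l, Rmult_1_r by lra.
  eapply Rle_trans; [exact A|]. eapply Rle_trans; [exact Hu|].
  rewrite Rpow_mult_distr.
  assert (q ^ m <= 1) by (rewrite <- (pow1 m); apply pow_incr; lra).
  assert (0 < q ^ m) by (apply pow_lt; lra). apply Rmult_le_compat_l; [lra|]. clearbody x. nra.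
Qed.

Lemma pow_inj_lt1 (q : R) (m k : nat) : 0 < q < 1 -> q ^ m = q ^ k -> m = k.
Proof.
  intros Hq.
  assert (W : forall m k, (m < k)%nat -> q ^ m <> q ^ k).
  { intros a b Hab E. replace b with (a + S (b - S a))%nat in E by lia.
    rewrite pow_add in E. assert (0 < q ^ a) by (apply pow_lt; lra).
    pose proof (pow_lt_1_compat q (S (b - S a)) ltac:(lra) ltac:(lia)). nra. }
  intros E. destruct (Nat.lt_trichotomy m k) as [H|[H|H]]; [|exact H|];
    exfalso; [apply (W m k H E)|apply (W k m H); auto].
Qed.

(** Take moduli in the functional equation at a small x > 0, divide by x^(m + k) and let x tend to
    0: |a| |b| q^k = |a| |b| q^m. *)
Lemma order_unique (u v : C -> C) (a b : C) (m k : nat) (q : R) : 0 < q < 1 ->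
  a <> 0 -> b <> 0 ->
  (forall e, 0 < e -> exists d, 0 < d /\
     forall z, Cmod z < d -> Cmod (u z - a * z ^ m) <= e * Cmod z ^ m) ->
  (forall e, 0 < e -> exists d, 0 < d /\
     forall z, Cmod z < d -> Cmod (v z - b * z ^ k) <= e * Cmod z ^ k) ->
  (forall z, Cmod z < 1 -> (u z * v (RtoC q * z) = v z * u (RtoC q * z))%C) ->
  m = k.
Proof.
  intros Hq Ha Hb Hu Hv H.
  apply Cmod_gt_0 in Ha. apply Cmod_gt_0 in Hb.
  pose proof (is_lim_seq_mult' _ _ _ _ (leading_seq u a m 1 ltac:(lra) Hu)
    (leading_seq v b k q ltac:(lra) Hv)) as L1.
  pose proof (is_lim_seq_mult' _ _ _ _ (leading_seq v b k 1 ltac:(lra) Hv)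
    (leading_seq u a m q ltac:(lra) Hu)) as L2.
  apply (is_lim_seq_ext _ (fun n => Cmod (v (RtoC (1 * (1 - radius n)))) / (1 - radius n) ^ k *
     (Cmod (u (RtoC (q * (1 - radius n)))) / (1 - radius n) ^ m))) in L1.
  - apply is_lim_seq_unique in L1. apply is_lim_seq_unique in L2. rewrite L1 in L2.
    injection L2 as E. rewrite !pow1 in E.
    apply (pow_inj_lt1 q m k Hq).
    apply Rmult_eq_reg_r with (Cmod a * Cmod b); [|nra]. lra.
  - intros n. pose proof (radius_bounds n). set (x := 1 - radius n).
    assert (Hx : 0 < x <= 1 / 2) by (unfold x; lra).
    assert (0 < x ^ m) by (apply pow_lt; lra). assert (0 < x ^ k) by (apply pow_lt; lra).
    specialize (H (RtoC x)). rewrite Cmod_R, Rabs_right in H by lra.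
    specialize (H ltac:(lra)). rewrite <- RtoC_mult in H. rewrite Rmult_1_l.
    apply (f_equal Cmod) in H. rewrite !Cmod_mult in H.
    unfold Rdiv.
    transitivity (Cmod (u (RtoC x)) * Cmod (v (RtoC (q * x))) * (/ x ^ m * / x ^ k)); [ring|].
    rewrite H. ring.
Qed.

Theorem theorem2p6 (f g : C -> C) (r : R) :
  H1 f -> H1 g -> 0 < r < 1 ->
  ae_circle (fun t => exists Lf Lg : C,
     radial_limit f t Lf /\ radial_limit g t Lg /\ Cmod Lf = Cmod Lg) ->
  ae_circle (fun t => Cmod (f (polar r t)) = Cmod (g (polar r t))) ->
  exists lambda : C, Cmod lambda = 1 /\
    forall z : C, Cmod z < 1 -> f z = Cmult lambda (g z).
Proof.
  intros [Hfh [Mf HMf]] [Hgh [Mg HMg]] Hr HT Hrr. pose proof PI_RGT_0 as HPI.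
  assert (Hf : forall z, Cmod z < 1 -> cdiff f z) by (intros; apply ex_derive_cdiff; auto).
  assert (Hg : forall z, Cmod z < 1 -> cdiff g z) by (intros; apply ex_derive_cdiff; auto).
  clear Hfh Hgh HMg Mg.
  assert (Hpf : path_cont (fun t => f (polar r t))).
  { apply path_cont_circle; [lra|]. intros z Hz. apply cdiff_ccont, Hf. lra. }
  assert (Hpg : path_cont (fun t => g (polar r t))).
  { apply path_cont_circle; [lra|]. intros z Hz. apply cdiff_ccont, Hg. lra. }
  (* Inside the disc both moduli are continuous, so the almost everywhere equality holds everywhere
     on the circle. *)
  assert (Hcirc : forall t, 0 <= t <= 2 * PI -> Cmod (f (polar r t)) = Cmod (g (polar r t))).
  { intros t Ht.
    assert (E : Rabs (Cmod (f (polar r t)) - Cmod (g (polar r t))) = 0).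
    { apply (continuous_ae_zero (fun t => Rabs (Cmod (f (polar r t)) - Cmod (g (polar r t)))));
        auto using Rabs_pos.
      - intros s. apply continuous_comp with (g := Rabs).
        + apply (continuous_minus (V := R_NormedModule));
            [apply (path_cont_Cmod _ s Hpf)|apply (path_cont_Cmod _ s Hpg)].
        + apply continuous_Rabs.
      - revert Hrr. apply null_set_mono. intros x [Hx Hne]. split; [auto|]. intros Heq. apply Hne.
        rewrite Heq, Rminus_diag. apply Rabs_R0. }
    apply Rabs_eq_0 in E. lra. }
  assert (Hvan : forall u : C -> C, (forall z, Cmod z < 1 -> cdiff u z) ->
    (forall t0, exists d, 0 < d /\ forall t, 0 < Rabs (t - t0) < d -> u (polar r t) <> 0) \/
    (forall z, Cmod z < 1 -> u z = 0)).
  { intros u Hu. destruct (circle_zeros_isolated u 0 1 r) as [H|H]; [lra|lra| | |left; exact H].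
    - intros z Hz. apply Hu. lra.
    - right. apply (identity_disc u (polar r 0) Hu); [rewrite Cmod_polar; lra|].
      intros d Hd. set (x := r - Rmin d r / 2).
      assert (0 < Rmin d r) by (apply Rmin_pos; lra).
      pose proof (Rmin_l d r). pose proof (Rmin_r d r).
      exists (RtoC x). rewrite polar_0, <- RtoC_minus, Cmod_R, Rabs_left by (unfold x; lra).
      split; [unfold x; lra|]. apply H. rewrite Cmod_R, Rabs_right; unfold x; lra. }
  (* PI serves as base angle because it is interior to [0, 2 PI]; an isolation statement there is
     refuted by a single nearby angle. *)
  assert (Hnear : forall d, 0 < d -> exists t, 0 <= t <= 2 * PI /\ 0 < Rabs (t - PI) < d).
  { intros d Hd. assert (0 < Rmin d PI) by (apply Rmin_pos; lra).
    pose proof (Rmin_l d PI). pose proof (Rmin_r d PI).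
    exists (PI + Rmin d PI / 2). split; [lra|]. rewrite Rabs_right; lra. }
  assert (Hvan' : forall u : C -> C, (forall z, Cmod z < 1 -> cdiff u z) ->
    (forall t, 0 <= t <= 2 * PI -> u (polar r t) = 0) -> forall z, Cmod z < 1 -> u z = 0).
  { intros u Hu H. destruct (Hvan u Hu) as [K|K]; [|exact K]. exfalso.
    destruct (K PI) as [d [Hd Kd]]. destruct (Hnear d Hd) as [t [Ht1 Ht2]].
    apply (Kd t Ht2), H, Ht1. }
  destruct (classic (forall z, Cmod z < 1 -> f z = 0)) as [Hf0|Hf0].
  { exists (RtoC 1). split; [apply Cmod_1|]. intros z Hz. rewrite Hf0 by auto.
    rewrite (Hvan' g Hg); [ring| |auto]. intros t Ht. apply Cmod_eq_0.
    rewrite <- Hcirc by auto. rewrite Hf0 by (rewrite Cmod_polar; lra). apply Cmod_0. }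
  assert (Hg0 : ~ forall z, Cmod z < 1 -> g z = 0).
  { intros H. apply Hf0, (Hvan' f Hf). intros t Ht. apply Cmod_eq_0.
    rewrite Hcirc by auto. rewrite H by (rewrite Cmod_polar; lra). apply Cmod_0. }
  set (q := r * r). assert (Hq : 0 < q < r) by (unfold q; nra).
  assert (Hm1 : forall z, q < Cmod z < 1 -> mirror f g q z = 0).
  { destruct (circle_zeros_isolated (mirror f g q) q 1 r) as [H|H]; auto; [lra|lra| |].
    { intros z Hz. apply mirror_cdiff; auto; lra. }
    exfalso. destruct (H PI) as [d [Hd Kd]]. destruct (Hnear d Hd) as [t [Ht1 Ht2]].
    apply (Kd t Ht2). rewrite mirror_polar by lra.
    replace (q / r) with r by (unfold q; field; lra).
    rewrite mult_conj_sub, Hcirc by auto. f_equal. ring. }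
  assert (Hm2 : forall z, q * q < Cmod z < 1 -> mirror f g (q * q) z = 0).
  { destruct (circle_zeros_isolated (mirror f g (q * q)) (q * q) 1 q) as [H|H]; auto; [nra|nra| |].
    { intros z Hz. apply mirror_cdiff; auto; nra. }
    exfalso. apply Hf0.
    (* If the mirror function had isolated zeros on q T, then |f| and |g| would differ there at all
       but finitely many angles. Adding these angles to the null set, the radial limit of f is 0 at
       every other angle. *)
    destruct (isolated_finite (fun t => mirror f g (q * q) (polar q t) = 0) 0 (2 * PI) H)
      as [l Hl].
    apply (hardy_uniqueness f Mf _ Hf HMf (null_set_add_list _ l HT)).
    intros t Ht HN e He.
    assert (Hgood : exists Lf Lg : C,
      radial_limit f t Lf /\ radial_limit g t Lg /\ Cmod Lf = Cmod Lg).
    { apply NNPP. intros Hno. apply HN. right. auto. }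
    destruct Hgood as [Lf [Lg [HLf [HLg HL]]]].
    assert (Hne : Cmod (f (polar q t)) <> Cmod (g (polar q t))).
    { intros E. apply HN. left. apply Hl; [auto|]. rewrite mirror_polar by lra.
      replace (q * q / q) with q by (field; lra).
      rewrite mult_conj_sub, E. f_equal. ring. }
    assert (Hcq : forall u, (forall z, Cmod z < 1 -> cdiff u z) -> ccont u (polar q t)).
    { intros u Hu. apply cdiff_ccont, Hu. rewrite Cmod_polar; lra. }
    pose proof (is_lim_seq_mult' _ _ _ _ (radial_limit_seq f t Lf HLf)
      (reflected_radius_seq f q t ltac:(lra) (Hcq f Hf))) as A1.
    pose proof (is_lim_seq_mult' _ _ _ _ (radial_limit_seq g t Lg HLg)
      (reflected_radius_seq g q t ltac:(lra) (Hcq g Hg))) as A2.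
    assert (Hloc : is_lim_seq (fun n => Cmod (g (polar (radius n) t)) *
       Cmod (g (polar (q / radius n) t))) (Cmod Lf * Cmod (f (polar q t)))).
    { apply (is_lim_seq_ext_loc (fun n => Cmod (f (polar (radius n) t)) *
         Cmod (f (polar (q / radius n) t)))); [|exact A1].
      (* The first reflection identity is available only once the radius exceeds q. *)
      destruct (radius_lim (1 - q)) as [n0 Hn0]; [lra|]. exists n0. intros n Hn.
      specialize (Hn0 n Hn). pose proof (radius_bounds n) as Hb.
      pose proof (Hm1 (polar (radius n) t)) as E. rewrite Cmod_polar in E by lra.
      specialize (E ltac:(lra)). rewrite mirror_polar in E by lra.
      rewrite <- (Cmod_conj (f (polar (q / radius n) t))).
      rewrite <- (Cmod_conj (g (polar (q / radius n) t))).
      rewrite <- !Cmod_mult. f_equal.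
      match type of E with (?a - ?b)%C = _ => replace a with ((a - b) + b)%C by ring end.
      rewrite E. ring. }
    apply is_lim_seq_unique in Hloc. apply is_lim_seq_unique in A2. rewrite Hloc in A2.
    injection A2 as A2. rewrite <- HL in A2.
    assert (HL0 : Cmod Lf = 0).
    { apply NNPP. intros Hn. apply Hne. apply Rmult_eq_reg_l in A2; auto. }
    apply Cmod_eq_0 in HL0. subst Lf.
    destruct (radial_limit_eps f t _ HLf e He) as [d [Hd Hfd]].
    destruct (radius_lim d Hd) as [n0 Hn0]. exists n0. intros n Hn.
    replace (f (polar (radius n) t)) with (f (polar (radius n) t) - 0)%C by ring.
    apply Hfd. specialize (Hn0 n Hn). pose proof (radius_bounds n). lra. }
  assert (Hqc : forall u, (forall z, Cmod z < 1 -> cdiff u z) -> forall z, Cmod z < 1 ->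
    cdiff (fun z => u (RtoC q * z)%C) z).
  { intros u Hu z Hz. apply (cdiff_comp u (fun z => RtoC q * z)%C).
    - apply cdiff_mult; [apply cdiff_const|apply cdiff_id].
    - apply Hu. rewrite Cmod_mult, Cmod_R, Rabs_right by lra. pose proof (Cmod_ge_0 z). nra. }
  assert (Hscale : forall z, Cmod z < 1 ->
    (f z * g (RtoC q * z) - g z * f (RtoC q * z))%C = 0).
  { set (D := fun z => (f z * g (RtoC q * z) - g z * f (RtoC q * z))%C).
    destruct (Hvan D) as [HD|HD]; [| |exact HD].
    { intros z Hz. apply cdiff_minus; apply cdiff_mult; auto. }
    (* It suffices to find angles near PI at which D vanishes; they are taken where f is nonzero, so
       that conj f can be divided out. *)
    exfalso. destruct (Hvan f Hf) as [Kf|Kf]; [|auto].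
    destruct (HD PI) as [d1 [Hd1 K1]]. destruct (Kf PI) as [d2 [Hd2 K2]].
    destruct (Hnear (Rmin d1 d2)) as [t [_ [Ht1 Ht2]]]; [apply Rmin_pos; auto|].
    assert (Hfz : f (polar r t) <> 0).
    { apply K2. split; [auto|]. eapply Rlt_le_trans; [exact Ht2|apply Rmin_r]. }
    apply (K1 t). { split; [auto|]. eapply Rlt_le_trans; [exact Ht2|apply Rmin_l]. }
    pose proof (Hm1 (polar r t)) as E1. pose proof (Hm2 (polar r t)) as E2.
    rewrite Cmod_polar in E1, E2 by lra. specialize (E1 ltac:(lra)). specialize (E2 ltac:(nra)).
    rewrite mirror_polar in E1, E2 by lra.
    replace (q / r) with r in E1 by (unfold q; field; lra).
    replace (q * q / r) with (q * r) in E2 by (unfold q; field; lra).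
    assert (Ez : (RtoC q * polar r t)%C = polar (q * r) t).
    { rewrite <- (polar_0 q), polar_mult, Rplus_0_l. reflexivity. }
    unfold D. rewrite Ez. set (z := polar r t) in *. set (w := polar (q * r) t) in *.
    apply (f_equal Cconj) in E1. apply (f_equal Cconj) in E2.
    rewrite !Cminus_conj, !Cmult_conj, !Cconj_conj in E1, E2.
    assert (Hcf : Cconj (f z) <> 0).
    { intros E. apply Hfz. rewrite <- (Cconj_conj (f z)), E. unfold Cconj, RtoC; simpl.
      f_equal; ring. }
    assert (Hc0 : Cconj (RtoC 0) = RtoC 0) by (unfold Cconj, RtoC; simpl; f_equal; ring).
    rewrite Hc0 in E1, E2.
    (* On r T the first identity pairs z with itself and the second pairs z with w = q z;
       eliminating conj g(z) leaves conj f(z) times the wanted difference. *)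
    replace (f z * g w - g z * f w)%C with
      (((Cconj (f z) * f z - Cconj (g z) * g z) * g w
        - g z * (Cconj (f z) * f w - Cconj (g z) * g w)) / Cconj (f z))%C by (field; auto).
    rewrite E1, E2. field. auto. }
  destruct (zero_order f 1 Rlt_0_1 Hf) as [[d [Hd H]]|[m [a [Ha Hfa]]]].
  { exfalso. apply Hf0, (identity_disc_0 f d); auto. }
  destruct (zero_order g 1 Rlt_0_1 Hg) as [[d [Hd H]]|[k [b [Hb Hgb]]]].
  { exfalso. apply Hg0, (identity_disc_0 g d); auto. }
  assert (Hsw : forall u v w x : C, (u * v - w * x)%C = 0 -> (u * v)%C = (w * x)%C).
  { intros u v w x E. replace (u * v)%C with ((u * v - w * x) + w * x)%C by ring.
    rewrite E. ring. }
  assert (Emk : m = k).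
  { apply (order_unique f g a b m k q); auto; lra. }
  subst k.
  set (F := fun z => (b * f z - a * g z)%C).
  assert (HF : forall z, Cmod z < 1 -> cdiff F z).
  { intros z Hz. apply cdiff_minus; apply cdiff_mult; auto using cdiff_const. }
  assert (HF0 : forall z, Cmod z < 1 -> F z = 0).
  { destruct (zero_order F 1 Rlt_0_1 HF) as [[d [Hd H]]|[j [c [Hc HFc]]]].
    { apply (identity_disc_0 F d); auto. }
    exfalso.
    assert (Ej : j = m).
    (* The functional equation is linear in its first function and trivial for the pair (g, g), so F
       inherits it. *)
    { apply (order_unique F g c b j m q); auto; [lra|]. intros z Hz. unfold F.
      pose proof (Hsw _ _ _ _ (Hscale z Hz)) as E.
      transitivity (b * (f z * g (RtoC q * z)) - a * (g z * g (RtoC q * z)))%C; [ring|].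
      rewrite E. ring. }
    subst j. apply Cmod_gt_0 in Hc. set (A := Cmod a + Cmod b + 1).
    pose proof (Cmod_ge_0 a). pose proof (Cmod_ge_0 b).
    (* The order m terms of b f and a g cancel in F, so |c| x^m <= (|a| + |b| + 1) e x^m = |c| x^m /
       2, which is absurd. *)
    set (e := Cmod c / (2 * A)).
    assert (He : 0 < e) by (apply Rdiv_lt_0_compat; unfold A; lra).
    assert (HeA : e * A = Cmod c / 2) by (unfold e; field; unfold A; lra).
    destruct (Hfa e He) as [d1 [Hd1 B1]]. destruct (Hgb e He) as [d2 [Hd2 B2]].
    destruct (HFc e He) as [d3 [Hd3 B3]].
    set (x := Rmin d1 (Rmin d2 d3) / 2).
    assert (Hx : 0 < Rmin d1 (Rmin d2 d3)) by (repeat apply Rmin_pos; auto).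
    pose proof (Rmin_l d1 (Rmin d2 d3)). pose proof (Rmin_r d1 (Rmin d2 d3)).
    pose proof (Rmin_l d2 d3). pose proof (Rmin_r d2 d3).
    assert (Hxm : Cmod (RtoC x) = x) by (rewrite Cmod_R; apply Rabs_right; unfold x; lra).
    specialize (B1 (RtoC x)). specialize (B2 (RtoC x)). specialize (B3 (RtoC x)).
    rewrite Hxm in B1, B2, B3.
    specialize (B1 ltac:(unfold x; lra)). specialize (B2 ltac:(unfold x; lra)).
    specialize (B3 ltac:(unfold x; lra)).
    set (y := RtoC x) in *. assert (Hpx : 0 < x ^ m) by (apply pow_lt; unfold x; lra).
    assert (E : (c * y ^ m)%C = (b * (f y - a * y ^ m) - (a * (g y - b * y ^ m)
      + (F y - c * y ^ m)))%C) by (unfold F; ring).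
    apply (f_equal Cmod) in E. rewrite Cmod_mult, Cmod_pow in E.
    rewrite Hxm in E.
    pose proof (Cmod_minus_le (b * (f y - a * y ^ m)) (a * (g y - b * y ^ m)
      + (F y - c * y ^ m))%C) as T1.
    pose proof (Cmod_triangle (a * (g y - b * y ^ m)) (F y - c * y ^ m)) as T2.
    rewrite Cmod_mult in T1, T2.
    assert (Cmod b * Cmod (f y - a * y ^ m) <= Cmod b * (e * x ^ m))
      by (apply Rmult_le_compat_l; auto).
    assert (Cmod a * Cmod (g y - b * y ^ m) <= Cmod a * (e * x ^ m))
      by (apply Rmult_le_compat_l; auto).
    assert (Cmod c * x ^ m <= e * A * x ^ m).
    { replace (e * A * x ^ m) with (Cmod b * (e * x ^ m) + (Cmod a * (e * x ^ m) + e * x ^ m))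
        by (unfold A; ring). lra. }
    rewrite HeA in *. nra. }
  assert (Hfg : forall z, Cmod z < 1 -> f z = (a / b * g z)%C).
  { intros z Hz. specialize (HF0 z Hz). unfold F in HF0.
    replace (f z) with ((b * f z - a * g z) / b + a / b * g z)%C by (field; auto).
    rewrite HF0. field. auto. }
  exists (a / b)%C. split; [|exact Hfg].
  destruct (Hvan g Hg) as [Kg|Kg]; [|exfalso; auto].
  (* The modulus of the constant is read off at a point of r T where g is nonzero. *)
  destruct (Kg PI) as [d [Hd K]]. destruct (Hnear d Hd) as [t [Ht1 Ht2]].
  specialize (K t Ht2). specialize (Hcirc t Ht1).
  rewrite Hfg, Cmod_mult in Hcirc by (rewrite Cmod_polar; lra).
  apply Cmod_gt_0 in K. apply Rmult_eq_reg_r with (Cmod (g (polar r t))); lra.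
Qed.
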